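(* There is an algorithm which, given the functional graphs $\mathcal{G}$ and $\mathcal{H}$ of two quadratic polynomials over $\mathbb{F}_q$ (so each graph has $n=q$ vertices), decides whether $\mathcal{G}$ and $\mathcal{H}$ are isomorphic as directed graphs, and which has linear time and memory complexities. (The algorithm consists of three phases: identifying the connected components of each graph with their cycles and attached trees; producing a canonical bit-string encoding of each component; and comparing the encodings of $\mathcal{G}$ and $\mathcal{H}$ by means of a trie with counters.)
   Context: For a function $f$ from a finite set $V$ to itself, its functional graph is the directed graph on $V$ with an edge $u\to v$ if and only if $f(u)=v$ (loops allowed). Each connected component contains exactly one directed cycle (possibly a loop), with trees attached to cycle vertices. A quadratic polynomial is a polynomial of degree $2$ in $\mathbb{F}_q[X]$. ''Linear'' complexity means linear in the size of the input; the input graph on $n$ vertices is given as an adjacency list, which has $n$ arcs and size of order $n\log n$ bits. A trie (prefix tree) is the rooted tree whose nodes are the prefixes of the stored strings; here each node carries a counter of the number of stored strings that terminate there. *)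

(* Defs.v *)
From HB Require Import structures.
From mathcomp Require Import all_boot all_order all_algebra.
Set Implicit Arguments.
Unset Strict Implicit.
Unset Printing Implicit Defensive.

Definition func_graph (V : finType) (f : V -> V) : rel V :=
  fun u v => f u == v.

Definition digraph_iso (V W : finType) (e : rel V) (e' : rel W) : Prop :=
  exists2 phi : V -> W, bijective phi & forall u v, e u v = e' (phi u) (phi v).

(* [a] is the adjacency list of a digraph all of whose out-degrees are 1, for
   some (arbitrary) numbering [l] of its vertices by 0, ..., #|V| - 1: entry
   [l u] is the number of the only out-neighbour of [u]. *)
Definition adjacency_list (V : finType) (e : rel V) (a : seq nat) : Prop :=
  size a = #|V| /\
  exists2 l : V -> 'I_#|V|, bijective l &
    forall u v, e u v = (nth 0 a (l u) == l v :> nat).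

(* Size in bits of an adjacency list: one vertex number per arc. *)
Definition bit_size (a : seq nat) : nat := size a * up_log 2 (size a).

(* Word RAM, with structured control flow. A program is a fixed finite piece of
   syntax using finitely many registers; it is independent of the input and of
   the word length. *)
Inductive test : Type :=
| TEq of nat & nat
| TLt of nat & nat.

Inductive cmd : Type :=
| Skip
| Const of nat & nat          (* r_i := k            *)
| Move of nat & nat           (* r_i := r_j          *)
| Add of nat & nat & nat      (* r_i := r_j + r_k    *)
| Sub of nat & nat & nat      (* r_i := r_j - r_k, truncated at 0 *)
| Read of nat & nat           (* r_i := M[r_j]       *)
| Write of nat & nat          (* M[r_i] := r_j       *)
| Seq of cmd & cmd
| If of test & cmd & cmd
| While of test & cmd.

Record state : Type := State { reg : nat -> nat; mem : nat -> nat }.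

Definition upd (m : nat -> nat) (i x : nat) : nat -> nat :=
  fun j => if j == i then x else m j.

Definition set_reg (s : state) (i x : nat) : state :=
  State (upd (reg s) i x) (mem s).

Definition set_mem (s : state) (a x : nat) : state :=
  State (reg s) (upd (mem s) a x).

Definition eval_test (b : test) (s : state) : bool :=
  match b with
  | TEq i j => reg s i == reg s j
  | TLt i j => reg s i < reg s j
  end.

(* [exec m w c s t s']: on a machine whose memory has [m] words of [w] bits,
   [c] started in [s] halts in [s'] after [t] instructions and tests. There is
   no rule for an overflow or for an access outside the memory, so such an
   execution does not count as halting. *)
Inductive exec (m w : nat) : cmd -> state -> nat -> state -> Prop :=
| ExecSkip s : exec m w Skip s 1 s
| ExecConst i k s : k < 2 ^ w -> exec m w (Const i k) s 1 (set_reg s i k)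
| ExecMove i j s : exec m w (Move i j) s 1 (set_reg s i (reg s j))
| ExecAdd i j k s : reg s j + reg s k < 2 ^ w ->
    exec m w (Add i j k) s 1 (set_reg s i (reg s j + reg s k))
| ExecSub i j k s :
    exec m w (Sub i j k) s 1 (set_reg s i (reg s j - reg s k))
| ExecRead i j s : reg s j < m ->
    exec m w (Read i j) s 1 (set_reg s i (mem s (reg s j)))
| ExecWrite i j s : reg s i < m ->
    exec m w (Write i j) s 1 (set_mem s (reg s i) (reg s j))
| ExecSeq c1 c2 s1 t1 s2 t2 s3 :
    exec m w c1 s1 t1 s2 -> exec m w c2 s2 t2 s3 ->
    exec m w (Seq c1 c2) s1 (t1 + t2) s3
| ExecIfTrue b c1 c2 s t s' : eval_test b s -> exec m w c1 s t s' ->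
    exec m w (If b c1 c2) s t.+1 s'
| ExecIfFalse b c1 c2 s t s' : ~~ eval_test b s -> exec m w c2 s t s' ->
    exec m w (If b c1 c2) s t.+1 s'
| ExecWhileFalse b c s : ~~ eval_test b s -> exec m w (While b c) s 1 s
| ExecWhileTrue b c s1 t1 s2 t2 s3 : eval_test b s1 ->
    exec m w c s1 t1 s2 -> exec m w (While b c) s2 t2 s3 ->
    exec m w (While b c) s1 (t1 + t2).+1 s3.

(* All registers of [c] are among r_0, ..., r_(num_regs c - 1). *)
Definition num_regs_test (b : test) : nat :=
  match b with TEq i j | TLt i j => maxn i.+1 j.+1 end.

Fixpoint num_regs (c : cmd) : nat :=
  match c with
  | Skip => 0
  | Const i _ => i.+1
  | Move i j | Read i j | Write i j => maxn i.+1 j.+1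
  | Add i j k | Sub i j k => maxn i.+1 (maxn j.+1 k.+1)
  | Seq c1 c2 => maxn (num_regs c1) (num_regs c2)
  | If b c1 c2 => maxn (num_regs_test b) (maxn (num_regs c1) (num_regs c2))
  | While b c => maxn (num_regs_test b) (num_regs c)
  end.

(* The two adjacency lists are stored contiguously, preceded by the number of
   vertices; everything else is initially 0. *)
Definition input_words (a b : seq nat) : seq nat := size a :: a ++ b.

Definition initial_state (a b : seq nat) : state :=
  State (fun=> 0) (nth 0 (input_words a b)).

(* The input has to fit in the machine. The answer is read off r_0. *)
Definition computes (m w : nat) (P : cmd) (a b : seq nat) (t : nat)
    (ans : bool) : Prop :=
  [/\ size (input_words a b) <= m, all (fun x => x < 2 ^ w) (input_words a b) &
      exists2 s, exec m w P (initial_state a b) t s & reg s 0 = ans].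

(* Bit complexities: an instruction on w-bit words and w-bit addresses is
   charged w (logarithmic cost criterion), and every word is charged w, the
   registers included. *)
Definition bit_time (w t : nat) : nat := t * w.

Definition bit_memory (m w : nat) (P : cmd) : nat := (m + num_regs P) * w.

(* Main.v *)
(** A quadratic polynomial takes each value at most twice, so the trees of its
    functional graph are at most binary.  Number the vertices of both graphs
    jointly.  Bottom-up, each vertex all of whose children are named receives
    as its class a number standing for the unordered pair of the classes of its
    children, so that two trees are isomorphic iff their roots have the same
    class.  Processing the classes in increasing order, all the vertices whose
    larger child class is [a] are met while [a] is processed, and an array
    indexed by the smaller child class and stamped with [a] plays the role of
    one node of a trie; no sorting is needed and the total work is linear.

    The vertices left without a class are those on the cycles.  Labelling each
    of them with the class of the tree attached to it, the two-pointer
    algorithm finds a lexicographically least rotation of each cyclic word in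
    linear time.  Each cycle is cut there, the cut being recorded by a special
    leaf below the first vertex; this turns every component into a rooted tree
    that determines it.  Naming again the classes of the resulting forest, the
    graphs are isomorphic iff each class has as many roots in both. *)

Require Import Defs.
From HB Require Import structures.
From mathcomp Require Import all_boot all_order all_algebra zify.
Set Implicit Arguments.
Unset Strict Implicit.
Unset Printing Implicit Defensive.

(** * Structured programs on the word RAM *)

(** The result must not depend on the choices made by the program. A cyclic word with a proper
    period has several least rotations, but all of them read the same infinite word. That word does
    not determine the length of the cycle; the cut leaf, which occurs once per cycle, does. Together
    they fix all the classes around the cycle, whichever of these rotations is used for the cut. No
    search for cycles is made: a vertex on a cycle waits forever for its child on the same cycle, so
    it is never named. Time is handled by credits carried in the loop invariants, which also give
    termination. The programs are verified in a small language of variables and arrays whose rules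
    count machine steps. Each array has [2n + 4] entries: 0 and [2n + 1] are pseudo-vertices
    (missing child, cut leaf), and the classes run up to [2n + 2]. *)

Inductive expr : Type :=
| Var of nat
| Cst of nat
| Plus of expr & expr
| Minus of expr & expr
| Get of nat & expr.

Inductive cond : Type :=
| CEq of expr & expr
| CLt of expr & expr.

Record hstate := HState { var : nat -> nat; arr : nat -> nat -> nat }.

Fixpoint eval (s : hstate) (e : expr) : nat :=
  match e with
  | Var i => var s i
  | Cst k => k
  | Plus e1 e2 => eval s e1 + eval s e2
  | Minus e1 e2 => eval s e1 - eval s e2
  | Get A e => arr s A (eval s e)
  end.

Definition evalc (s : hstate) (b : cond) : bool :=
  match b with
  | CEq e1 e2 => eval s e1 == eval s e2
  | CLt e1 e2 => eval s e1 < eval s e2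
  end.

(** [eqn] is used instead of [==] so that [/=] decides whether two concrete variables are the
    same. *)
Definition setv (s : hstate) (i x : nat) : hstate :=
  HState (fun j => if eqn j i then x else var s j) (arr s).

Definition seta (s : hstate) (A i x : nat) : hstate :=
  HState (var s) (fun B => if eqn B A then upd (arr s A) i x else arr s B).

(* Registers: the variables, then the base addresses of the arrays, then a stack
   of temporaries. *)
Definition nvars := 24.
Definition narrs := 12.
Definition tmp (d : nat) : nat := nvars + narrs + d.

Fixpoint compile (d : nat) (e : expr) : cmd :=
  match e with
  | Var i => Move (tmp d) i
  | Cst k => Const (tmp d) k
  | Plus e1 e2 =>
      Seq (compile d e1) (Seq (compile d.+1 e2) (Add (tmp d) (tmp d) (tmp d.+1)))
  | Minus e1 e2 =>
      Seq (compile d e1) (Seq (compile d.+1 e2) (Defs.Sub (tmp d) (tmp d) (tmp d.+1)))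
  | Get A e1 =>
      Seq (compile d e1)
          (Seq (Add (tmp d) (tmp d) (nvars + A)) (Read (tmp d) (tmp d)))
  end.

Fixpoint cost (e : expr) : nat :=
  match e with
  | Var _ | Cst _ => 1
  | Plus e1 e2 | Minus e1 e2 => (cost e1 + cost e2).+1
  | Get _ e1 => (cost e1).+2
  end.

Definition assign (x : nat) (e : expr) : cmd :=
  Seq (compile 0 e) (Move x (tmp 0)).

Definition store (A : nat) (e1 e2 : expr) : cmd :=
  Seq (compile 0 e1) (Seq (compile 1 e2)
    (Seq (Add (tmp 0) (tmp 0) (nvars + A)) (Write (tmp 0) (tmp 1)))).

Definition load_cond (b : cond) : cmd :=
  match b with CEq e1 e2 | CLt e1 e2 => Seq (compile 0 e1) (compile 1 e2) end.

Definition test_of (b : cond) : test :=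
  match b with
  | CEq _ _ => TEq (tmp 0) (tmp 1)
  | CLt _ _ => TLt (tmp 0) (tmp 1)
  end.

Definition costc (b : cond) : nat :=
  match b with CEq e1 e2 | CLt e1 e2 => (cost e1 + cost e2).+1 end.

Definition ifc (b : cond) (c1 c2 : cmd) : cmd :=
  Seq (load_cond b) (If (test_of b) c1 c2).

(** The machine tests registers only, so the operands are evaluated again at the end of each
    pass. *)
Definition whilec (b : cond) (c : cmd) : cmd :=
  Seq (load_cond b) (While (test_of b) (Seq c (load_cond b))).

Definition for_ (x : nat) (lo hi : expr) (c : cmd) : cmd :=
  Seq (assign x lo)
      (whilec (CLt (Var x) hi) (Seq c (assign x (Plus (Var x) (Cst 1))))).

(** * Total correctness and running time of structured programs *)

Section Wp.
Variables (m w S : nat).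
Hypotheses (Sm : narrs * S <= m) (Sw : narrs * S <= 2 ^ w).

Definition rep (s : hstate) (r : state) : Prop :=
  [/\ forall i, i < nvars -> reg r i = var s i,
      forall A, A < narrs -> reg r (nvars + A) = A * S &
      forall A x, A < narrs -> x < S -> Defs.mem r (A * S + x) = arr s A x].

(** The machine has no step for an overflow or a stray access, so both are excluded here. The bound
    [S] on indices also keeps an access inside its own array. *)
Fixpoint safe (s : hstate) (e : expr) : Prop :=
  match e with
  | Var i => i < nvars
  | Cst k => k < 2 ^ w
  | Plus e1 e2 => [/\ safe s e1, safe s e2 & eval s e1 + eval s e2 < 2 ^ w]
  | Minus e1 e2 => safe s e1 /\ safe s e2
  | Get A e1 => [/\ A < narrs, safe s e1 & eval s e1 < S]
  end.

Definition safec (s : hstate) (b : cond) : Prop :=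
  match b with CEq e1 e2 | CLt e1 e2 => safe s e1 /\ safe s e2 end.

(* Total correctness: [Q] receives the final state and the time spent. *)
Definition wp (c : cmd) (s : hstate) (Q : hstate -> nat -> Prop) : Prop :=
  forall r, rep s r ->
  exists t r' s', [/\ exec m w c r t r', rep s' r' & Q s' t].

Lemma updE (f : nat -> nat) i x : upd f i x i = x.
Proof. by rewrite /upd eqxx. Qed.

Lemma upd_neq (f : nat -> nat) i x j : j <> i -> upd f i x j = f j.
Proof. by rewrite /upd => /eqP/negPf->. Qed.

Lemma rep_tmp s r d x : rep s r -> rep s (set_reg r (tmp d) x).
Proof.
move=> [R1 R2 R3]; split=> [i lti|A ltA|A y ltA lty] /=.
- by rewrite upd_neq ?R1 // /tmp; lia.
- by rewrite upd_neq ?R2 // /tmp; lia.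
- exact: R3.
Qed.

Lemma arr_addr A x : A < narrs -> x < S -> A * S + x < narrs * S.
Proof.
move=> ltA ltx; apply: (@leq_trans (A.+1 * S)); first by rewrite mulSn; lia.
by rewrite leq_mul2r ltA orbT.
Qed.

(** The last clause lets a binary operation keep its left operand in [tmp d] while the right one is
    computed from [tmp d.+1] on. *)
Lemma compileP e d s r : rep s r -> safe s e ->
  exists r', [/\ exec m w (compile d e) r (cost e) r', rep s r',
    reg r' (tmp d) = eval s e &
    forall d', d' < d -> reg r' (tmp d') = reg r (tmp d')].
Proof.
elim: e d s r => [i|k|e1 IH1 e2 IH2|e1 IH1 e2 IH2|A e1 IH1] d s r R /=.
- move=> lti; exists (set_reg r (tmp d) (reg r i)); split.
  + exact: ExecMove.
  + exact: rep_tmp.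
  + by rewrite /= updE; case: R => ->.
  + by move=> d' ltd /=; rewrite upd_neq // /tmp; lia.
- move=> ltk; exists (set_reg r (tmp d) k); split.
  + exact: ExecConst.
  + exact: rep_tmp.
  + by rewrite /= updE.
  + by move=> d' ltd /=; rewrite upd_neq // /tmp; lia.
- case=> s1 s2 lt12.
  have [r1 [E1 R1 V1 U1]] := IH1 d s r R s1.
  have [r2 [E2 R2 V2 U2]] := IH2 d.+1 s r1 R1 s2.
  exists (set_reg r2 (tmp d) (reg r2 (tmp d) + reg r2 (tmp d.+1))); split.
  + have -> : (cost e1 + cost e2).+1 = cost e1 + (cost e2 + 1) by lia.
    apply: ExecSeq E1 _; apply: ExecSeq E2 _; apply: ExecAdd.
    by rewrite V2 U2 // V1.
  + exact: rep_tmp.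
  + by rewrite /= updE V2 U2 // V1.
  + move=> d' ltd /=; rewrite upd_neq; last by rewrite /tmp; lia.
    by rewrite U2 ?U1 //; lia.
- case=> s1 s2.
  have [r1 [E1 R1 V1 U1]] := IH1 d s r R s1.
  have [r2 [E2 R2 V2 U2]] := IH2 d.+1 s r1 R1 s2.
  exists (set_reg r2 (tmp d) (reg r2 (tmp d) - reg r2 (tmp d.+1))); split.
  + have -> : (cost e1 + cost e2).+1 = cost e1 + (cost e2 + 1) by lia.
    by apply: ExecSeq E1 _; apply: ExecSeq E2 _; apply: ExecSub.
  + exact: rep_tmp.
  + by rewrite /= updE V2 U2 // V1.
  + move=> d' ltd /=; rewrite upd_neq; last by rewrite /tmp; lia.
    by rewrite U2 ?U1 //; lia.
- case=> ltA s1 ltS.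
  have [r1 [E1 R1 V1 U1]] := IH1 d s r R s1.
  have addr := arr_addr ltA ltS.
  case: (R1) => _ RB RM.
  set r2 := set_reg r1 (tmp d) (reg r1 (tmp d) + reg r1 (nvars + A)).
  have V2 : reg r2 (tmp d) = A * S + eval s e1.
    by rewrite /= updE V1 RB // addnC.
  exists (set_reg r2 (tmp d) (Defs.mem r2 (reg r2 (tmp d)))); split.
  + have -> : (cost e1).+2 = cost e1 + (1 + 1) by lia.
    apply: ExecSeq E1 _; apply: ExecSeq.
      by apply: ExecAdd; rewrite V1 RB //; lia.
    by apply: ExecRead; rewrite V2; lia.
  + by do 2!apply: rep_tmp.
  + by rewrite V2 /= updE RM.
  + by move=> d' ltd /=; rewrite !upd_neq ?U1 // /tmp; lia.
Qed.

Lemma wp_conseq (Q' Q : hstate -> nat -> Prop) c s :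
  wp c s Q' -> (forall s' t, Q' s' t -> Q s' t) -> wp c s Q.
Proof. by move=> H QQ r /H[t [r' [s' [E R q]]]]; exists t, r', s'; split; auto. Qed.

Lemma wp_skip s (Q : hstate -> nat -> Prop) : Q s 1 -> wp Skip s Q.
Proof. by move=> q r R; exists 1, r, s; split=> //; apply: ExecSkip. Qed.

Lemma wp_seq c1 c2 s (Q : hstate -> nat -> Prop) :
  wp c1 s (fun s1 t1 => wp c2 s1 (fun s2 t2 => Q s2 (t1 + t2))) ->
  wp (Seq c1 c2) s Q.
Proof.
move=> H r /H[t1 [r1 [s1 [E1 /[swap] H2 /H2 [t2 [r2 [s2 [E2 R2 q]]]]]]]].
by exists (t1 + t2), r2, s2; split=> //; apply: ExecSeq; eauto.
Qed.

Lemma wp_assign x e s (Q : hstate -> nat -> Prop) :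
  x < nvars -> safe s e -> Q (setv s x (eval s e)) (cost e).+1 ->
  wp (assign x e) s Q.
Proof.
move=> ltx se q r R; have [r1 [E [R1 R2 R3] V _]] := compileP 0 R se.
exists (cost e + 1), (set_reg r1 x (reg r1 (tmp 0))), (setv s x (eval s e)).
split; last by rewrite addn1.
  by apply: ExecSeq; eauto; apply: ExecMove.
split=> [i lti|A ltA|A y ltA lty] /=.
- by rewrite /upd eqnE; case: eqP => // _; rewrite R1.
- by rewrite upd_neq ?R2 //; lia.
- exact: R3.
Qed.

Lemma wp_store A e1 e2 s (Q : hstate -> nat -> Prop) :
  A < narrs -> safe s e1 -> safe s e2 -> eval s e1 < S ->
  Q (seta s A (eval s e1) (eval s e2)) (cost e1 + cost e2).+2 ->
  wp (store A e1 e2) s Q.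
Proof.
move=> ltA se1 se2 ltS q r R.
have [r1 [E1 R1 V1 _]] := compileP 0 R se1.
have [r2 [E2 R2 V2 U2]] := compileP 1 R1 se2.
have addr := arr_addr ltA ltS.
case: (R2) => RV RB RM.
set r3 := set_reg r2 (tmp 0) (reg r2 (tmp 0) + reg r2 (nvars + A)).
have V3 : reg r3 (tmp 0) = A * S + eval s e1.
  by rewrite /= updE U2 // V1 RB // addnC.
have V4 : reg r3 (tmp 1) = eval s e2 by rewrite /= upd_neq.
exists (cost e1 + (cost e2 + (1 + 1))), (set_mem r3 (reg r3 (tmp 0)) (reg r3 (tmp 1))).
exists (seta s A (eval s e1) (eval s e2)); split; last first.
- by move: q; congr (Q _ _); lia.
- have [R3v R3b R3m] := rep_tmp 0 (reg r2 (tmp 0) + reg r2 (nvars + A)) R2.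
  split=> [i lti|B ltB|B y ltB lty]; first exact: R3v; first exact: R3b.
  rewrite V3 V4 /= /upd eqnE; case: (eqVneq B A) => [->|neqBA] /=.
    by rewrite eqn_add2l; case: eqP => // _; rewrite RM.
  rewrite ifN ?RM //; apply/eqP => eqBA; case/eqP: neqBA; clear -eqBA ltS lty.
  (* Arrays do not overlap: dividing an address by [S] recovers the number of its array. *)
  have : (B * S + y) %/ S = (A * S + eval s e1) %/ S by rewrite eqBA.
  by rewrite !divnMDl ?divn_small ?addn0 //; lia.
- apply: ExecSeq E1 _; apply: ExecSeq E2 _; apply: ExecSeq.
    by apply: ExecAdd; rewrite U2 // V1 RB //; lia.
  by apply: ExecWrite; rewrite V3; lia.
Qed.

Lemma load_condP b s r : rep s r -> safec s b ->
  exists r', [/\ exec m w (load_cond b) r (costc b).-1 r', rep s r' &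
    eval_test (test_of b) r' = evalc s b].
Proof.
case: b => e1 e2 R /= [s1 s2].
all: have [r1 [E1 R1 V1 _]] := compileP 0 R s1.
all: have [r2 [E2 R2 V2 U2]] := compileP 1 R1 s2.
all: exists r2; split=> //; first by apply: ExecSeq; eauto.
all: by rewrite V2 U2 // V1.
Qed.

Lemma wp_if b c1 c2 s (Q : hstate -> nat -> Prop) : safec s b ->
  (evalc s b -> wp c1 s (fun s' t => Q s' (costc b + t))) ->
  (~~ evalc s b -> wp c2 s (fun s' t => Q s' (costc b + t))) ->
  wp (ifc b c1 c2) s Q.
Proof.
move=> sb H1 H2 r R; have [r1 [E1 R1 V]] := load_condP R sb.
have bt t : costc b + t = (costc b).-1 + t.+1 by case: (b) => *; rewrite /=; lia.
case: (boolP (evalc s b)) => eb.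
- have [t [r2 [s2 [E2 R2 q]]]] := H1 eb _ R1.
  exists (costc b + t), r2, s2; split=> //; rewrite bt.
  by apply: ExecSeq; eauto; apply: ExecIfTrue; rewrite ?V.
- have [t [r2 [s2 [E2 R2 q]]]] := H2 eb _ R1.
  exists (costc b + t), r2, s2; split=> //; rewrite bt.
  by apply: ExecSeq; eauto; apply: ExecIfFalse; rewrite ?V.
Qed.

(* [I p s] is the loop invariant together with the remaining time credits [p]. *)
Lemma wp_while (I : nat -> hstate -> Prop) b c p s :
  (forall p s, I p s -> safec s b) ->
  (forall p s, I p s -> evalc s b -> wp c s (fun s' t =>
     exists2 p', I p' s' & t + costc b + p' <= p)) ->
  I p s ->
  wp (whilec b c) s (fun s' t =>
     exists p', [/\ I p' s', ~~ evalc s' b & t + p' <= p + costc b]).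
Proof.
move=> Hs Hc Is r R.
have cb : 0 < costc b by case: (b).
suff: forall r1, rep s r1 -> eval_test (test_of b) r1 = evalc s b ->
  exists t r' s', [/\ exec m w (While (test_of b) (Seq c (load_cond b))) r1 t r',
     rep s' r' & exists p', [/\ I p' s', ~~ evalc s' b & t + p' <= p.+1]].
  have [r1 [E1 R1 V]] := load_condP R (Hs _ _ Is).
  move=> /(_ _ R1 V)[t [r' [s' [E2 R2 [p' [I' nb le']]]]]].
  exists ((costc b).-1 + t), r', s'; split=> //.
    by apply: ExecSeq; eauto.
  by exists p'; split=> //; lia.
(* The cost of the test alone makes the credits drop strictly, so they serve as the termination
   measure. *)
clear r R; elim/ltn_ind: p s Is => p IHp s Is r1 R1 V.
case: (boolP (evalc s b)) => eb; last first.
  exists 1, r1, s; split=> //; first by apply: ExecWhileFalse; rewrite V.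
  by exists p; split=> //; lia.
have [t2 [r2 [s2 [E2 R2 [p2 I2 le2]]]]] := Hc _ _ Is eb _ R1.
have [r3 [E3 R3 V3]] := load_condP R2 (Hs _ _ I2).
have ltp : p2 < p by lia.
have [t4 [r4 [s4 [E4 R4 [p4 [I4 nb4 le4]]]]]] := IHp p2 ltp s2 I2 r3 R3 V3.
exists ((t2 + (costc b).-1 + t4).+1), r4, s4; split=> //.
  apply: ExecWhileTrue; [by rewrite V| |exact: E4].
  by apply: ExecSeq; eauto.
by exists p4; split=> //; lia.
Qed.

(** The bound [ehi] is evaluated before every pass, hence the premise that the invariant fixes its
    value. In each pass, 6 pays for the increment (4) and for the rest of the comparison (2). *)
Lemma wp_for (I : nat -> hstate -> Prop) x elo ehi c lo hi T s :
  x < nvars -> safe s elo -> eval s elo = lo -> lo <= hi -> hi < 2 ^ w ->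
  1 < 2 ^ w ->
  I lo (setv s x lo) ->
  (forall k s, I k s -> var s x = k -> safe s ehi /\ eval s ehi = hi) ->
  (forall k s, lo <= k < hi -> I k s -> var s x = k ->
     wp c s (fun s' t => [/\ I k.+1 (setv s' x k.+1), var s' x = k & t <= T])) ->
  wp (for_ x elo ehi c) s (fun s' t => [/\ I hi s', var s' x = hi &
     t <= (hi - lo) * (T + cost ehi + 6) + cost elo + cost ehi + 3]).
Proof.
move=> ltx sl el lehi hw w1 Ilo Hh Hc.
apply: wp_seq; apply: wp_assign => //; rewrite el.
pose J p s := exists2 k, lo <= k <= hi & [/\ I k s, var s x = k &
  p = (hi - k) * (T + cost ehi + 6)].
apply: wp_conseq.
- apply: (@wp_while J _ _ ((hi - lo) * (T + cost ehi + 6))).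
  + by move=> p s' [k _ [Ik vk _]] /=; case: (Hh _ _ Ik vk) => sh _.
  + move=> p s' [k lek [Ik vk ->]] /=; case: (Hh _ _ Ik vk) => sh ->; rewrite vk => ltk.
    have lok : lo <= k < hi by lia.
    apply: wp_seq; apply: wp_conseq (Hc _ _ lok Ik vk) _ => s1 t1 [I1 v1 le1].
    apply: wp_assign => //=; first by split=> //; lia.
    rewrite v1 addn1; exists ((hi - k.+1) * (T + cost ehi + 6)).
      exists k.+1; first by lia.
      by split=> //=; rewrite eqnE eqxx.
    have -> : hi - k = (hi - k.+1).+1 by lia.
    by rewrite mulSn; lia.
  + exists lo; first by lia.
    by split=> //=; rewrite eqnE eqxx.
- move=> s' t /= [p [[k lek [Ik vk ->]]]]; case: (Hh _ _ Ik vk) => _ ->.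
  rewrite vk -leqNgt => lek2 tle.
  have ek : k = hi by lia.
  by rewrite ek in Ik vk; split=> //; lia.
Qed.

End Wp.

(** Frame condition: the two lists name what may change. *)
Definition keeps (vs As : seq nat) (s0 s : hstate) : Prop :=
  (forall i, i \notin vs -> var s i = var s0 i) /\
  (forall A, A \notin As -> arr s A = arr s0 A).

Lemma keeps_refl vs As s : keeps vs As s s.
Proof. by []. Qed.

Lemma keeps_setv vs As s0 s x v :
  x \in vs -> keeps vs As s0 s -> keeps vs As s0 (setv s x v).
Proof.
move=> xvs [k1 k2]; split=> // i ivs /=; rewrite eqnE.
by case: eqP => [ix|_]; [rewrite ix xvs in ivs|exact: k1].
Qed.

Lemma keeps_seta vs As s0 s A x v :
  A \in As -> keeps vs As s0 s -> keeps vs As s0 (seta s A x v).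
Proof.
move=> Avs [k1 k2]; split=> // i ivs /=; rewrite eqnE.
by case: eqP => [ix|_]; [rewrite ix Avs in ivs|exact: k2].
Qed.

Lemma keeps_trans vs As s1 s2 s3 :
  keeps vs As s1 s2 -> keeps vs As s2 s3 -> keeps vs As s1 s3.
Proof.
move=> [a b] [c d]; split=> [i h|A h]; first by rewrite c // a.
by rewrite d // b.
Qed.

Lemma keeps_sub vs As vs' As' s1 s2 :
  all (fun i => i \in vs') vs -> all (fun A => A \in As') As ->
  keeps vs As s1 s2 -> keeps vs' As' s1 s2.
Proof.
move=> /allP hv /allP hA [a b]; split=> [i h|A h].
  by apply: a; apply: contra h; apply: hv.
by apply: b; apply: contra h; apply: hA.
Qed.

(** * Naming the classes of a forest *)

(** Linked list with 0 as null pointer, so that zeroed memory holds empty lists; vertices are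
    therefore numbered from 1. *)
Fixpoint chain (X : nat -> nat) (h : nat) (l : seq nat) : Prop :=
  if l is x :: l' then [/\ h = x, 0 < x & chain X (X x) l'] else h = 0.

Lemma chain_upd X h l u z : u \notin l -> chain X h l -> chain (upd X u z) h l.
Proof.
elim: l h => //= x l IHl h; rewrite inE negb_or => /andP[ux ul] [-> x0 ch].
by split=> //; rewrite upd_neq; [exact: IHl|move=> xu; rewrite xu eqxx in ux].
Qed.

Lemma chain_pos X h l : 0 < h -> chain X h l -> exists l', l = h :: l'.
Proof. by case: l => [|x l] /= h0; [move=> h1; rewrite h1 in h0|case=> ->; exists l]. Qed.

Lemma count_upd (P : pred nat) (K : nat -> nat) u k s :
  uniq s -> u \in s -> ~~ P (K u) -> P k ->
  count (fun v => P (upd K u k v)) s = (count (fun v => P (K v)) s).+1.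
Proof.
elim: s => //= x s IHs /andP[xs us]; rewrite inE.
case: (eqVneq u x) => [ux _ nP Pk|ux /= us' nP Pk]; first subst x.
  rewrite updE Pk (negPf nP) add1n add0n; congr _.+1; apply: eq_in_count => y ys.
  by rewrite upd_neq // => yu; rewrite -yu ys in xs.
by rewrite upd_neq ?IHs // ?addnS // => xu; rewrite xu eqxx in ux.
Qed.

Section Naming.
Variable N : nat.

Definition real (v : nat) : bool := (0 < v) && (v <= N).

(* In-degrees are at most 2: [C1 u] and [C2 u] are the children of [u], where
   0 stands for a missing child and [N.+1] for a cut edge. *)
Definition forest (F C1 C2 : nat -> nat) : Prop :=
  [/\ forall v, real v -> F v <= N,
      forall u, real u -> C1 u <= N.+1 /\ C2 u <= N.+1 &
      forall u c, real u -> real c -> c = C1 u \/ c = C2 u -> F c = u].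

Section Structure.
Variables F C1 C2 : nat -> nat.
Hypothesis fF : forest F C1 C2.

(** The unordered pair of the children's classes is coded by its maximum and minimum. As class 0
    means unnamed, [0 < lo K u] says that both children are named. *)
Definition hi (K : nat -> nat) (u : nat) : nat := maxn (K (C1 u)) (K (C2 u)).
Definition lo (K : nat -> nat) (u : nat) : nat := minn (K (C1 u)) (K (C2 u)).

(** Classes 1 and 2 are reserved for the two pseudo-vertices. Since [hi K u < K u], structural
    inductions on trees become inductions on the class. *)
Record naming (K : nat -> nat) : Prop := Naming {
  naming_none : K 0 = 1;
  naming_cut : K N.+1 = 2;
  naming_range : forall v, real v -> K v = 0 \/ 3 <= K v < N + 3;
  naming_complete : forall u, real u -> 0 < lo K u -> 0 < K u;
  naming_children : forall u, real u -> 0 < K u -> 0 < lo K u /\ hi K u < K u;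
  naming_eq : forall u u', real u -> real u' -> 0 < K u -> 0 < K u' ->
    K u = K u' <-> hi K u = hi K u' /\ lo K u = lo K u' }.

(* [a] is the class being processed, [nx] the next free class, [st] and [nm]
   the stamps and the names of the pairs [(a, b)] indexed by [b], [H] and [X]
   the linked lists of the members of each class; [e] counts the classes
   created but still empty. *)
Record name_inv (e : nat) (K : nat -> nat) (nx : nat) (st nm H X : nat -> nat) (a : nat)
    : Prop := Inv {
  inv_none : K 0 = 1;
  inv_cut : K N.+1 = 2;
  inv_range : forall v, real v -> K v = 0 \/ 3 <= K v < nx;
  inv_nx3 : 3 <= nx;
  inv_nx : nx <= 3 + count (fun v => K v != 0) (iota 1 N) + e;
  inv_children : forall u, real u -> 0 < K u ->
    [/\ 0 < lo K u, hi K u <= a & hi K u < K u];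
  inv_eq : forall u u', real u -> real u' -> 0 < K u -> 0 < K u' ->
    K u = K u' <-> hi K u = hi K u' /\ lo K u = lo K u';
  inv_st : forall b, st b <= a;
  inv_nm : forall b, st b = a -> [/\ nm b < nx, a < nm b & 3 <= nm b];
  inv_st_nm : forall b u, st b = a -> real u -> 0 < K u ->
    K u = nm b <-> hi K u = a /\ lo K u = b;
  inv_st_in : forall u, real u -> 0 < K u -> hi K u = a -> st (lo K u) = a;
  inv_nm_inj : forall b b', st b = a -> st b' = a -> nm b = nm b' -> b = b';
  inv_complete : forall u, real u -> 0 < lo K u -> hi K u < a -> 0 < K u;
  inv_list : forall k, 3 <= k -> exists l,
    [/\ chain X (H k) l, uniq l & forall v, (v \in l) = real v && (K v == k)] }.

Lemma real_iota v : real v = (v \in iota 1 N).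
Proof. by rewrite mem_iota /real add1n ltnS. Qed.

Lemma inv_nx_max e K nx st nm H X a : name_inv e K nx st nm H X a -> nx <= N + 3 + e.
Proof.
move=> I; apply: leq_trans (inv_nx I) _; rewrite leq_add2r addnC leq_add2r.
by apply: leq_trans (count_size _ _) _; rewrite size_iota.
Qed.

(** The stamps start at 0 and [a] at 1, so no entry of the zeroed table counts as valid. *)
Lemma inv_init K st nm H X : K 0 = 1 -> K N.+1 = 2 -> (forall v, real v -> K v = 0) ->
  (forall b, st b = 0) -> (forall k, H k = 0) -> name_inv 0 K 3 st nm H X 1.
Proof.
move=> K0 K1 Kr st0 H0.
have stn b : st b <> 1 by rewrite st0.
split=> //.
- by move=> v /Kr; left.
- by move=> u /Kr ->.
- by move=> u u' /Kr ->.
- by move=> b; rewrite st0.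
- by move=> b /stn.
- by move=> b u /stn.
- by move=> u /Kr ->.
- by move=> b b' /stn.
- by move=> u ru; rewrite /lo /hi; lia.
- move=> k k3; exists [::]; split=> //= v.
  by rewrite in_nil; case: (boolP (real v)) => //= /Kr ->; lia.
Qed.

(** No stamp exceeds [a], so incrementing [a] empties the table at no cost. *)
Lemma inv_next K nx st nm H X a : name_inv 0 K nx st nm H X a ->
  (forall u, real u -> 0 < lo K u -> hi K u = a -> 0 < K u) ->
  name_inv 0 K nx st nm H X a.+1.
Proof.
move=> I done.
have stn b : st b <> a.+1 by have := inv_st I b; lia.
split; try by case: I.
- by move=> u ru Ku; have [] := inv_children I ru Ku; split=> //; lia.
- by move=> b; have := inv_st I b; lia.
- by move=> b /stn.
- by move=> b u /stn.
- by move=> u ru Ku; have [] := inv_children I ru Ku; lia.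
- by move=> b b' /stn.
- move=> u ru Ku; rewrite ltnS leq_eqVlt => /orP[/eqP|]; first exact: done.
  exact: (inv_complete I).
Qed.

(** A missing stamp means, by [inv_st_in], that no named vertex has the pair [(a, b)], so a fresh
    name is right. The new class is empty until the next insertion, whence the 1. *)
Lemma inv_stamp K nx st nm H X a b : name_inv 0 K nx st nm H X a -> a < nx ->
  st b <> a -> name_inv 1 K nx.+1 (upd st b a) (upd nm b nx) H X a.
Proof.
move=> I anx sb.
have nm_lt b' : st b' = a -> nm b' < nx by move=> /(inv_nm I) [].
have cases b' : upd st b a b' = a -> b' = b \/ b' <> b /\ st b' = a.
  by case: (eqVneq b' b) => [->|/eqP bb']; [left|rewrite upd_neq //; right].
have upd_st b' : st b' = a -> upd st b a b' = a.
  by rewrite /upd; case: eqP.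
split; try by case: I.
- by move=> v rv; have := inv_range I rv; lia.
- by have := inv_nx3 I; lia.
- by have := inv_nx I; lia.
- by move=> b'; have := inv_st I b'; rewrite /upd; case: eqP.
- move=> b' /cases[->|[bb' /(inv_nm I)]].
    by rewrite updE; split=> //; exact: inv_nx3 I.
  by rewrite upd_neq // => -[]; split=> //; lia.
- move=> b' u /cases[->|[bb' sb']] ru Ku; last first.
    by rewrite upd_neq //; exact: (inv_st_nm I).
  rewrite updE; split=> [Kn|[hu lu]]; first by have := inv_range I ru; lia.
  by case: sb; rewrite -lu; exact: (inv_st_in I).
- by move=> u ru Ku hu; exact/upd_st/(inv_st_in I).
- move=> b1 b2 /cases[->|[nb1 s1]] /cases[->|[nb2 s2]] //.
  + by rewrite updE upd_neq // => e; have := nm_lt _ s2; lia.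
  + by rewrite updE upd_neq // => e; have := nm_lt _ s1; lia.
  + by rewrite !upd_neq //; exact: (inv_nm_inj I) s1 s2.
Qed.

(** The name given exceeds [a], so the insertion completes no pair whose maximum is at most [a]:
    what remains to be done for the current [a] does not grow. *)
Lemma inv_insert e K nx st nm H X a u : e <= 1 -> name_inv e K nx st nm H X a ->
  real u -> K u = 0 -> 0 < lo K u -> hi K u = a -> st (lo K u) = a ->
  let k := nm (lo K u) in
  name_inv 0 (upd K u k) nx st nm (upd H k u) (upd X u (H k)) a /\
  (forall u', real u' -> 0 < lo (upd K u k) u' -> hi (upd K u k) u' <= a ->
     u' = u \/ 0 < lo K u' /\ hi K u' <= a).
Proof.
move=> e1 I ru Ku lou hiu stu k.
have [knx ak k3] := inv_nm I stu.
have uN0 : u <> 0 by move: ru; rewrite /real; lia.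
have uN1 : u <> N.+1 by move: ru; rewrite /real; lia.
(* A pair with maximum at most [a] after the insertion cannot involve [u], whose class is now
   larger. *)
have low u' : 0 < lo (upd K u k) u' -> hi (upd K u k) u' <= a ->
    hi (upd K u k) u' = hi K u' /\ lo (upd K u k) u' = lo K u'.
  rewrite /lo /hi /upd; case: eqP => [_|_]; first by rewrite -/k in ak *; lia.
  by case: eqP => [_|_] //; rewrite -/k in ak *; lia.
(* Nor can a pair that was complete before, when [u] had no class. *)
have named u' : 0 < lo K u' ->
    hi (upd K u k) u' = hi K u' /\ lo (upd K u k) u' = lo K u'.
  rewrite /lo /hi /upd; case: eqP => [->|_]; first by rewrite Ku; lia.
  by case: eqP => [->|_] //; rewrite Ku; lia.
have cases u' : real u' -> 0 < upd K u k u' ->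
    u' = u \/ [/\ u' <> u, 0 < K u', hi (upd K u k) u' = hi K u' &
               lo (upd K u k) u' = lo K u'].
  move=> ru'; case: (eqVneq u' u) => [->|/eqP nu]; first by left.
  rewrite upd_neq // => Ku'; right.
  by have [lo0 _ _] := inv_children I ru' Ku'; have [-> ->] := named _ lo0.
have [hu lu] := named _ lou.
split; last first.
  move=> u' ru' lo' hi'; right; have [h l] := low _ lo' hi'.
  by rewrite -h -l.
have nk u' : real u' -> 0 < K u' -> k = K u' <-> hi K u = hi K u' /\ lo K u = lo K u'.
  move=> ru' Ku'; have E := inv_st_nm I stu ru' Ku'.
  split=> [/esym/E[-> ->] //|[h l]]; apply/esym/E.
  by rewrite -h -l hiu.
split.
- by rewrite upd_neq ?(inv_none I) //; lia.
- by rewrite upd_neq ?(inv_cut I) //; lia.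
- move=> v rv; case: (eqVneq v u) => [->|/eqP vu]; first by rewrite updE; right; lia.
  by rewrite upd_neq //; exact: (inv_range I).
- exact: inv_nx3 I.
- rewrite (@count_upd (fun x => x != 0)) ?iota_uniq -?real_iota ?Ku //; last by lia.
  by have := inv_nx I; lia.
- move=> u' ru' /(cases _ ru')[->|[nu Ku' -> ->]].
    by rewrite hu lu updE hiu.
  by rewrite upd_neq //; exact: (inv_children I).
- move=> u1 u2 r1 r2 /(cases _ r1)[->|[n1 K1 -> ->]] /(cases _ r2)[->|[n2 K2 -> ->]].
  + by [].
  + by rewrite updE upd_neq // hu lu; exact: nk.
  + rewrite updE upd_neq // hu lu; have E := nk _ r1 K1.
    by split=> [/esym/E[]|[h l]] //; apply/esym/E.
  + by rewrite !upd_neq //; exact: (inv_eq I).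
- exact: inv_st I.
- exact: inv_nm I.
- move=> b u' stb ru' /(cases _ ru')[->|[nu Ku' -> ->]]; last first.
    by rewrite upd_neq //; exact: (inv_st_nm I).
  rewrite updE hu lu; split=> [e'|[_ <-]] //; split=> //.
  exact: (inv_nm_inj I) stu stb e'.
- move=> u' ru' /(cases _ ru')[->|[nu Ku' -> ->]]; first by rewrite hu lu.
  exact: (inv_st_in I).
- exact: inv_nm_inj I.
- move=> u' ru' lo' hi'; case: (eqVneq u' u) => [->|/eqP nu].
    by rewrite updE; lia.
  have [h l] := low _ lo' (ltnW hi'); rewrite upd_neq //.
  by apply: (inv_complete I) ru' _ _; rewrite -?h -?l.
- move=> j j3; have [l [ch ul ml]] := inv_list I j3.
  have unl : u \notin l by rewrite ml ru Ku /=; lia.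
  case: (eqVneq j k) => [->|jk]; last first.
    exists l; split=> //; first by rewrite upd_neq; [exact: chain_upd|exact/eqP].
    move=> v; rewrite ml; case: (eqVneq v u) => [->|/eqP vu]; last by rewrite upd_neq.
    by rewrite updE Ku ru; lia.
  case: (inv_list I k3) => l' [ch' ul' ml'].
  have unl' : u \notin l' by rewrite ml' ru Ku /=; lia.
  exists (u :: l'); split=> /=; rewrite ?unl' //.
    rewrite !updE; split=> //; first by lia.
    exact: chain_upd.
  move=> v; rewrite inE ml'; case: (eqVneq v u) => [->|/eqP vu].
    by rewrite updE ru eqxx.
  by rewrite upd_neq.
Qed.

(** Once [a] reaches [nx], every class in use is below [a], so [inv_complete] applies to all
    vertices. *)
Lemma inv_naming K nx st nm H X : name_inv 0 K nx st nm H X nx -> naming K.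
Proof.
move=> I; have nxN := inv_nx_max I; rewrite addn0 in nxN.
have hi_lt u : real u -> hi K u < nx.
  move=> ru; have cl c : c <= N.+1 -> K c < nx.
    move=> cN; case: (posnP c) => [->|c0].
      by rewrite (inv_none I); have := inv_nx3 I; lia.
    case: (eqVneq c N.+1) => [->|cN1].
      by rewrite (inv_cut I); have := inv_nx3 I; lia.
    have rc : real c by rewrite /real; lia.
    by have := inv_range I rc; have := inv_nx3 I; lia.
  by case: fF => _ /(_ u ru)[c1 c2] _; rewrite /hi gtn_max !cl.
split; try by case: I.
- by move=> v rv; have := inv_range I rv; lia.
- by move=> u ru lou; exact: (inv_complete I ru lou (hi_lt _ ru)).
- by move=> u ru Ku; have [] := inv_children I ru Ku.
Qed.

End Structure.
End Naming.

(** * The naming program *)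

(* The vertices are numbered from 1 to [N = 2n], the address in the input of
   their adjacency list entry; [aF] initially overlays the input.  The arrays
   hold: the out-neighbour (0 at the root of a cut component), the two children,
   the class, the linked list of the members of each class ([aH] its head, [aX]
   the successor), the stamps and names of pairs of classes, the visited and the
   cut vertices, the number of roots of each class in either graph. *)
Notation vAns := 0 (only parsing).
Notation vn := 1 (only parsing).
Notation vN := 2 (only parsing).
Notation vv := 3 (only parsing).
Notation vu := 4 (only parsing).
Notation va := 5 (only parsing).
Notation vnx := 6 (only parsing).
Notation vx := 7 (only parsing).
Notation vy := 8 (only parsing).
Notation vb := 9 (only parsing).
Notation vk := 10 (only parsing).
Notation vL := 11 (only parsing).
Notation vi := 12 (only parsing).
Notation vj := 13 (only parsing).
Notation vfi := 14 (only parsing).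
Notation vfj := 15 (only parsing).
Notation aF := 0 (only parsing).
Notation aC1 := 1 (only parsing).
Notation aC2 := 2 (only parsing).
Notation aK := 3 (only parsing).
Notation aH := 4 (only parsing).
Notation aX := 5 (only parsing).
Notation aST := 6 (only parsing).
Notation aNM := 7 (only parsing).
Notation aVIS := 8 (only parsing).
Notation aCUT := 9 (only parsing).
Notation aCG := 10 (only parsing).
Notation aCH := 11 (only parsing).

Notation "c1 ;; c2" := (Seq c1 c2) (at level 60, right associativity).

(* Also encodes conjunctions: a minimum is positive iff both arguments are. *)
Definition Min (e1 e2 : expr) : expr := Minus e1 (Minus e1 e2).

Definition push_name : cmd :=
  assign vk (Get aNM (Var vb)) ;;
  store aK (Var vu) (Var vk) ;;
  store aX (Var vu) (Get aH (Var vk)) ;;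
  store aH (Var vk) (Var vu).

(** The test asks only that both classes be positive and at most [a]. For an unnamed vertex the
    maximum is then exactly [a], smaller maxima having been processed, and the other class is
    [x + y - a]. *)
Definition try_name : cmd :=
  ifc (CEq (Get aK (Var vu)) (Cst 0))
    (assign vx (Get aK (Get aC1 (Var vu))) ;;
     assign vy (Get aK (Get aC2 (Var vu))) ;;
     ifc (CLt (Cst 0) (Min (Min (Var vx) (Var vy))
            (Min (Minus (Plus (Var va) (Cst 1)) (Var vx))
                 (Minus (Plus (Var va) (Cst 1)) (Var vy)))))
       (assign vb (Minus (Plus (Var vx) (Var vy)) (Var va)) ;;
        ifc (CEq (Get aST (Var vb)) (Var va))
          push_name
          (store aST (Var vb) (Var va) ;;
           store aNM (Var vb) (Var vnx) ;;
           assign vnx (Plus (Var vnx) (Cst 1)) ;;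
           push_name))
       Skip)
    Skip.

Definition name_list : cmd :=
  assign vv (Get aH (Var va)) ;;
  whilec (CLt (Cst 0) (Var vv))
    (assign vu (Get aF (Var vv)) ;;
     try_name ;;
     assign vv (Get aX (Var vv))).

Definition name_all : cmd :=
  for_ vu (Cst 1) (Plus (Var vN) (Cst 1)) try_name.

(** Classes 1 and 2 belong to pseudo-vertices, which have no single parent and no list of members;
    for them all vertices are tried. From 3 on, only the parents of the members of a class are. *)
Definition name_classes : cmd :=
  store aK (Cst 0) (Cst 1) ;;
  store aK (Plus (Var vN) (Cst 1)) (Cst 2) ;;
  assign vnx (Cst 3) ;;
  assign va (Cst 1) ;; name_all ;;
  assign va (Cst 2) ;; name_all ;;
  assign va (Cst 3) ;;
  whilec (CLt (Var va) (Var vnx))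
    (name_list ;; assign va (Plus (Var va) (Cst 1))).

Ltac keep :=
  repeat first [apply: keeps_setv; first by [] | apply: keeps_seta; first by []];
  try exact: keeps_refl.

Section Progress.
Variables (a : nat) (C1 C2 : nat -> nat).

(** Names given while [a] is processed are above [a]. Hence the list of class [a] is not altered
    while it is walked, and a vertex once processed stays so. *)
Record progress (K X K' X' : nat -> nat) : Prop := Progress {
  progress_old : forall v, 0 < K v -> K' v = K v /\ X' v = X v;
  progress_new : forall v, K v = 0 -> K' v = 0 \/ a < K' v }.

Definition processed (N : nat) (K : nat -> nat) (u : nat) : Prop :=
  real N u -> 0 < lo C1 C2 K u -> hi C1 C2 K u <= a -> 0 < K u.

Lemma progress_refl K X : progress K X K X.
Proof. by split=> // v; left. Qed.

Lemma progress_trans K1 X1 K2 X2 K3 X3 :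
  progress K1 X1 K2 X2 -> progress K2 X2 K3 X3 -> progress K1 X1 K3 X3.
Proof.
move=> [o1 n1] [o2 n2]; split=> v Kv.
  have [k1 x1] := o1 v Kv; rewrite -k1 in Kv.
  by have [-> ->] := o2 v Kv.
case: (n1 v Kv) => [|lt1]; first exact: n2.
have K2v : 0 < K2 v by lia.
by right; have [-> _] := o2 v K2v.
Qed.

Lemma processed_progress N K X K' X' u : progress K X K' X' ->
  processed N K u -> processed N K' u.
Proof.
move=> [o n] pr ru; rewrite /lo /hi => l h.
have old c : 0 < K' c -> K' c <= a -> K' c = K c.
  case: (posnP (K c)) => [/n[->|]|/o[]] //; lia.
have e1 : K' (C1 u) = K (C1 u) by apply: old; lia.
have e2 : K' (C2 u) = K (C2 u) by apply: old; lia.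
rewrite e1 e2 in l h; have := pr ru l h.
by move=> Ku; have [-> _] := o _ Ku.
Qed.

(** This count is the potential of the outer loop: naming a vertex moves it from one alternative to
    the other, and only the increment of [a] spends credits. *)
Lemma count_progress N K X K' X' : progress K X K' X' ->
  count (fun v => (K' v == 0) || (a < K' v)) (iota 1 N) =
  count (fun v => (K v == 0) || (a < K v)) (iota 1 N).
Proof.
move=> [o n]; apply: eq_count => v; case: (posnP (K v)) => [Kv|Kv].
  by rewrite Kv; case: (n _ Kv) => ->; rewrite ?orbT.
by have [-> _] := o _ Kv; rewrite (gtn_eqF Kv).
Qed.

End Progress.

(** * Correctness and linear cost of the naming program *)

Section NameProg.
Variables (m w N : nat).
Let S := N + 4.
Hypotheses (Sm : narrs * S <= m) (Sw : narrs * S <= 2 ^ w).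
Variables F C1 C2 : nat -> nat.
Hypothesis fF : forest N F C1 C2.
Let W c s Q := wp m w S c s Q.

Definition SInv (e : nat) (s : hstate) : Prop :=
  [/\ arr s aF = F, arr s aC1 = C1, arr s aC2 = C2 &
      name_inv N C1 C2 e (arr s aK) (var s vnx) (arr s aST) (arr s aNM) (arr s aH)
          (arr s aX) (var s va)].

Lemma bound_w : 12 * (N + 4) <= 2 ^ w.
Proof. exact: Sw. Qed.

Lemma wp_push_name s e : e <= 1 -> SInv e s ->
  let u := var s vu in let K := arr s aK in
  real N u -> K u = 0 -> 0 < lo C1 C2 K u -> hi C1 C2 K u = var s va ->
  var s vb = lo C1 C2 K u -> arr s aST (var s vb) = var s va ->
  W push_name s (fun s' t => [/\ SInv 0 s',
    keeps [:: vk] [:: aK; aX; aH] s s',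
    progress (var s va) (arr s aK) (arr s aX) (arr s' aK) (arr s' aX),
    0 < arr s' aK u & t <= 30]).
Proof.
move=> e1 [fE c1E c2E I] u K ru Ku lou hiu bE stb.
have uN : u <= N by case/andP: ru.
have nxN := inv_nx_max I.
rewrite bE in stb.
have [knx ak k3] := inv_nm I stb.
have bS : var s vb < S.
  have := inv_children I; have : hi C1 C2 K u <= N + 3 by lia.
  by rewrite bE /hi /lo /S; lia.
have kS : arr s aNM (var s vb) < S by rewrite bE /S; lia.
have uS : u < S by rewrite /S; lia.
apply: wp_seq; apply: wp_assign => //=.
apply: wp_seq; apply: wp_store => //=.
apply: wp_seq; apply: wp_store => //=.
apply: wp_store => //=.
have [I' lo'] := inv_insert e1 I ru Ku lou hiu stb.
split=> //.
- by split=> //=; move: I'; rewrite -bE.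
- by keep.
- split=> v /= Kv; rewrite bE.
    have vu : v <> u by move=> vu; move: Kv; rewrite vu -/K Ku.
    by rewrite !upd_neq.
  by rewrite /upd; case: eqP => _; [right|left].
- by rewrite /= -/u updE bE; lia.
Qed.

Lemma name_inv_K e K nx st nm H X a c : name_inv N C1 C2 e K nx st nm H X a ->
  c <= N.+1 -> K c < nx.
Proof.
move=> I cN; have nx3 := inv_nx3 I.
case: (posnP c) => [->|c0]; first by rewrite (inv_none I); lia.
case: (eqVneq c N.+1) => [->|cN1]; first by rewrite (inv_cut I).
have rc : real N c by rewrite /real; lia.
by have := inv_range I rc; lia.
Qed.

Lemma processed_named a K u : 0 < K u -> processed a C1 C2 N K u.
Proof. by move=> ? ? ?. Qed.

Definition name_keeps := keeps [:: vx; vy; vb; vk; vnx] [:: aK; aH; aX; aST; aNM].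

Lemma wp_try s : SInv 0 s -> var s vu <= N -> var s va < var s vnx ->
  W try_name s (fun s' t => [/\ SInv 0 s', name_keeps s s',
    progress (var s va) (arr s aK) (arr s aX) (arr s' aK) (arr s' aX),
    var s vnx <= var s' vnx &
    processed (var s va) C1 C2 N (arr s' aK) (var s vu) /\ t <= 200]).
Proof.
move=> SI uN anx; case: (SI) => fE c1E c2E I.
have Wb := bound_w; have nxN := inv_nx_max I.
have uS : var s vu < S by rewrite /S; lia.
set K := arr s aK in I *.
apply: (wp_if Sm Sw) => /=; first by repeat split=> //; lia.
  rewrite -/K => /eqP Ku; have ru : real N (var s vu).
    by rewrite /real uN andbT; case: (posnP (var s vu)) Ku => // ->; rewrite (inv_none I).
  have [c1N c2N] : C1 (var s vu) <= N.+1 /\ C2 (var s vu) <= N.+1.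
    by case: fF => _ h _; exact: h.
  have K1 := name_inv_K I c1N; have K2 := name_inv_K I c2N.
  apply: wp_seq; apply: wp_assign => //=; rewrite ?c1E -/K; first by split=> //; rewrite /S; lia.
  apply: wp_seq; apply: wp_assign => //=; rewrite ?c2E -/K; first by split=> //; rewrite /S; lia.
  set k1 := K (C1 _) in K1 *; set k2 := K (C2 _) in K2 *.
  apply: (wp_if Sm Sw) => //=.
  - by repeat split=> //; lia.
  - move=> cnd; have lou : 0 < lo C1 C2 K (var s vu) by rewrite /lo -/k1 -/k2; lia.
    have hiu : hi C1 C2 K (var s vu) = var s va.
      have hle : hi C1 C2 K (var s vu) <= var s va by rewrite /hi -/k1 -/k2; lia.
      case: (ltnP (hi C1 C2 K (var s vu)) (var s va)) => [hlt|]; last by lia.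
      by have := inv_complete I ru lou hlt; rewrite Ku.
    have bE : k1 + k2 - var s va = lo C1 C2 K (var s vu).
      by move: hiu; rewrite /hi /lo -/k1 -/k2; lia.
    apply: wp_seq; apply: wp_assign => //=; first by repeat split=> //; lia.
    rewrite bE; have loS : lo C1 C2 K (var s vu) < S.
      by rewrite /lo -/k1 -/k2 /S; lia.
    set s1 := setv _ _ _.
    apply: (wp_if Sm Sw) => //=.
    + move=> /eqP stb.
      have SI1 : SInv 0 s1 by [].
      apply: wp_conseq; first exact: (@wp_push_name s1 0).
      move=> s' t [SI' k' pr Ku' t30]; split=> //.
      * apply: (@keeps_trans _ _ _ s1); first by rewrite /s1; keep.
        exact: keeps_sub k'.
      * by case: k' => /(_ vnx isT) ->.
      * by split; [exact: processed_named|lia].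
    + move=> /eqP stb.
      have I1 := inv_stamp I anx stb.
      apply: wp_seq; apply: wp_store => //=.
      apply: wp_seq; apply: wp_store => //=.
      apply: wp_seq; apply: wp_assign => //=; first by split=> //; lia.
      set s2 := setv _ _ _.
      have SI2 : SInv 1 s2 by split=> //=; rewrite addn1.
      apply: wp_conseq; first by apply: (@wp_push_name s2 1) => //=; rewrite updE.
      move=> s' t [SI' k' pr Ku' t30]; split=> //.
      * apply: (@keeps_trans _ _ _ s2).
          by rewrite /s2; keep.
        exact: keeps_sub k'.
      * by case: k' => /(_ vnx isT) -> _ /=; lia.
      * by split; [exact: processed_named|lia].
  - move=> ncnd; apply: wp_skip; split=> //.
    + by rewrite /name_keeps; keep.
    + exact: progress_refl.
    + split=> // _; rewrite /lo /hi /= -/K -/k1 -/k2; lia.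
rewrite -/K => Ku; apply: wp_skip; split=> //; first exact: progress_refl.
by split=> //; apply: processed_named; move: Ku; rewrite -/K; lia.
Qed.

Definition name_vars := [:: vv; vu; va; vx; vy; vb; vk; vnx].

Definition grows (s s' : hstate) : Prop :=
  [/\ keeps [:: vv; vu; vx; vy; vb; vk; vnx] [:: aK; aH; aX; aST; aNM] s s',
      progress (var s va) (arr s aK) (arr s aX) (arr s' aK) (arr s' aX) &
      var s vnx <= var s' vnx].

Lemma grows_trans s1 s2 s3 : grows s1 s2 -> grows s2 s3 -> grows s1 s3.
Proof.
move=> [k1 p1 n1] [k2 p2 n2]; split; last by lia.
  exact: keeps_trans k1 k2.
by apply: progress_trans p1 _; move: p2; case: k1 => /(_ va isT) ->.
Qed.

Lemma wp_try_grows s : SInv 0 s -> var s vu <= N -> var s va < var s vnx ->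
  W try_name s (fun s' t => [/\ SInv 0 s', grows s s',
    processed (var s va) C1 C2 N (arr s' aK) (var s vu),
    var s' vv = var s vv /\ var s' vu = var s vu & t <= 200]).
Proof.
move=> SI uN an; apply: wp_conseq; first exact: wp_try.
move=> s' t [SI' k pr nx [pro tle]]; split=> //.
- by split=> //; exact: keeps_sub k.
- by case: k => kv _; split; [exact: (kv vv)|exact: (kv vu)].
Qed.

Lemma wp_name_all s : SInv 0 s -> var s vN = N -> var s va < var s vnx ->
  W name_all s (fun s' t => [/\ SInv 0 s', grows s s',
    forall u, processed (var s va) C1 C2 N (arr s' aK) u & t <= N * 212 + 20]).
Proof.
move=> SI NE an; have Wb := bound_w.
pose I k s' := [/\ SInv 0 s', grows s s' &
  forall u, u < k -> processed (var s va) C1 C2 N (arr s' aK) u].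
apply: wp_conseq.
- apply: (@wp_for _ _ _ Sm Sw I _ _ _ _ 1 N.+1 200) => //; try lia.
  + by rewrite /=; lia.
  + split=> //; first by split; [keep|exact: progress_refl|].
    by case=> [|//] _; rewrite /processed /real.
  + move=> k s' [_ [[kv _] _ _] _] _ /=; rewrite (kv vN) // NE addn1.
    by repeat split=> //; lia.
  + move=> k s' lek [SI' gr pr] uE.
    have [[kv _] _ nx] := gr.
    have aE : var s' va = var s va by rewrite kv.
    apply: wp_conseq; first by apply: wp_try_grows => //; lia.
    move=> s2 t [SI2 gr2 pro [vE uE2] tle]; split=> //; last by rewrite uE2.
    have gr' := grows_trans gr gr2.
    split=> //.
      by case: gr' => *; split=> //; keep.
    move=> u; rewrite ltnS leq_eqVlt => /orP[/eqP->|ltu]; first by rewrite -aE -uE.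
    have [_ pr2 _] := gr2.
    by rewrite aE in pr2; apply: processed_progress pr2 _; exact: pr.
- move=> s' t [[SI' gr pr] _ tle]; split=> //; last by rewrite /= in tle; lia.
  by move=> u ru; apply: pr => //; move: ru; rewrite /real; lia.
Qed.

Lemma SInv_next s : SInv 0 s ->
  (forall u, processed (var s va) C1 C2 N (arr s aK) u) ->
  SInv 0 (setv s va (var s va).+1).
Proof.
move=> [fE c1E c2E I] pr; split=> //=; apply: inv_next => // u ru lou hiu.
by apply: pr => //; rewrite hiu.
Qed.

Lemma wp_name_list s : SInv 0 s -> 3 <= var s va < var s vnx ->
  W name_list s (fun s' t => [/\ SInv 0 s', grows s s',
    forall u, processed (var s va) C1 C2 N (arr s' aK) u &
    t <= 220 * count (fun v => arr s aK v == var s va) (iota 1 N) + 20]).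
Proof.
move=> SI /andP[a3 an]; have Wb := bound_w; case: (SI) => fE c1E c2E I0.
have nxN := inv_nx_max I0.
have [l [ch ul ml]] := inv_list I0 a3.
have szl : size l = count (fun v => arr s aK v == var s va) (iota 1 N).
  rewrite -size_filter; apply/perm_size/uniq_perm => //.
    by apply: filter_uniq; exact: iota_uniq.
  by move=> v; rewrite ml mem_filter real_iota andbC.
apply: wp_seq; apply: wp_assign => //=; first by repeat split=> //; rewrite /S; lia.
(* [l] is the list of class [a] found at the start: [l1] has been walked, [l2] remains, and each
   member is worth 220 credits. *)
pose I p s' := exists l1 l2, [/\ l = l1 ++ l2 , p = 220 * size l2,
  SInv 0 s', grows s s' & chain (arr s' aX) (var s' vv) l2 /\
  (forall v, v \in l1 -> processed (var s va) C1 C2 N (arr s' aK) (F v))].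
apply: wp_conseq.
- apply: (@wp_while _ _ _ Sm Sw I _ _ (220 * size l)).
  + by move=> p s' _ /=; split=> //; lia.
  + move=> p s' [l1 [l2 [lE -> SI' gr [ch' pr]]]] /= v0.
    case: (SI') => fE' _ _ I'.
    have [l3 l2E] := chain_pos v0 ch'; rewrite l2E in lE ch' *.
    have vl : var s' vv \in l by rewrite lE mem_cat inE eqxx orbT.
    have [rv /eqP Kv] : real N (var s' vv) /\ arr s aK (var s' vv) == var s va.
      by apply/andP; rewrite -ml.
    have vN' : var s' vv <= N by case/andP: rv.
    have [kv prg nx] := gr.
    have aE : var s' va = var s va by case: kv => ->.
    have FN : F (var s' vv) <= N by case: fF => /(_ _ rv).
    apply: wp_seq; apply: wp_assign => //=; first by repeat split=> //; rewrite /S; lia.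
    set s1 := setv _ _ _.
    have gr1 : grows s s1 by case: gr => *; split=> //; rewrite /s1; keep.
    have gr1' : grows s' s1.
      by split=> //; [rewrite /s1; keep | exact: progress_refl].
    apply: wp_seq; apply: wp_conseq.
      apply: wp_try_grows => //=; rewrite ?fE' //.
      by rewrite aE; lia.
    move=> s2 t [SI2 gr2 pro [vE uE] tle].
    apply: wp_assign => //=; first by repeat split=> //; rewrite vE /S /=; lia.
    rewrite vE; exists (220 * size l3); last by rewrite /=; lia.
    exists (rcons l1 (var s' vv)), l3; split=> //.
    + by rewrite cat_rcons.
    + by case: (grows_trans gr1 gr2) => *; split=> //; keep.
    + have [_ pr2 _] := gr2; rewrite /= aE in pr2 pro.
      case: ch' => _ _ ch3; split=> /=.
        have Kv' : 0 < arr s' aK (var s' vv).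
          by have [o _] := prg; have [|-> _] := o (var s' vv); rewrite ?Kv; lia.
        have [o _] := pr2.
        have [_ ->] := o _ Kv'.
        (* Members of the list are already named, so their successors have not been touched. *)
        suff /(_ l3) : forall l4, {subset l4 <= l3} ->
            forall h, chain (arr s' aX) h l4 -> chain (arr s2 aX) h l4.
          by apply.
        elim=> //= x l4 IH sub h [-> x0 chx]; split=> //.
        have xl : x \in l by rewrite lE mem_cat inE (sub x) ?inE ?eqxx ?orbT.
        have /eqP Kx : arr s aK x == var s va by move: xl; rewrite ml => /andP[].
        have Kx' : 0 < arr s' aK x.
          by have [o' _] := prg; have [|-> _] := o' x; rewrite ?Kx; lia.
        have [_ ->] := o _ Kx'.
        by apply: IH => // y yl; apply: sub; rewrite inE yl orbT.
      move=> v; rewrite mem_rcons inE => /orP[/eqP->|vl1].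
        by move: pro; rewrite fE'.
      by apply: processed_progress pr2 _; exact: pr.
  + exists [::], l; split=> //.
    by split=> //; [keep|exact: progress_refl].
- move=> s' t [p' [[l1 [l2 [lE -> SI' gr [ch' pr]]]] /= v0 tle]].
  have l20 : l2 = [::].
    by case: (l2) ch' v0 => //= x l' [-> x0 _]; rewrite x0.
  rewrite l20 cats0 in lE.
  split=> //; last by rewrite -szl; lia.
  move=> u ru lou hiu.
  have [kv [o n] nx] := gr; case: (SI') => _ _ _ I'.
  have aE : var s' va = var s va by case: kv => ->.
  case: (ltnP (hi C1 C2 (arr s' aK) u) (var s va)) => [hlt|hge].
    by apply: (inv_complete I'); rewrite // aE.
  (* A pair with maximum [a] has a child of class [a]; that child is in the list, and its parent was
     tried. *)
  have [c cu Kc] : exists2 c, c = C1 u \/ c = C2 u & arr s' aK c = var s va.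
    move: hiu hge; rewrite /hi; case: (leqP (arr s' aK (C1 u)) (arr s' aK (C2 u))) => _ h1 h2.
      by exists (C2 u); [right|lia].
    by exists (C1 u); [left|lia].
  have cN : c <= N.+1.
    by case: fF => _ /(_ u ru)[]; case: cu => ->.
  have rc : real N c.
    have c0 : c <> 0 by move=> c0; move: Kc; rewrite c0 (inv_none I'); lia.
    have cN1 : c <> N.+1 by move=> cE; move: Kc; rewrite cE (inv_cut I'); lia.
    by rewrite /real; lia.
  have cl : c \in l1.
    rewrite -lE ml rc /=; case: (posnP (arr s aK c)) => [/n[]|/o[e _]]; try lia.
  have FcE : F c = u by case: fF => _ _ /(_ u c ru rc cu).
  by move: (pr c cl); rewrite FcE; apply.
Qed.

Lemma wp_name_classes s : arr s aF = F -> arr s aC1 = C1 -> arr s aC2 = C2 ->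
  var s vN = N -> (forall x, arr s aK x = 0) -> (forall x, arr s aH x = 0) ->
  (forall x, arr s aST x = 0) ->
  W name_classes s (fun s' t => [/\ naming N C1 C2 (arr s' aK),
    keeps name_vars [:: aK; aH; aX; aST; aNM] s s' &
    t <= 1000 * N + 1000]).
Proof.
move=> fE c1E c2E NE K0 H0 st0; have Wb := bound_w.
apply: wp_seq; apply: wp_store => //=; try by rewrite /S; lia.
apply: wp_seq; apply: wp_store => //=; rewrite ?NE; try by rewrite /S; lia.
  by repeat split=> //; lia.
rewrite addn1.
apply: wp_seq; apply: wp_assign => //=; first by lia.
apply: wp_seq; apply: wp_assign => //=; first by lia.
set s1 := setv _ _ _.
have SI1 : SInv 0 s1.
  rewrite /s1; split=> //=; apply: inv_init => // [|v].
  - by rewrite updE.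
  - by rewrite /real => rv; rewrite !upd_neq //; lia.
have ks1 : keeps name_vars [:: aK; aH; aX; aST; aNM] s s1.
  by rewrite /s1; keep.
have kg s2 s3 : grows s2 s3 -> keeps name_vars [:: aK; aH; aX; aST; aNM] s2 s3.
  by case=> k _ _; exact: keeps_sub k.
apply: wp_seq; apply: wp_conseq; first exact: wp_name_all.
move=> s2 t2 [SI2 gr2 pr2 tle2].
have a2 : var s2 va = 1 by case: gr2 => -[/(_ va isT) ->].
have ks2 := keeps_trans ks1 (kg _ _ gr2).
apply: wp_seq; apply: wp_assign => //=; first by lia.
have := SInv_next SI2; rewrite a2 => /(_ pr2).
set s3 := setv _ _ _ => SI3.
have ks3 : keeps name_vars [:: aK; aH; aX; aST; aNM] s s3.
  by rewrite /s3; keep.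
apply: wp_seq; apply: wp_conseq.
  apply: wp_name_all => //; first by case: ks3 => /(_ vN isT) ->.
  by case: SI3 => _ _ _ /inv_nx3.
move=> s4 t4 [SI4 gr4 pr4 tle4].
have a4 : var s4 va = 2 by case: gr4 => -[/(_ va isT) ->].
have ks4 := keeps_trans ks3 (kg _ _ gr4).
apply: wp_seq; apply: wp_assign => //=; first by lia.
have := SInv_next SI4; rewrite a4 => /(_ pr4).
set s5 := setv _ _ _ => SI5.
have ks5 : keeps name_vars [:: aK; aH; aX; aST; aNM] s s5.
  by rewrite /s5; keep.
(* Each vertex whose class is still to be processed holds 220 credits, and each value of [a] up to
   [N + 3] holds 100. *)
pose I p s' := [/\ SInv 0 s', keeps name_vars [:: aK; aH; aX; aST; aNM] s s',
  3 <= var s' va <= var s' vnx &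
  p = 220 * count (fun v => (arr s' aK v == 0) || (var s' va <= arr s' aK v)) (iota 1 N)
      + 100 * (N + 3 - var s' va)].
apply: wp_conseq.
- apply: (@wp_while _ _ _ Sm Sw I).
  + by move=> p s' [_ _ _ _].
  + move=> p s' [SI' ks' /andP[a3 _] ->] /= an.
    have nxN : var s' vnx <= N + 3 by case: SI' => _ _ _ /inv_nx_max; rewrite addn0.
    apply: wp_seq; apply: wp_conseq; first by apply: wp_name_list => //; rewrite a3.
    move=> s6 t6 [SI6 gr6 pr6 tle6].
    have a6 : var s6 va = var s' va by case: gr6 => -[/(_ va isT) ->].
    apply: wp_assign => //=; first by split=> //; lia.
    rewrite a6 addn1.
    exists (220 * count (fun v => (arr s6 aK v == 0) || (var s' va < arr s6 aK v)) (iota 1 N)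
            + 100 * (N + 3 - (var s' va).+1)).
      split=> //=.
      * by have := SInv_next SI6; rewrite a6; apply.
      * by keep; exact: keeps_trans ks' (kg _ _ gr6).
      * by case: gr6; lia.
    have [_ prg _] := gr6; rewrite (count_progress _ prg).
    set c1 := count _ _ in tle6; set c2 := count _ _; set c3 := count _ _.
    have -> : c3 = c1 + c2.
      pose P1 v := arr s' aK v == var s' va.
      pose P2 v := (arr s' aK v == 0) || (var s' va < arr s' aK v).
      have <- := count_predUI P1 P2 (iota 1 N).
      rewrite [X in _ + X](@eq_count _ _ pred0) ?count_pred0; last first.
        by move=> v; rewrite /P1 /P2 /=; lia.
      by rewrite addn0; apply: eq_count => v; rewrite /P1 /P2 /=; lia.
    by lia.
  + split=> //; first by case: SI5 => _ _ _ /inv_nx3.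
- move=> s' t [p' [[SI' ks' /andP[a3 an] ->] /=]]; rewrite -leqNgt => nxa tle.
  have ea : var s' va = var s' vnx by lia.
  split=> //.
  + by case: SI' => _ _ _; rewrite ea => /inv_naming; apply; exact: fF.
  + have : count (fun v => (arr s5 3 v == 0) || (var s5 5 <= arr s5 3 v)) (iota 1 N) <= N.
      by apply: leq_trans (count_size _ _) _; rewrite size_iota.
    by rewrite /= in tle *; lia.
Qed.

End NameProg.

(** * Cycles and least rotations *)

(** Lexicographic order on infinite words, phrased without asserting that a first difference
    exists. *)
Definition wle (a b : nat -> nat) : Prop :=
  forall d, (forall e, e < d -> a e = b e) -> a d <= b d.

Lemma wle_anti a b : wle a b -> wle b a -> forall d, a d = b d.
Proof.
move=> ab ba; elim/ltn_ind=> d IH; apply/eqP; rewrite eqn_leq ab //= ba // => e /IH.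
by [].
Qed.

(** * Least rotation of a periodic word by two pointers *)

Section Rotation.
Variables (s : nat -> nat) (L : nat).
Hypotheses (L0 : 0 < L) (per : forall p, s (p + L) = s p).

(** Rotations of a cyclic word are represented by the suffixes of its infinite repetition, so
    positions need no reduction modulo [L]. *)
Definition lexlt (p q : nat) : Prop :=
  exists2 d, forall e, e < d -> s (p + e) = s (q + e) & s (p + d) < s (q + d).
Definition nonmin (p : nat) : Prop := exists q, lexlt q p.
Definition least (p : nat) : Prop :=
  forall q, wle (fun d => s (p + d)) (fun d => s (q + d)).

Lemma per_mul p k : s (p + k * L) = s p.
Proof. by elim: k => [|k IH]; rewrite ?mul0n ?addn0 // mulSn addnCA addnC per. Qed.

Lemma per_mod p e : s (p + e) = s (p + e %% L).
Proof. by rewrite -(per_mul (p + e %% L) (e %/ L)) {1}(divn_eq e L) -addnA [_ * L + _]addnC. Qed.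

Lemma not_nonmin p : ~ nonmin p -> least p.
Proof.
move=> np q d eqd; rewrite leqNgt; apply/negP => lt.
by case: np; exists q, d => // e /eqd.
Qed.

Definition lexltb p q := has (fun d =>
  all (fun e => s (p + e) == s (q + e)) (iota 0 d) && (s (p + d) < s (q + d)))
  (iota 0 L).

(** By periodicity, words that agree on [L] letters agree everywhere, so a first difference lies
    below [L]. *)
Lemma lexltP p q : reflect (lexlt p q) (lexltb p q).
Proof.
apply: (iffP hasP) => [[d _ /andP[/allP ae lt]]|[d ae lt]].
  by exists d => // e ed; apply/eqP/ae; rewrite mem_iota.
exists d; last by rewrite lt andbT; apply/allP => e; rewrite mem_iota => /ae->.
rewrite mem_iota /= add0n ltnNge; apply/negP => Ld; move: lt.
rewrite per_mod [s (q + d)]per_mod ae ?ltnn //.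
by apply: leq_trans Ld; rewrite ltn_mod.
Qed.

Lemma lexlt_trans p q r : lexlt p q -> lexlt q r -> lexlt p r.
Proof.
move=> [d1 e1 l1] [d2 e2 l2]; exists (minn d1 d2).
  by move=> e; rewrite leq_min => /andP[/e1-> /e2->].
case: (ltngtP d1 d2) => [lt|lt|E]; first by rewrite -(e2 _ lt).
  by rewrite (e1 _ lt).
by rewrite -E in l2; apply: ltn_trans l2.
Qed.

Lemma lexlt_irr p : ~ lexlt p p.
Proof. by case=> d _; rewrite ltnn. Qed.

Lemma exists_least_in (l : seq nat) x : exists2 p, p \in x :: l &
  forall q, q \in x :: l -> ~ lexlt q p.
Proof.
elim: l x => [|y l IH] x.
  by exists x; rewrite ?mem_head // => q; rewrite inE => /eqP->; exact: lexlt_irr.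
have [p pl minp] := IH y.
case: (lexltP x p) => [lt|nlt].
  exists x; rewrite ?mem_head // => q; rewrite inE => /orP[/eqP->|ql].
    exact: lexlt_irr.
  by move=> /lexlt_trans/(_ lt); exact: minp.
exists p; first by rewrite inE pl orbT.
by move=> q; rewrite inE => /orP[/eqP->|/minp].
Qed.

Lemma exists_least : exists p, least p.
Proof.
have [p _ minp] := exists_least_in (iota 1 L.-1) 0.
exists p; apply: not_nonmin => -[q [d ae lt]].
apply: (minp (q %% L)).
  have := ltn_pmod q L0; rewrite inE mem_iota; lia.
have E e : s (q %% L + e) = s (q + e).
  rewrite -[LHS](per_mul _ (q %/ L)); congr s.
  by rewrite [in RHS](divn_eq q L); lia.
by exists d => [f fd|]; rewrite !E // ae.
Qed.

Lemma least_nonmin p : least p -> ~ nonmin p.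
Proof.
move=> mp [q [d ae lt]]; have := mp q d; rewrite leqNgt lt.
by move=> /(_ (fun e ed => esym (ae e ed))).
Qed.

(* The rotation at [i + x] loses against the one at [j + x], so [k.+1] starting
   points are discarded for the [k.+1] comparisons made. *)
Lemma nonmin_skip i j k p : (forall e, e < k -> s (i + e) = s (j + e)) ->
  s (j + k) < s (i + k) -> i <= p <= i + k -> nonmin p.
Proof.
move=> ae lt /andP[ip pk]; exists (j + (p - i)), (k - (p - i)).
  move=> e le; have -> : p + e = i + (p - i + e) by lia.
  by rewrite -addnA ae //; lia.
have -> : j + (p - i) + (k - (p - i)) = j + k by lia.
by have -> : p + (k - (p - i)) = i + k by lia.
Qed.

Definition candidates (i j : nat) : Prop :=
  [/\ i <> j, minn i j < L &
      forall p, p < maxn i j -> p <> i -> p <> j -> nonmin p].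

Lemma candidatesC i j : candidates i j -> candidates j i.
Proof.
by rewrite /candidates minnC maxnC => -[ij lL H]; split=> [/esym//|//|p pm pj pi]; apply: H.
Qed.

(** If the jump lands on [j], pointer [i] takes over that candidate and [j] moves one further, so
    that the pointers stay distinct. *)
Lemma candidates_step i j k : candidates i j -> i < L -> j < L ->
  (forall e, e < k -> s (i + e) = s (j + e)) -> s (j + k) < s (i + k) ->
  candidates (i + k).+1 (if (i + k).+1 == j then j.+1 else j).
Proof.
move=> [ij _ H] iL jL ae lt; have sk p := @nonmin_skip i j k p ae lt.
case: eqP => [E|nE]; split; try lia.
- move=> p pm pi pj; case: (ltnP p i) => pi'; last by apply: sk; lia.
  by apply: H; lia.
- move=> p pm pi pj; case: (boolP (i <= p <= i + k)) => [/sk //|np].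
  by apply: H; lia.
Qed.

(** With [i < j], a least position can be brought below [j]: subtract [L] if [j] is at least [L], or
    [j - i] if the words at [i] and [j] agree over a whole period. Below [j], only [i] has not been
    excluded. *)
Lemma candidates_end i j : candidates i j ->
  L <= maxn i j \/ (forall e, e < L -> s (i + e) = s (j + e)) -> least (minn i j).
Proof.
wlog ij : i j / i < j.
  move=> wl cij H; have [lt|[lt|E]] : i < j \/ j < i \/ i = j by lia.
  - exact: wl.
  - rewrite minnC; apply: wl => //; first exact: candidatesC.
    by case: H => [|H]; [left; rewrite maxnC|right=> e /H].
  - by case: cij; rewrite E.
case=> _; rewrite (minn_idPl (ltnW ij)) (maxn_idPr (ltnW ij)) => iL H end_.
have [p0 lp0] := exists_least.
elim/ltn_ind: p0 lp0 => p0 IH lp0.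
case: (ltnP p0 j) => [ltj|lej].
  case: (eqVneq p0 i) => [<- //|/eqP ni].
  by case: (least_nonmin lp0); apply: H => // E; rewrite E ltnn in ltj.
have shift p : p < p0 -> (forall d, s (p0 + d) = s (p + d)) -> least i.
  move=> lt E; apply: IH lt _ => q d ae; rewrite -E; apply: lp0 => e /ae.
  by rewrite E.
case: end_ => [Lj|agree].
  apply: (shift (p0 - L)); first by lia.
  move=> d; rewrite -[RHS]per; congr s; lia.
apply: (shift (p0 - (j - i))); first by lia.
move=> d; have -> : p0 - (j - i) + d = i + (p0 - j + d) by lia.
have -> : p0 + d = j + (p0 - j + d) by lia.
rewrite per_mod [RHS]per_mod agree //; exact: ltn_pmod.
Qed.
End Rotation.

(** * Unnamed vertices form the cycles; choice of the cuts *)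

Section Cycles.
Variable N : nat.
Variables F C1 C2 : nat -> nat.

Definition graph : Prop :=
  [/\ forall v, real N v -> real N (F v),
      forall u, real N u -> C1 u <= N /\ C2 u <= N,
      forall u c, real N u -> real N c -> F c = u <-> c = C1 u \/ c = C2 u &
      forall u, real N u -> C1 u = C2 u -> C1 u = 0].

Hypothesis gF : graph.

Lemma graph_forest : forest N F C1 C2.
Proof.
case: gF => gr gC gE _; split.
- by move=> v /gr/andP[].
- by move=> u /gC[]; lia.
- by move=> u c ru rc /(gE u c ru rc).
Qed.

Variable K : nat -> nat.
Hypothesis nK : naming N C1 C2 K.

(** Having no class is taken as the definition of lying on a cycle; [cyc_period] shows that such a
    vertex is periodic. *)
Definition cyc (v : nat) : bool := real N v && (K v == 0).

Lemma cyc_F v : cyc v -> cyc (F v).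
Proof.
case: gF => gr _ gE _ /andP[rv /eqP Kv]; rewrite /cyc gr //=.
case: (posnP (K (F v))) => // KF.
have [lo0 _] := naming_children nK (gr _ rv) KF.
have : v = C1 (F v) \/ v = C2 (F v) by apply/gE => //; exact: gr.
by move: lo0; rewrite /lo => lo0 [] e; rewrite -e Kv in lo0; lia.
Qed.

Lemma cyc_iter v i : cyc v -> cyc (iter i F v).
Proof. by move=> cv; elim: i => //= i; exact: cyc_F. Qed.

Lemma unnamed_child u : cyc u -> exists2 v, cyc v & F v = u.
Proof.
case: gF => gr gC gE _ /andP[ru /eqP Ku].
have H c : c = C1 u \/ c = C2 u -> K c = 0 -> exists2 v, cyc v & F v = u.
  move=> cu Kc; have rc : real N c.
    have : c <> 0 by move=> c0; move: Kc; rewrite c0 (naming_none nK).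
    by have [? ?] := gC u ru; rewrite /real; case: cu => ->; lia.
  by exists c; [rewrite /cyc rc Kc|apply/gE].
case: (posnP (lo C1 C2 K u)) => [|lo0].
  rewrite /lo; case: leqP => _; [apply: (H (C1 u)); by left|apply: (H (C2 u)); by right].
by have := naming_complete nK ru lo0; rewrite Ku.
Qed.

(** By [unnamed_child], [F] maps the finite set of unnamed vertices onto itself; hence it is
    injective there. *)
Lemma cyc_inj u v : cyc u -> cyc v -> F u = F v -> u = v.
Proof.
pose s := [seq v <- iota 1 N | cyc v].
have ms x : (x \in s) = cyc x.
  by rewrite mem_filter -real_iota /cyc; case: (real N x); rewrite ?andbF ?andbT.
have us : uniq s by apply: filter_uniq; exact: iota_uniq.
have um : uniq (map F s).
  apply: (@leq_size_uniq _ s) => //; last by rewrite size_map.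
  move=> x; rewrite ms => /unnamed_child[y cy <-].
  by apply: map_f; rewrite ms.
rewrite -!ms => us' vs' E.
have iu := us'; have iv := vs'; rewrite -index_mem in iu; rewrite -index_mem in iv.
rewrite -(nth_index 0 us') -(nth_index 0 vs'); congr nth; apply/eqP.
rewrite -(nth_uniq 0 _ _ um) ?size_map //.
by rewrite !(nth_map 0) // !nth_index // E.
Qed.

Lemma cyc_iter_inj i u v : cyc u -> cyc v -> iter i F u = iter i F v -> u = v.
Proof.
move=> cu cv; elim: i => //= i IH /cyc_inj E; apply/IH/E; exact: cyc_iter.
Qed.

(** By the pigeonhole principle two iterates coincide, and injectivity cancels the common initial
    steps. *)
Lemma cyc_period v : cyc v -> exists2 L, 0 < L & iter L F v = v.
Proof.
move=> cv; pose s := [seq iter i F v | i <- iota 0 N.+1].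
have : ~~ uniq s.
  apply/negP => us; suff : size s <= size (iota 1 N) by rewrite size_map !size_iota ltnn.
  apply: uniq_leq_size => // x /mapP[i _ ->].
  by rewrite -real_iota; case/andP: (cyc_iter i cv).
case/(uniqPn 0) => i [j [ij jN]].
rewrite size_map size_iota in jN.
rewrite !(nth_map 0) ?size_iota ?nth_iota //; try lia.
rewrite !add0n => E; exists (j - i); first by lia.
apply/esym/(@cyc_iter_inj i) => //; first exact: cyc_iter.
by rewrite E -iterD; congr iter; lia.
Qed.

Lemma iter_period L v k : iter L F v = v -> iter (k * L) F v = v.
Proof. by move=> E; elim: k => //= k IH; rewrite mulSn iterD IH. Qed.

(** On a cycle one child is unnamed and contributes 0, so the sum is the class of the attached tree,
    or 1 if there is none. *)
Definition lab (v : nat) : nat := K (C1 v) + K (C2 v).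
Definition word (v : nat) : nat -> nat := fun d => lab (iter d F v).

Record cuts (CUT : nat -> nat) : Prop := Cuts {
  cuts_cyc : forall c, 0 < CUT c -> cyc c;
  cuts_least : forall c p, 0 < CUT c -> wle (word c) (word (iter p F c));
  cuts_exist : forall v, cyc v -> exists p, 0 < CUT (iter p F v);
  cuts_uniq : forall c p, 0 < CUT c -> 0 < CUT (iter p F c) -> iter p F c = c }.

(** Loop invariant, [v0] being the next vertex to examine. By [done_F] the visited vertices form
    whole cycles, for which the requirements of [cuts] already hold. *)
Record cycles_done (v0 : nat) (VIS CUT : nat -> nat) : Prop := CyclesDone {
  done_cyc : forall v, 0 < VIS v -> cyc v;
  done_F : forall v, cyc v -> (0 < VIS (F v)) = (0 < VIS v);
  done_lt : forall v, v < v0 -> cyc v -> 0 < VIS v;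
  done_cut : forall c, 0 < CUT c -> 0 < VIS c;
  done_least : forall c p, 0 < CUT c -> wle (word c) (word (iter p F c));
  done_exist : forall v, 0 < VIS v -> exists p, 0 < CUT (iter p F v);
  done_uniq : forall c p, 0 < CUT c -> 0 < CUT (iter p F c) -> iter p F c = c }.

Lemma done_init VIS CUT : (forall x, VIS x = 0) -> (forall x, CUT x = 0) ->
  cycles_done 1 VIS CUT.
Proof.
move=> V0 C0; split=> [c|v _|[|//]|c|c p|v|c p]; rewrite ?V0 ?C0 //.
Qed.

Lemma done_cuts VIS CUT : cycles_done N.+1 VIS CUT -> cuts CUT.
Proof.
case=> dc dF dl dcut dle de du; split=> //.
- by move=> c /dcut/dc.
- move=> v cv; apply: de; apply: dl => //.
  by case/andP: cv => /andP[_]; lia.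
Qed.

Lemma done_skip v0 VIS CUT : cycles_done v0 VIS CUT ->
  (cyc v0 -> 0 < VIS v0) -> cycles_done v0.+1 VIS CUT.
Proof.
case=> dc dF dl dcut dle de du V0; split=> // v; rewrite ltnS leq_eqVlt.
by case/orP => [/eqP->|] //; exact: dl.
Qed.

Lemma done_iter v0 VIS CUT v p : cycles_done v0 VIS CUT -> cyc v ->
  (0 < VIS (iter p F v)) = (0 < VIS v).
Proof.
move=> D cv; elim: p => //= p <-; apply: (done_F D); exact: cyc_iter.
Qed.

Lemma done_add v0 VIS CUT VIS' L q : cycles_done v0 VIS CUT -> cyc v0 ->
  VIS v0 = 0 -> 0 < L -> iter L F v0 = v0 ->
  (forall x, 0 < VIS' x <-> 0 < VIS x \/ exists2 i, i < L & x = iter i F v0) ->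
  least (word v0) q ->
  cycles_done v0.+1 VIS' (upd CUT (iter q F v0) 1).
Proof.
move=> D cv0 V0 L0 per V' lq.
have orbit p : exists2 i, i < L & iter p F v0 = iter i F v0.
  exists (p %% L); first exact: ltn_pmod.
  by rewrite {1}(divn_eq p L) addnC iterD iter_period.
have orb_V p : 0 < VIS' (iter p F v0).
  by apply/V'; right; have [i iL E] := orbit p; exists i.
have orb_new p : VIS (iter p F v0) = 0.
  by have := done_iter p D cv0; rewrite V0; lia.
have cutE c : 0 < upd CUT (iter q F v0) 1 c -> c = iter q F v0 \/ 0 < CUT c.
  by rewrite /upd; case: eqP; [left|right].
have cutI c : 0 < CUT c -> 0 < upd CUT (iter q F v0) 1 c.
  by rewrite /upd; case: eqP.
have cut_old c p : 0 < CUT c -> iter p F c <> iter q F v0.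
  move=> Cc E; have Vc := done_cut D Cc.
  have := done_iter p D (done_cyc D Vc); rewrite E orb_new Vc; by [].
split.
- by move=> v /V'[/(done_cyc D)|[i _ ->]] //; exact: cyc_iter.
- move=> v cv; apply/idP/idP => /V'[].
  + by rewrite (done_F D) // => Vv; apply/V'; left.
  + case=> i iL E.
    (* A full turn is added before stepping back, since [i] may be 0. *)
    have -> : v = iter (i + L).-1 F v0.
      apply: cyc_inj => //; first exact: cyc_iter.
      rewrite E -iterS prednK; last by lia.
      by rewrite iterD per.
    exact: orb_V.
  + by move=> Vv; apply/V'; left; rewrite (done_F D).
  + by case=> i iL ->; rewrite -iterS; exact: orb_V.
- move=> v; rewrite ltnS leq_eqVlt => /orP[/eqP-> _|lt cv].
    exact: (orb_V 0).
  by apply/V'; left; apply: (done_lt D).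
- move=> c /cutE[->|/(done_cut D) Vc]; first exact: orb_V.
  by apply/V'; left.
- move=> c p /cutE[->|]; last exact: (done_least D).
  have := lq (p + q) => H d ae; rewrite /word -!iterD.
  have := H d; rewrite /word ![_ + d]addnC addnA; apply => e /ae.
  by rewrite /word -!iterD addnC => ->; congr (lab (iter _ F v0)); lia.
- move=> v /V'[/(done_exist D)[p Cp]|[i iL ->]]; first by exists p; exact: cutI.
  exists (q + (L - i)); rewrite -iterD.
  have -> : q + (L - i) + i = q + L by lia.
  by rewrite iterD per updE.
- move=> c p /cutE[->|Cc] /cutE[E|Cp] //.
  + by have := done_cut D Cp; rewrite -iterD orb_new.
  + by case: (cut_old _ _ Cc E).
  + exact: (done_uniq D) Cc Cp.
Qed.

End Cycles.

(** * The program cutting the cycles *)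

Notation vci := 16 (only parsing).
Notation vcj := 17 (only parsing).

Definition walk_cycle : cmd :=
  assign vL (Cst 1) ;;
  store aVIS (Var vv) (Cst 1) ;;
  assign vx (Get aF (Var vv)) ;;
  whilec (CEq (Get aVIS (Var vx)) (Cst 0))
    (store aVIS (Var vx) (Cst 1) ;;
     assign vL (Plus (Var vL) (Cst 1)) ;;
     assign vx (Get aF (Var vx))).

Definition label (x : nat) : expr :=
  Plus (Get aK (Get aC1 (Var x))) (Get aK (Get aC2 (Var x))).

(** The vertex [fi] is already [k] steps ahead of [ci], so the jump by [k + 1] takes a single step
    along [F]. *)
Definition skip_start (i j ci cj fi : nat) : cmd :=
  assign i (Plus (Plus (Var i) (Var vk)) (Cst 1)) ;;
  assign ci (Get aF (Var fi)) ;;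
  ifc (CEq (Var i) (Var j))
    (assign j (Plus (Var j) (Cst 1)) ;;
     assign cj (Get aF (Var cj)))
    Skip.

Definition rotate_step : cmd :=
  assign vx (label vfi) ;;
  assign vy (label vfj) ;;
  ifc (CEq (Var vx) (Var vy))
    (assign vk (Plus (Var vk) (Cst 1)) ;;
     assign vfi (Get aF (Var vfi)) ;;
     assign vfj (Get aF (Var vfj)))
    (ifc (CLt (Var vy) (Var vx))
       (skip_start vi vj vci vcj vfi)
       (skip_start vj vi vcj vci vfj) ;;
     assign vk (Cst 0) ;;
     assign vfi (Var vci) ;;
     assign vfj (Var vcj)).

Definition rotate : cmd :=
  assign vi (Cst 0) ;;
  assign vj (Cst 1) ;;
  assign vk (Cst 0) ;;
  assign vci (Var vv) ;;
  assign vcj (Get aF (Var vv)) ;;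
  assign vfi (Var vci) ;;
  assign vfj (Var vcj) ;;
  whilec (CLt (Cst 0) (Min (Min (Minus (Var vL) (Var vi)) (Minus (Var vL) (Var vj)))
                           (Minus (Var vL) (Var vk))))
    rotate_step.

Definition cut_cycles : cmd :=
  assign vv (Cst 1) ;;
  whilec (CLt (Var vv) (Plus (Var vN) (Cst 1)))
    (ifc (CEq (Get aK (Var vv)) (Cst 0))
       (ifc (CEq (Get aVIS (Var vv)) (Cst 0))
          (walk_cycle ;;
           rotate ;;
           ifc (CLt (Var vi) (Var vj))
             (store aCUT (Var vci) (Cst 1))
             (store aCUT (Var vcj) (Cst 1)))
          Skip)
       Skip ;;
     assign vv (Plus (Var vv) (Cst 1))).

(** * Correctness and linear cost of the cutting program *)

Section CycleProg.
Variables (m w N : nat).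
Let S := N + 4.
Hypotheses (Sm : narrs * S <= m) (Sw : narrs * S <= 2 ^ w).
Variables F C1 C2 K : nat -> nat.
Hypothesis gF : graph N F C1 C2.
Hypothesis nK : naming N C1 C2 K.
Let W c s Q := wp m w S c s Q.
Let Wb : 12 * (N + 4) <= 2 ^ w := Sw.

Definition graph_in (s : hstate) : Prop :=
  [/\ arr s aF = F, arr s aC1 = C1, arr s aC2 = C2, arr s aK = K & var s vN = N].

Lemma graph_in_keeps vs As s s' : graph_in s -> keeps vs As s s' ->
  all (fun i => i != vN) vs -> all (fun A => 3 < A) As -> graph_in s'.
Proof.
move=> [fE c1 c2 kE NE] [kv kA] /allP hv /allP hA.
have nv : vN \notin vs by apply/negP => /hv.
have nA A : A <= 3 -> A \notin As by move=> A3; apply/negP => /hA; lia.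
by split; rewrite ?kv ?kA // nA.
Qed.

Lemma cyc_bound v : cyc N K v -> v < S.
Proof. by case/andP => /andP[_]; rewrite /S; lia. Qed.

Lemma wp_walk_cycle s : graph_in s -> let v := var s vv in
  cyc N K v -> arr s aVIS v = 0 ->
  (forall u, cyc N K u -> 0 < arr s aVIS (F u) -> 0 < arr s aVIS u) ->
  W walk_cycle s (fun s' t => exists2 L, [/\ 0 < L <= N, iter L F v = v, var s' vL = L &
      forall x, 0 < arr s' aVIS x <->
                0 < arr s aVIS x \/ exists2 i, i < L & x = iter i F v] &
    [/\ keeps [:: vL; vx] [:: aVIS] s s',
        count (fun v => arr s' aVIS v == 0) (iota 1 N) + L =
          count (fun v => arr s aVIS v == 0) (iota 1 N) &
        t <= 40 * L + 40]).
Proof.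
move=> G v cv Vv back; case: (G) => fE _ _ _ _.
have vS := cyc_bound cv; have vN_ : v <= N by case/andP: cv => /andP[].
have cvi i : cyc N K (iter i F v) by exact: (cyc_iter gF nK).
have Vback i : 0 < arr s aVIS (iter i F v) -> 0 < arr s aVIS v.
  by elim: i => //= i IH /(back _ (cvi i)).
pose I p s' := exists2 L, [/\ 0 < L, var s' vL = L, var s' vx = iter L F v &
    forall x, 0 < arr s' aVIS x <->
              0 < arr s aVIS x \/ exists2 i, i < L & x = iter i F v] &
    [/\ forall i, 0 < i < L -> iter i F v <> v, keeps [:: vL; vx] [:: aVIS] s s',
        count (fun v => arr s' aVIS v == 0) (iota 1 N) + L =
          count (fun v => arr s aVIS v == 0) (iota 1 N) &
        p = 40 * (count (fun v => arr s' aVIS v == 0) (iota 1 N))].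
have cnt_set g u : real N u -> g u = 0 ->
    count (fun v => upd g u 1 v == 0) (iota 1 N) + 1 = count (fun v => g v == 0) (iota 1 N).
  move=> ru gu; have H := @count_upd (fun x => x != 0) g u 1 (iota 1 N) (iota_uniq _ _).
  have := H; rewrite -real_iota gu => /(_ ru isT isT) {}H.
  have cP (h : nat -> nat) : count (fun v => h v == 0) (iota 1 N) +
      count (fun v => h v != 0) (iota 1 N) = N.
    by rewrite -[RHS](size_iota 1) -(count_predC (fun v => h v == 0)).
  have := cP g; have := cP (upd g u 1); lia.
have rv : real N v by case/andP: cv.
apply: wp_seq; apply: wp_assign => //=; first by lia.
apply: wp_seq; apply: wp_store => //=; first by lia.
apply: wp_seq; apply: wp_assign => //=.
rewrite fE -/v.
set s1 := setv _ _ _.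
have count_le g : count (fun v => g v == 0 :> nat) (iota 1 N) <= N.
  by apply: leq_trans (count_size _ _) _; rewrite size_iota.
apply: wp_conseq.
- apply: (@wp_while _ _ _ Sm Sw I _ _ (40 * count (fun v => arr s1 aVIS v == 0) (iota 1 N))).
  + move=> p s' [L [L0 LE xE V'] _] /=; rewrite xE.
    by repeat split=> //; [exact/cyc_bound/cvi|lia].
  + move=> p s' [L [L0 LE xE V'] [np k' cnt ->]] /= /eqP.
    rewrite xE => VL.
    have G' := graph_in_keeps G k' isT isT; case: (G') => fE' _ _ _ _.
    have xS := cyc_bound (cvi L); have rx : real N (iter L F v) by case/andP: (cvi L).
    have := cnt_set _ _ rx VL => cnt1.
    have := count_le (arr s aVIS) => cntle.
    apply: wp_seq; apply: wp_store => //=; rewrite ?xE //; first by lia.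
    apply: wp_seq; apply: wp_assign => //=; rewrite ?LE; first by repeat split=> //; lia.
    apply: wp_assign => //=; first by rewrite xE; split=> //; exact: xS.
    rewrite fE' xE addn1.
    exists (40 * (count (fun x => upd (arr s' aVIS) (iter L F v) 1 x == 0) (iota 1 N))); last by lia.
    exists L.+1; split=> //=.
    * move=> x; rewrite /upd; case: eqP => [->|nx].
        by split=> // _; right; exists L.
      rewrite V'; split=> -[?|[i iL E]]; [by left|right|by left|right].
        by exists i => //; lia.
      exists i => //; move: iL; rewrite ltnS leq_eqVlt => /orP[/eqP iE|//].
      by case: nx; rewrite E iE.
    * move=> i /andP[i0]; rewrite ltnS leq_eqVlt => /orP[/eqP->|iL]; last by apply: np; rewrite i0.
      move=> E; rewrite E in VL; have := V' v; rewrite VL => -[_ H].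
      by suff: 0 < 0 by []; apply: H; right; exists 0.
    * by keep.
    * by lia.
  + exists 1; split=> //=.
    * move=> x; rewrite /upd; case: eqP => [->|nx].
        by split=> // _; right; exists 0.
      split=> [Vx|[//|[[|//] _ E]]]; first by left.
      by case: nx.
    * by case=> [|[]].
    * by rewrite /s1; keep.
    * by rewrite cnt_set.
- move=> s' t [p [[L [L0 LE xE V'] [np k' cnt ->]] /= Vx tle]].
  rewrite xE in Vx.
  (* The walk stops at a visited vertex. It was not visited before the walk, for then [v] would be
     too; if it is the [i]-th vertex of the walk with [0 < i], injectivity gives a return to [v]
     after [L - i] steps, which [np] forbids. *)
  have VLv : iter L F v = v.
    rewrite -lt0n in Vx; case/V': Vx => [/Vback|[i iL E]]; first by rewrite Vv.
    case: (posnP i) => [i0|i0]; first by rewrite E i0.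
    case: (np (L - i)); first by lia.
    apply: (cyc_iter_inj gF nK (i := i)) => //.
    by rewrite -iterD subnKC 1?ltnW.
  have := count_le (arr s aVIS) => cntle.
  exists L; first by split=> //; rewrite L0; lia.
  split=> //; move: tle; rewrite /s1 /=.
  have := cnt_set _ _ rv Vv. lia.
Qed.

Lemma wp_rotate s v L : graph_in s -> var s vv = v -> cyc N K v ->
  var s vL = L -> 0 < L <= N -> iter L F v = v ->
  W rotate s (fun s' t => exists2 q, least (word F C1 C2 K v) q &
    [/\ (if var s' vi < var s' vj then var s' vci else var s' vcj) = iter q F v,
        keeps [:: vi; vj; vk; vci; vcj; vfi; vfj; vx; vy] [::] s s' &
        t <= 500 * L + 100]).
Proof.
move=> G vE cv LE /andP[L0 LN] per; case: (G) => fE c1E c2E kE _.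
have cvi i : cyc N K (iter i F v) by exact: (cyc_iter gF nK).
have cS i := cyc_bound (cvi i).
have child i : C1 (iter i F v) <= N /\ C2 (iter i F v) <= N.
  by case: gF => _ h _ _; apply: h; case/andP: (cvi i).
have Kmax c : c <= N -> K c <= N + 3.
  move=> cN; case: (posnP c) => [->|c0]; first by rewrite (naming_none nK); lia.
  by have := @naming_range _ _ _ _ nK c; rewrite /real c0 cN => /(_ isT); lia.
set wd := word F C1 C2 K v.
have wper p : wd (p + L) = wd p by rewrite /wd /word iterD per.
(* The sum [i + j + k] grows at every step, as a jump by [k + 1] outweighs the reset of [k]; it is
   at most [2L + 2L + L]. *)
pose I p s' := [/\ keeps [:: vi; vj; vk; vci; vcj; vfi; vfj; vx; vy] [::] s s',
   [/\ candidates wd L (var s' vi) (var s' vj), var s' vi <= 2 * L,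
       var s' vj <= 2 * L & var s' vk <= L],
   [/\ var s' vci = iter (var s' vi) F v, var s' vcj = iter (var s' vj) F v,
       var s' vfi = iter (var s' vi + var s' vk) F v &
       var s' vfj = iter (var s' vj + var s' vk) F v],
   forall e, e < var s' vk -> wd (var s' vi + e) = wd (var s' vj + e) &
   p = 100 * (5 * L - (var s' vi + var s' vj + var s' vk))].
apply: wp_seq; apply: wp_assign => //=; first by lia.
apply: wp_seq; apply: wp_assign => //=; first by lia.
apply: wp_seq; apply: wp_assign => //=; first by lia.
apply: wp_seq; apply: wp_assign => //=.
apply: wp_seq; apply: wp_assign => //=.
  by rewrite vE; repeat split=> //; exact: (cS 0).
apply: wp_seq; apply: wp_assign => //=.
apply: wp_seq; apply: wp_assign => //=.
rewrite fE vE; set s1 := setv _ _ _.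
apply: wp_conseq.
- apply: (@wp_while _ _ _ Sm Sw I _ _ (100 * (5 * L - 1))).
  + by move=> p s' _ /=; repeat split=> //; lia.
  + move=> p s' [k' [cand iL jL kL] [ciE cjE fiE fjE] ae ->] /= cnd.
    have G' := graph_in_keeps G k' isT isT; case: (G') => fE' c1E' c2E' kE' _.
    have LE' : var s' vL = L by case: k' => ->.
    rewrite LE' in cnd.
    have {cnd} [iL' jL' kL'] : [/\ var s' vi < L, var s' vj < L & var s' vk < L].
      by split; lia.
    set i := var s' vi in cand iL ciE fiE ae iL' *.
    set j := var s' vj in cand jL cjE fjE ae jL' *.
    set k := var s' vk in kL fiE fjE ae kL' *.
    have [ci1 ci2] := child (i + k); have [cj1 cj2] := child (j + k).
    have := Kmax _ ci1; have := Kmax _ ci2; have := Kmax _ cj1; have := Kmax _ cj2.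
    move=> K1 K2 K3 K4.
    apply: wp_seq; apply: wp_assign => //=.
      rewrite fiE c1E' c2E' kE'; repeat split=> //; try exact: cS; rewrite /S; lia.
    apply: wp_seq; apply: wp_assign => //=.
      rewrite fjE c1E' c2E' kE'; repeat split=> //; try exact: cS; rewrite /S; lia.
    rewrite fiE fjE c1E' c2E' kE'.
    have <- : wd (i + k) = K (C1 (iter (i + k) F v)) + K (C2 (iter (i + k) F v)) by [].
    have <- : wd (j + k) = K (C1 (iter (j + k) F v)) + K (C2 (iter (j + k) F v)) by [].
    apply: (wp_if Sm Sw) => //=.
    * move=> /eqP wE.
      apply: wp_seq; apply: wp_assign => //=; first by repeat split=> //; lia.
      apply: wp_seq; apply: wp_assign => //=.
        by rewrite fiE; repeat split=> //; exact: cS.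
      apply: wp_assign => //=.
        by rewrite fjE; repeat split=> //; exact: cS.
      rewrite fE' fiE fjE -/k -!iterS.
      exists (100 * (5 * L - (i + j + k.+1))); last by lia.
      split=> //=.
      - by keep.
      - by split=> //; lia.
      - by rewrite -/i -/j addn1 !addnS.
      - rewrite addn1 => e; rewrite ltnS leq_eqVlt => /orP[/eqP->|] //; exact: ae.
      - by rewrite addn1.
    * move=> /eqP wne.
      apply: wp_seq; apply: (wp_if Sm Sw) => //=.
      - move=> lt.
        have cand' := candidates_step L0 cand iL' jL' ae lt.
        apply: wp_seq; apply: wp_assign => //=; first by repeat split=> //; lia.
        apply: wp_seq; apply: wp_assign => //=.
          by rewrite fiE; repeat split=> //; exact: cS.
        rewrite fE' fiE -/i -/j -/k -iterS addn1.
        apply: (wp_if Sm Sw) => //=.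
          rewrite -/j => /eqP E; rewrite E eqxx in cand'.
          apply: wp_seq; apply: wp_assign => //=; first by repeat split=> //; lia.
          apply: wp_assign => //=; first by rewrite cjE; split=> //; exact: cS.
          apply: wp_seq; apply: wp_assign => //=; first by lia.
          apply: wp_seq; apply: wp_assign => //=.
          apply: wp_assign => //=.
          rewrite -/j fE' cjE -iterS addn1 E.
          exists (100 * (5 * L - (j + j.+1))); last by lia.
          split=> //=.
          - by keep.
          - by split=> //; lia.
          - by rewrite !addn0.
          - by rewrite addn0.
        rewrite -/j => nE; rewrite (negPf nE) in cand'.
        apply: wp_skip.
        apply: wp_seq; apply: wp_assign => //=; first by lia.
        apply: wp_seq; apply: wp_assign => //=.
        apply: wp_assign => //=.
        rewrite cjE.
        exists (100 * (5 * L - ((i + k).+1 + j))); last by lia.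
        split=> //=.
        - by keep.
        - by split=> //; lia.
        - by rewrite !addn0.
        - by rewrite addn0.
      - move=> nlt.
        have lt : wd (i + k) < wd (j + k) by lia.
        have ae' e (ek : e < k) : wd (j + e) = wd (i + e) by rewrite ae.
        have cand' := candidatesC (candidates_step L0 (candidatesC cand) jL' iL' ae' lt).
        apply: wp_seq; apply: wp_assign => //=; first by repeat split=> //; lia.
        apply: wp_seq; apply: wp_assign => //=.
          by rewrite fjE; repeat split=> //; exact: cS.
        rewrite fE' fjE -/i -/j -/k -iterS addn1.
        apply: (wp_if Sm Sw) => //=.
          rewrite -/i => /eqP E; rewrite E eqxx in cand'.
          apply: wp_seq; apply: wp_assign => //=; first by repeat split=> //; lia.
          apply: wp_assign => //=; first by rewrite ciE; split=> //; exact: cS.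
          apply: wp_seq; apply: wp_assign => //=; first by lia.
          apply: wp_seq; apply: wp_assign => //=.
          apply: wp_assign => //=.
          rewrite -/i fE' ciE -iterS addn1 E.
          exists (100 * (5 * L - (i + i.+1))); last by lia.
          split=> //=.
          - by keep.
          - by split=> //; lia.
          - by rewrite !addn0.
          - by rewrite addn0 addnC.
        rewrite -/i => nE; rewrite (negPf nE) in cand'.
        apply: wp_skip.
        apply: wp_seq; apply: wp_assign => //=; first by lia.
        apply: wp_seq; apply: wp_assign => //=.
        apply: wp_assign => //=.
        rewrite ciE.
        exists (100 * (5 * L - (i + (j + k).+1))); last by lia.
        split=> //=.
        - by keep.
        - by split=> //; lia.
        - by rewrite !addn0.
        - by rewrite addn0.
  + split=> //=.
    * by rewrite /s1; keep.
    * split=> //; try lia.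
      by split=> // -[|p] //; lia.
- move=> s' t [p [[k' [cand iL jL kL] [ciE cjE fiE fjE] ae ->]] /= cnd tle].
  have LE' : var s' vL = L by case: k' => ->.
  rewrite LE' in cnd.
  exists (minn (var s' vi) (var s' vj)); last first.
    split=> //; last by lia.
    by rewrite /minn; case: ifP.
  apply: (candidates_end L0 wper) => //.
  (* If both pointers are still below [L], the loop ended because a whole period was compared. *)
  case: (leqP L (maxn (var s' vi) (var s' vj))) => [|lt]; [by left|right].
  have -> : L = var s' vk by lia.
  exact: ae.
Qed.

Definition cut_vars := [:: vv; vL; vi; vj; vk; vci; vcj; vfi; vfj; vx; vy].

Lemma wp_cut_cycles s : graph_in s -> (forall x, arr s aVIS x = 0) ->
  (forall x, arr s aCUT x = 0) ->
  W cut_cycles s (fun s' t => [/\ cuts N F C1 C2 K (arr s' aCUT),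
    keeps cut_vars [:: aVIS; aCUT] s s' & t <= 2200 * N + 100]).
Proof.
move=> G V0 C0.
(* The vertices of a cycle pay together, 2000 credits each, for walking it and finding its least
   rotation; the other 100 pay for the scan. *)
pose I p s' := [/\ 0 < var s' vv <= N.+1,
  cycles_done N F C1 C2 K (var s' vv) (arr s' aVIS) (arr s' aCUT),
  keeps cut_vars [:: aVIS; aCUT] s s' &
  p = 2000 * count (fun x => arr s' aVIS x == 0) (iota 1 N)
            + 100 * (N.+1 - var s' vv)].
apply: wp_seq; apply: wp_assign => //=; first by lia.
set s1 := setv _ _ _.
apply: wp_conseq.
- apply: (@wp_while _ _ _ Sm Sw I _ _ (2000 * count (fun x => arr s1 aVIS x == 0) (iota 1 N)
            + 100 * (N.+1 - 1))).
  + move=> p s' [_ _ ks _] /=; have [_ _ _ _ NE] := graph_in_keeps G ks isT isT.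
    by repeat split=> //; rewrite ?NE; lia.
  + move=> p s' [/andP[v1 _] D ks ->] /=.
    have G' := graph_in_keeps G ks isT isT; case: (G') => fE c1E c2E kE NE.
    rewrite NE addn1 => vN_.
    have rv : real N (var s' vv) by rewrite /real; lia.
    have vS : var s' vv < S by rewrite /S; lia.
    have skip (c : nat) : (cyc N K (var s' vv) -> 0 < arr s' aVIS (var s' vv)) -> c <= 50 ->
        wp m w S (assign vv (Plus (Var vv) (Cst 1))) s'
         (fun s2 t2 => exists2 p', I p' s2 & c + t2 + 4 + p' <=
           2000 * count (fun x => arr s' aVIS x == 0) (iota 1 N)
            + 100 * (N.+1 - var s' vv)).
      move=> done_v c50; apply: wp_assign => //=; first by repeat split=> //; lia.
      exists (2000 * count (fun x => arr s' aVIS x == 0) (iota 1 N)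
            + 100 * (N.+1 - (var s' vv).+1)); last by lia.
      by rewrite addn1; split=> //=; [exact: done_skip|keep].
    apply: wp_seq; apply: (wp_if Sm Sw) => /=; first by repeat split=> //; lia.
      rewrite kE => /eqP Kv; have cv : cyc N K (var s' vv) by rewrite /cyc rv Kv.
      apply: (wp_if Sm Sw) => /=; first by repeat split=> //; lia.
        move=> /eqP Vv.
        apply: wp_seq; apply: wp_conseq.
          apply: wp_walk_cycle => // u cu; by rewrite (done_F D).
        move=> s2 t2 [L [/andP[L0 LN] per LE V2] [ks2 cnt t2le]].
        have G2 := graph_in_keeps G' ks2 isT isT.
        have v2 : var s2 vv = var s' vv by case: ks2 => ->.
        apply: wp_seq; apply: wp_conseq.
          by apply: (@wp_rotate s2 (var s' vv) L) => //; rewrite L0.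
        move=> s3 t3 [q lq [cE ks3 t3le]].
        have v3 : var s3 vv = var s' vv by rewrite -v2; case: ks3 => ->.
        have V3 : arr s3 aVIS = arr s2 aVIS by case: ks3 => _ ->.
        have C3 : arr s3 aCUT = arr s' aCUT.
          by case: ks3 => _ -> //; case: ks2 => _ ->.
        have D3 := done_add gF nK D cv Vv L0 per V2 lq.
        have ks13 : keeps cut_vars [:: aVIS; aCUT] s s3.
          apply: (keeps_trans ks); apply: (@keeps_trans _ _ _ s2).
            exact: keeps_sub ks2.
          exact: keeps_sub ks3.
        have cS : iter q F (var s' vv) < S.
          by apply: cyc_bound; exact: (cyc_iter gF nK).
        apply: (wp_if Sm Sw) => //= ij; rewrite ?(negPf ij) ?ij in cE.
          apply: wp_store => //=; rewrite ?cE //; first by lia.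
          apply: wp_assign => //=; first by repeat split=> //; lia.
          rewrite v3 addn1.
          exists (2000 * count (fun x => arr s2 aVIS x == 0) (iota 1 N)
            + 100 * (N.+1 - (var s' vv).+1)); last by lia.
          by split=> //=; [rewrite V3 C3|keep|rewrite V3].
        apply: wp_store => //=; rewrite ?cE //; first by lia.
        apply: wp_assign => //=; first by repeat split=> //; lia.
        rewrite v3 addn1.
        exists (2000 * count (fun x => arr s2 aVIS x == 0) (iota 1 N)
            + 100 * (N.+1 - (var s' vv).+1)); last by lia.
        by split=> //=; [rewrite V3 C3|keep|rewrite V3].
      move=> Vv; apply: wp_skip; apply: wp_conseq; first apply: (skip 50) => //.
        by move=> _; rewrite lt0n.
      by move=> s2 t2 [p' Ip le]; exists p' => //; lia.
    rewrite kE => Kv; apply: wp_skip; apply: wp_conseq; first apply: (skip 50) => //.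
      by rewrite /cyc (negPf Kv) andbF.
    by move=> s2 t2 [p' Ip le]; exists p' => //; lia.
  + by split=> //=; [exact: done_init|rewrite /s1; keep].
- move=> s' t [p [[/andP[v1 vN_] D ks ->] /= cnd tle]].
  have [_ _ _ _ NE] := graph_in_keeps G ks isT isT.
  rewrite NE -leqNgt in cnd.
  have vE : var s' vv = N.+1 by lia.
  rewrite vE in D; split=> //; first exact: done_cuts D.
  have : count (fun x => arr s 8 x == 0) (iota 1 N) <= N.
    by apply: leq_trans (count_size _ _) _; rewrite size_iota.
  by lia.
Qed.

End CycleProg.

(** * The other passes *)

(** An entry of the input is a number, counted from 0, within its own graph; adding 1 or [n + 1]
    turns it into an address. *)
Definition shift_input : cmd :=
  for_ vv (Cst 1) (Plus (Var vn) (Cst 1))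
    (store aF (Var vv) (Plus (Get aF (Var vv)) (Cst 1))) ;;
  for_ vv (Plus (Var vn) (Cst 1)) (Plus (Var vN) (Cst 1))
    (store aF (Var vv) (Plus (Get aF (Var vv)) (Plus (Var vn) (Cst 1)))).

Definition find_children : cmd :=
  for_ vv (Cst 1) (Plus (Var vN) (Cst 1))
    (assign vu (Get aF (Var vv)) ;;
     ifc (CEq (Get aC1 (Var vu)) (Cst 0))
       (store aC1 (Var vu) (Var vv))
       (store aC2 (Var vu) (Var vv))).

Definition cut_child (A : nat) : cmd :=
  ifc (CEq (Get aK (Get A (Var vv))) (Cst 0))
    (store A (Var vv) (Plus (Var vN) (Cst 1))) Skip.

Definition apply_cuts : cmd :=
  for_ vv (Cst 1) (Plus (Var vN) (Cst 1))
    (ifc (CLt (Cst 0) (Get aCUT (Var vv))) (cut_child aC1 ;; cut_child aC2) Skip ;;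
     ifc (CEq (Get aK (Var vv)) (Cst 0))
       (ifc (CLt (Cst 0) (Get aCUT (Get aF (Var vv)))) (store aF (Var vv) (Cst 0)) Skip)
       Skip).

(** Classes, list heads and stamps are reset; a successor or a name is read only behind a nonzero
    head or a valid stamp. *)
Definition clear_names : cmd :=
  for_ vv (Cst 0) (Plus (Var vN) (Cst 4))
    (store aK (Var vv) (Cst 0) ;; store aH (Var vv) (Cst 0) ;;
     store aST (Var vv) (Cst 0)).

Definition count_roots : cmd :=
  for_ vv (Cst 1) (Plus (Var vN) (Cst 1))
    (ifc (CEq (Get aF (Var vv)) (Cst 0))
       (assign vx (Get aK (Var vv)) ;;
        ifc (CLt (Var vv) (Plus (Var vn) (Cst 1)))
          (store aCG (Var vx) (Plus (Get aCG (Var vx)) (Cst 1)))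
          (store aCH (Var vx) (Plus (Get aCH (Var vx)) (Cst 1))))
       Skip).

Definition compare_counts : cmd :=
  assign vAns (Cst 1) ;;
  for_ vv (Cst 0) (Plus (Var vN) (Cst 4))
    (ifc (CEq (Get aCG (Var vv)) (Get aCH (Var vv))) Skip (assign vAns (Cst 0))).

(** The edge removed is the one entering a cut vertex along its cycle. Its source becomes a root,
    and its target receives the leaf [N.+1] in place of that child. *)
Definition cutF (F K CUT : nat -> nat) (x : nat) : nat :=
  if (K x == 0) && (0 < CUT (F x)) then 0 else F x.
Definition cutC (N : nat) (K CUT C : nat -> nat) (x : nat) : nat :=
  if (0 < CUT x) && (K (C x) == 0) then N.+1 else C x.

Section Loops.
Variables (m w n : nat).
Let N := n + n.
Let S := N + 4.
Hypotheses (Sm : narrs * S <= m) (Sw : narrs * S <= 2 ^ w).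
Let W c s Q := wp m w S c s Q.
Let Wb : 12 * (n + n + 4) <= 2 ^ w := Sw.

Lemma wp_shift_input s : var s vn = n -> var s vN = N ->
  (forall x, real N x -> arr s aF x < n) ->
  W shift_input s (fun s' t => [/\
    forall x, real N x -> arr s' aF x = arr s aF x + (if x <= n then 1 else n.+1),
    keeps [:: vv] [:: aF] s s' & t <= 40 * N + 100]).
Proof.
move=> nE NE Fn; have Nb : N = n + n by [].
pose I k s' := keeps [:: vv] [:: aF] s s' /\ forall x,
  arr s' aF x = if 0 < x < k then arr s aF x + (if x <= n then 1 else n.+1) else arr s aF x.
apply: wp_seq; apply: wp_conseq.
  apply: (@wp_for _ _ _ Sm Sw I _ _ _ _ 1 n.+1 10) => //; try lia.
  - by rewrite /=; lia.
  - by split=> [|x /=]; [keep|case: ifP => //; lia].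
  - move=> k s' [[kv _] _] _ /=; rewrite (kv vn) // nE addn1.
    by repeat split=> //; lia.
  - move=> k s' /andP[k1 kn] [ks FE] vE.
    have rk : real N k by rewrite /real; lia.
    have := Fn _ rk => Fk.
    have FkE : arr s' aF k = arr s aF k by rewrite FE ltnn andbF.
    apply: wp_store => //=; rewrite ?vE ?FkE; try by rewrite /S; lia.
      by repeat split=> //; rewrite /S; lia.
    split=> //; split=> [|x /=]; first by keep.
    rewrite /upd; case: eqP => [->|nk]; first by rewrite k1 ltnSn -ltnS kn addn1.
    by rewrite FE; congr (if _ then _ else _); lia.
move=> s1 t1 [[ks1 F1] v1 t1le].
have n1 : var s1 vn = n by case: ks1 => ->.
have N1 : var s1 vN = N by case: ks1 => ->.
apply: wp_conseq.
  apply: (@wp_for _ _ _ Sm Sw I _ _ _ _ n.+1 N.+1 10) => //; try lia.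
  - by rewrite /= n1; split=> //; lia.
  - by rewrite /= n1 addn1.
  - by split=> //; keep.
  - move=> k s' [[kv _] _] _ /=; rewrite (kv vN) // NE addn1.
    by repeat split=> //; lia.
  - move=> k s' /andP[k1 kn] [ks FE] vE.
    have rk : real N k by rewrite /real; lia.
    have := Fn _ rk => Fk.
    have FkE : arr s' aF k = arr s aF k by rewrite FE ltnn andbF.
    have n' : var s' vn = n by case: ks => ->.
    apply: wp_store => //=; rewrite ?vE ?FkE ?n'; try by rewrite /S; lia.
      by repeat split=> //; rewrite /S; lia.
    split=> //; split=> [|x /=]; first by keep.
    rewrite /upd; case: eqP => [->|nk].
      have -> : 0 < k < k.+1 by lia.
      by rewrite leqNgt k1 addn1.
    by rewrite FE; congr (if _ then _ else _); lia.
move=> s2 t2 [[ks2 F2] v2 t2le]; split=> //.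
  by move=> x rx; rewrite F2 ifT //; move: rx; rewrite /real; lia.
by rewrite /= in t1le t2le; lia.
Qed.

Section Children.
Variable F : nat -> nat.
Hypotheses (FR : forall v, real N v -> real N (F v))
  (F2 : forall x y z, real N x -> real N y -> real N z -> F x = F y -> F y = F z ->
        [\/ x = y, y = z | x = z]).

Lemma wp_find_children s : var s vN = N -> arr s aF = F ->
  (forall x, arr s aC1 x = 0) -> (forall x, arr s aC2 x = 0) ->
  W find_children s (fun s' t => [/\ graph N F (arr s' aC1) (arr s' aC2),
    keeps [:: vv; vu] [:: aC1; aC2] s s' & t <= 50 * N + 50]).
Proof.
move=> NE FE C10 C20; have Nb : N = n + n by [].
pose child k u c := real N c && (c < k) /\ F c = u.
pose I k s' := [/\ keeps [:: vv; vu] [:: aC1; aC2] s s',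
  forall u, 0 < arr s' aC1 u -> child k u (arr s' aC1 u),
  forall u, 0 < arr s' aC2 u -> child k u (arr s' aC2 u),
  forall c, real N c -> c < k -> c = arr s' aC1 (F c) \/ c = arr s' aC2 (F c) &
  forall u, [/\ arr s' aC1 u = arr s' aC2 u -> arr s' aC1 u = 0 &
                arr s' aC1 u = 0 -> arr s' aC2 u = 0]].
apply: wp_conseq.
  apply: (@wp_for _ _ _ Sm Sw I _ _ _ _ 1 N.+1 30) => //; try lia.
  - by rewrite /=; lia.
  - split=> [|u|u|c|u] /=; rewrite ?C10 ?C20 //; first by keep.
    by rewrite /real; lia.
  - move=> k s' [[kv _] _ _ _ _] _ /=; rewrite (kv vN) // NE addn1.
    by repeat split=> //; lia.
  - move=> k s' /andP[k1 kN] [ks c1 c2 cC cD] vE.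
    have rk : real N k by rewrite /real; lia.
    have Fs : arr s' aF = F by case: ks => _ ->.
    have rF := FR rk; have FS : F k < S by move: rF; rewrite /real /S; lia.
    have child_le u c : child k u c -> child k.+1 u c.
      by case=> /andP[rc ck] Fc; split=> //; rewrite rc ltnW.
    apply: wp_seq; apply: wp_assign => //=; rewrite ?vE.
      by repeat split=> //; rewrite /S; lia.
    rewrite Fs.
    apply: (wp_if Sm Sw) => //=; first by repeat split=> //; lia.
    + move=> /eqP c10; have [_ /(_ c10) c20] := cD (F k).
      apply: wp_store => //=; rewrite vE; split=> //=; split=> [|u|u|c rc|u] /=.
      * by keep.
      * rewrite /upd; case: eqP => [-> _|_ /c1/child_le] //.
        by split=> //; rewrite rk ltnSn.
      * by move/c2/child_le.
      * rewrite ltnS leq_eqVlt => /orP[/eqP->|ck]; first by left; rewrite updE.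
        rewrite /upd; case: eqP => [E|_]; last exact: cC.
        by have := cC c rc ck; rewrite E c10 c20; case=> c0; rewrite c0 in rc.
      * rewrite /upd; case: eqP => [->|_]; last exact: cD.
        by rewrite c20; split=> //; lia.
    + rewrite -lt0n => c10; have [rc1 F1] := c1 _ c10.
      have {rc1} [rc1 lt1] := andP rc1.
      (* Otherwise the two recorded children and [k] would be three vertices with the same image. *)
      have c20 : arr s' aC2 (F k) = 0.
        case: (posnP (arr s' aC2 (F k))) => // c20.
        have [/andP[rc2 lt2] Fc2] := c2 _ c20.
        have [nE _] := cD (F k).
        by case: (F2 rc1 rc2 rk); rewrite ?F1 ?Fc2 // => E; [have := nE E| |]; lia.
      apply: wp_store => //=; rewrite vE; split=> //=; split=> [|u|u|c rc|u] /=.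
      * by keep.
      * by move/c1/child_le.
      * rewrite /upd; case: eqP => [-> _|_ /c2/child_le] //.
        by split=> //; rewrite rk ltnSn.
      * rewrite ltnS leq_eqVlt => /orP[/eqP->|ck]; first by right; rewrite updE.
        rewrite /upd; case: eqP => [E|_]; last exact: cC.
        have := cC c rc ck; rewrite E c20; case=> c0; first by left.
        by rewrite c0 in rc.
      * rewrite /upd; case: eqP => [->|_]; last exact: cD.
        by split=> E; [rewrite E ltnn in lt1|rewrite E in c10].
move=> s' t [[ks c1 c2 cC cD] _ tle]; split=> //; last by rewrite /= in tle; lia.
split=> //.
- move=> u ru; split.
    by case: (posnP (arr s' aC1 u)) => [->|/c1[/andP[/andP[]]]].
  by case: (posnP (arr s' aC2 u)) => [->|/c2[/andP[/andP[]]]].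
- move=> u c ru rc; split=> [<-|]; first by apply: cC => //; case/andP: rc.
  have c0 : 0 < c by case/andP: rc.
  by case=> cE; rewrite cE in c0 *; [case: (c1 _ c0)|case: (c2 _ c0)].
- by move=> u _; case: (cD u).
Qed.

End Children.

Section Cuts.
Variables F C1 C2 K CUT : nat -> nat.
Hypothesis gF : graph N F C1 C2.

Lemma wp_apply_cuts s : var s vN = N -> arr s aF = F -> arr s aC1 = C1 ->
  arr s aC2 = C2 -> arr s aK = K -> arr s aCUT = CUT ->
  W apply_cuts s (fun s' t => [/\
    forall x, real N x -> [/\ arr s' aF x = cutF F K CUT x, arr s' aC1 x = cutC N K CUT C1 x &
                              arr s' aC2 x = cutC N K CUT C2 x],
    keeps [:: vv] [:: aF; aC1; aC2] s s' & t <= 100 * N + 100]).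
Proof.
move=> NE FE C1E C2E KE CE; have Nb : N = n + n by [].
pose I k s' := [/\ keeps [:: vv] [:: aF; aC1; aC2] s s',
  forall x, arr s' aF x = if 0 < x < k then cutF F K CUT x else F x,
  forall x, arr s' aC1 x = if 0 < x < k then cutC N K CUT C1 x else C1 x &
  forall x, arr s' aC2 x = if 0 < x < k then cutC N K CUT C2 x else C2 x].
have step k x (f g : nat -> nat) : x <> k ->
    (if 0 < x < k then f x else g x) = (if 0 < x < k.+1 then f x else g x).
  by move=> nk; congr (if _ then _ else _); lia.
have stepk k (f g : nat -> nat) : 0 < k -> (if 0 < k < k.+1 then f k else g k) = f k.
  by move=> k0; rewrite k0 ltnSn.
apply: wp_conseq.
  apply: (@wp_for _ _ _ Sm Sw I _ _ _ _ 1 N.+1 80) => //; try lia.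
  - by rewrite /=; lia.
  - split=> [|x|x|x] /=; rewrite ?FE ?C1E ?C2E; first by keep.
    + by case: ifP => //; lia.
    + by case: ifP => //; lia.
    + by case: ifP => //; lia.
  - move=> k s' [[kv _] _ _ _] _ /=; rewrite (kv vN) // NE addn1.
    by repeat split=> //; lia.
  - move=> k s' /andP[k1 kN] [ks fE c1E c2E] vE.
    have kk : (0 < k < k) = false by rewrite ltnn andbF.
    have rk : real N k by rewrite /real; lia.
    have kS : k < S by rewrite /S; lia.
    have K' : arr s' aK = K by case: ks => _ ->.
    have CUT' : arr s' aCUT = CUT by case: ks => _ ->.
    have N' : var s' vN = N by case: ks => ->.
    case: (gF) => gr gC _ _.
    have [c1N c2N] := gC _ rk.
    have FN : F k <= N by case/andP: (gr _ rk).
    have kF : arr s' aF k = F k by rewrite fE kk.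
    have kC1 : arr s' aC1 k = C1 k by rewrite c1E kk.
    have kC2 : arr s' aC2 k = C2 k by rewrite c2E kk.
    pose J s2 := [/\ keeps [:: vv] [:: aF; aC1; aC2] s s2, var s2 vv = k,
      arr s2 aF = arr s' aF,
      forall x, arr s2 aC1 x = if 0 < x < k.+1 then cutC N K CUT C1 x else C1 x &
      forall x, arr s2 aC2 x = if 0 < x < k.+1 then cutC N K CUT C2 x else C2 x].
    apply: wp_seq; apply: (@wp_conseq _ _ _ (fun s2 t2 => J s2 /\ t2 <= 50)).
      apply: (wp_if Sm Sw) => /=; first by rewrite vE; repeat split=> //; lia.
        rewrite vE CUT' => cut; apply: wp_seq.
        apply: (@wp_conseq _ _ _ (fun s2 t2 => [/\ keeps [:: vv] [:: aF; aC1; aC2] s s2, var s2 vv = k,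
      arr s2 aF = arr s' aF, arr s2 aC2 = arr s' aC2 &
      t2 <= 20 /\ forall x, arr s2 aC1 x = if 0 < x < k.+1 then cutC N K CUT C1 x else C1 x])).
          apply: (wp_if Sm Sw) => /=.
            by rewrite vE kC1; repeat split=> //; rewrite /S; lia.
            rewrite vE kC1 K' => Kc; apply: wp_store => //=; rewrite ?vE ?N' //.
              by repeat split=> //; lia.
            split=> //; first by keep.
            split=> // x; rewrite /upd; case: eqP => [->|nk].
              by rewrite stepk // /cutC cut Kc addn1.
            by rewrite c1E step.
          rewrite vE kC1 K' => Kc; apply: wp_skip; split=> //; split=> // x.
          case: (eqVneq x k) => [->|/eqP nk]; last by rewrite c1E step.
          by rewrite stepk // kC1 /cutC (negPf Kc) andbF.
        move=> s3 t3 [k3 v3 F3 C23 [t3le C13]].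
        have kC2' : arr s3 aC2 k = C2 k by rewrite C23.
        have K3 : arr s3 aK = K by case: k3 => _ ->.
        have N3 : var s3 vN = N by case: k3 => ->.
        apply: (wp_if Sm Sw) => /=.
          by rewrite v3 kC2'; repeat split=> //; rewrite /S; lia.
          rewrite v3 kC2' K3 => Kc; apply: wp_store => //=; rewrite ?v3 ?N3 //.
            by repeat split=> //; lia.
          split; last by lia.
          split=> //; first by keep.
          move=> x /=; rewrite /upd; case: eqP => [->|nk].
            by rewrite stepk // /cutC cut Kc addn1.
          by rewrite C23 c2E step.
        rewrite v3 kC2' K3 => Kc; apply: wp_skip; split; last by lia.
        split=> // x; case: (eqVneq x k) => [->|/eqP nk]; last by rewrite C23 c2E step.
        by rewrite stepk // kC2' /cutC (negPf Kc) andbF.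
      rewrite vE CUT' => ncut; apply: wp_skip; split=> //; split=> // x.
        case: (eqVneq x k) => [->|/eqP nk]; last by rewrite c1E step.
        by rewrite stepk // kC1 /cutC (negPf ncut).
      case: (eqVneq x k) => [->|/eqP nk]; last by rewrite c2E step.
      by rewrite stepk // kC2 /cutC (negPf ncut).
    move=> s3 t3 [[k3 v3 F3 C13 C23] t3le].
    have K3 : arr s3 aK = K by case: k3 => _ ->.
    have CUT3 : arr s3 aCUT = CUT by case: k3 => _ ->.
    apply: (wp_if Sm Sw) => /=; first by rewrite v3; repeat split=> //; lia.
      rewrite v3 K3 => Kk; apply: (wp_if Sm Sw) => /=.
        by rewrite v3 F3 kF; repeat split=> //; rewrite /S; lia.
        rewrite v3 F3 kF CUT3 => cut.
        apply: wp_store => //=; rewrite ?v3 //; first by lia.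
        split=> //; last by lia.
        split=> //=; first by keep.
        move=> x; rewrite /upd; case: eqP => [->|nk].
          by rewrite stepk // /cutF Kk cut.
        by rewrite F3 fE step.
      rewrite v3 F3 kF CUT3 => ncut; apply: wp_skip; split=> //; last by lia.
      split=> //=; first by keep.
      move=> x; case: (eqVneq x k) => [->|/eqP nk]; last by rewrite F3 fE step.
      by rewrite stepk // F3 kF /cutF (negPf ncut) andbF.
    rewrite v3 K3 => Kk; apply: wp_skip; split=> //; last by lia.
    split=> //=; first by keep.
    move=> x; case: (eqVneq x k) => [->|/eqP nk]; last by rewrite F3 fE step.
    by rewrite stepk // F3 kF /cutF (negPf Kk).
move=> s' t [[ks fE c1E c2E] _ tle]; split=> //; last by rewrite /= in tle; lia.
by move=> x rx; have rx' : 0 < x < N.+1 by []; rewrite fE c1E c2E rx'.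
Qed.

End Cuts.

Lemma wp_clear_names s : var s vN = N ->
  W clear_names s (fun s' t => [/\
    forall x, x < S -> [/\ arr s' aK x = 0, arr s' aH x = 0 & arr s' aST x = 0],
    keeps [:: vv] [:: aK; aH; aST] s s' & t <= 40 * N + 200]).
Proof.
move=> NE; have Nb : N = n + n by [].
pose I k s' := keeps [:: vv] [:: aK; aH; aST] s s' /\
  forall x, x < k -> [/\ arr s' aK x = 0, arr s' aH x = 0 & arr s' aST x = 0].
apply: wp_conseq.
  apply: (@wp_for _ _ _ Sm Sw I _ _ _ _ 0 S 15) => //; try (rewrite /S; lia).
  - by rewrite /=; lia.
  - by split=> //; keep.
  - move=> k s' [[kv _] _] _ /=; rewrite (kv vN) // NE.
    by repeat split=> //; lia.
  - move=> k s' kS [ks Z] vE.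
    apply: wp_seq; apply: wp_store => //=; rewrite ?vE //; first by lia.
    apply: wp_seq; apply: wp_store => //=; rewrite ?vE //; first by lia.
    apply: wp_store => //=; rewrite ?vE //; first by lia.
    split=> //; split=> [|x /=]; first by keep.
    rewrite ltnS leq_eqVlt => /orP[/eqP->|/Z[z1 z2 z3]]; first by rewrite !updE.
    by rewrite /upd; case: eqP.
move=> s' t [[ks Z] _ tle]; split=> //.
by move: tle; rewrite /= /S; lia.
Qed.

Definition root_count (F K : nat -> nat) (l : seq nat) (k : nat) : nat :=
  count (fun v => (F v == 0) && (K v == k)) l.

Lemma wp_count_roots s : var s vN = N -> var s vn = n ->
  (forall v, real N v -> arr s aK v < S) ->
  (forall x, arr s aCG x = 0) -> (forall x, arr s aCH x = 0) ->
  W count_roots s (fun s' t => [/\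
    forall k, arr s' aCG k = root_count (arr s aF) (arr s aK) (iota 1 n) k,
    forall k, arr s' aCH k = root_count (arr s aF) (arr s aK) (iota n.+1 n) k,
    keeps [:: vv; vx] [:: aCG; aCH] s s' & t <= 60 * N + 100]).
Proof.
move=> NE nE KS CG0 CH0; have Nb : N = n + n by [].
pose R := root_count (arr s aF) (arr s aK).
(* The vertices below [k] are shared between the two graphs. The last clause bounds the counters, so
   that incrementing them does not overflow. *)
pose I k s' := [/\ keeps [:: vv; vx] [:: aCG; aCH] s s',
  forall x, arr s' aCG x = R (iota 1 (minn k.-1 n)) x,
  forall x, arr s' aCH x = R (iota n.+1 (k.-1 - n)) x &
  forall x, x < S -> arr s' aCG x + arr s' aCH x <= k].
have Rext a l x : R (iota a l.+1) x = R (iota a l) x + R [:: a + l] x.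
  by rewrite /R /root_count -count_cat -[l.+1]addn1 iotaD.
have R1 v x : R [:: v] x = (arr s aF v == 0) && (arr s aK v == x).
  by rewrite /R /root_count /= addn0.
apply: wp_conseq.
  apply: (@wp_for _ _ _ Sm Sw I _ _ _ _ 1 N.+1 40) => //; try lia.
  - by rewrite /=; lia.
  - split=> [|x|x|x _] /=; rewrite ?CG0 ?CH0 //; first by keep.
    by rewrite min0n.
  - move=> k s' [[kv _] _ _ _] _ /=; rewrite (kv vN) // NE addn1.
    by repeat split=> //; lia.
  - move=> k s' /andP[k1 kN] [ks cg ch le] vE.
    have F' : arr s' aF = arr s aF by case: ks => _ ->.
    have K' : arr s' aK = arr s aK by case: ks => _ ->.
    have n' : var s' vn = n by case: ks => ->.
    have rk : real N k by rewrite /real; lia.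
    have kS : k < S by rewrite /S; lia.
    have := KS _ rk => KkS.
    have next x : R (iota 1 (minn k n)) x =
        R (iota 1 (minn k.-1 n)) x + (if k <= n then R [:: k] x else 0).
      case: ifP => kn.
        have -> : minn k n = (minn k.-1 n).+1 by lia.
        by rewrite Rext; congr (_ + R [:: _] _); lia.
      by rewrite addn0; congr (R (iota _ _) _); lia.
    have next' x : R (iota n.+1 (k - n)) x =
        R (iota n.+1 (k.-1 - n)) x + (if k <= n then 0 else R [:: k] x).
      case: ifP => kn; first by rewrite addn0; congr (R (iota _ _) _); lia.
      have -> : k - n = (k.-1 - n).+1 by lia.
      by rewrite Rext; congr (_ + R [:: _] _); lia.
    have eqE (a x : nat) (g : nat -> nat) : upd g a (g a + 1) x = g x + (a == x).
      by rewrite /upd eq_sym; case: eqP => [->|]; rewrite ?addn0.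
    apply: (wp_if Sm Sw) => /=; first by rewrite vE; repeat split=> //; lia.
      rewrite vE F' => Fk.
      apply: wp_seq; apply: wp_assign => //=; first by rewrite vE.
      rewrite vE K'; have := le _ KkS => leK.
      apply: (wp_if Sm Sw) => /=; first by rewrite n'; repeat split=> //; lia.
        rewrite vE n' addn1 ltnS => kn.
        apply: wp_store => //=; first by repeat split=> //; lia.
        split=> //; split=> [|x|x|x] /=.
        + by keep.
        + by rewrite next kn R1 Fk eqE cg.
        + by rewrite next' kn addn0.
        + rewrite eqE => /le; case: (_ == x); lia.
      rewrite vE n' addn1 ltnS => nkn.
      apply: wp_store => //=; first by repeat split=> //; lia.
      split=> //; split=> [|x|x|x] /=.
      + by keep.
      + by rewrite next (negPf nkn) addn0.
      + by rewrite next' (negPf nkn) R1 Fk eqE ch.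
      + rewrite eqE => /le; case: (_ == x); lia.
    rewrite vE F' => Fk; apply: wp_skip; split=> //; split=> [|x|x|x /le] /=.
    + by keep.
    + by rewrite next R1 (negPf Fk) if_same addn0.
    + by rewrite next' R1 (negPf Fk) if_same addn0.
    + by lia.
move=> s' t [[ks cg ch le] _ tle]; split=> //; last by rewrite /= in tle; lia.
  by move=> k; rewrite cg /=; congr (root_count _ _ (iota _ _) _); lia.
by move=> k; rewrite ch /=; congr (root_count _ _ (iota _ _) _); lia.
Qed.

Lemma wp_compare_counts s : var s vN = N ->
  W compare_counts s (fun s' t =>
    var s' vAns = all (fun k => arr s aCG k == arr s aCH k) (iota 0 S) /\
    t <= 40 * N + 200).
Proof.
move=> NE; have Nb : N = n + n by [].
apply: wp_seq; apply: wp_assign => //=; first by lia.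
set s1 := setv _ _ _.
pose I k s' := keeps [:: vAns; vv] [::] s s' /\
  var s' vAns = all (fun k => arr s aCG k == arr s aCH k) (iota 0 k).
apply: wp_conseq.
  apply: (@wp_for _ _ _ Sm Sw I _ _ _ _ 0 S 15) => //; try (rewrite /S; lia).
  - by rewrite /=; lia.
  - by split=> //; rewrite /s1; keep.
  - move=> k s' [[kv _] _] _ /=; rewrite (kv vN) // NE.
    by repeat split=> //; lia.
  - move=> k s' kS [ks aE] vE.
    have CG' : arr s' aCG = arr s aCG by case: ks => _ ->.
    have CH' : arr s' aCH = arr s aCH by case: ks => _ ->.
    have ext : all (fun k => arr s aCG k == arr s aCH k) (iota 0 k.+1) =
        all (fun k => arr s aCG k == arr s aCH k) (iota 0 k) && (arr s aCG k == arr s aCH k).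
      by rewrite -[k.+1]addn1 iotaD all_cat /= andbT.
    apply: (wp_if Sm Sw) => /=; first by rewrite vE; repeat split=> //.
      rewrite vE CG' CH' => e; apply: wp_skip; split=> //; split; first by keep.
      by rewrite ext e andbT.
    rewrite vE CG' CH' => e; apply: wp_assign => //=; first by lia.
    split=> //; split; first by keep.
    by rewrite ext (negPf e) andbF.
move=> s' t [[ks aE] _ tle]; split=> //.
by move: tle; rewrite /= /S; lia.
Qed.

End Loops.

(** * The main program *)

(** [rep] does not see an array beyond its first [S] entries, so an abstract state may be changed
    there. *)
Lemma wp_ext m w S c s s' Q : var s' = var s ->
  (forall A x, x < S -> arr s' A x = arr s A x) ->
  wp m w S c s' Q -> wp m w S c s Q.
Proof.
move=> ev ea H r [R1 R2 R3]; apply: H; split=> // [i|A x Al xS]; first by rewrite ev; exact: R1.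
by rewrite ea // R3.
Qed.

Definition main_loop : cmd :=
  shift_input ;; find_children ;; name_classes ;; cut_cycles ;; apply_cuts ;;
  clear_names ;; name_classes ;; count_roots ;; compare_counts.

Lemma naming_ext N C1 C2 C1' C2' K :
  (forall u, real N u -> C1 u = C1' u /\ C2 u = C2' u) ->
  naming N C1 C2 K -> naming N C1' C2' K.
Proof.
move=> E nK.
have hl u : real N u -> hi C1' C2' K u = hi C1 C2 K u /\ lo C1' C2' K u = lo C1 C2 K u.
  by case/E => e1 e2; rewrite /hi /lo e1 e2.
split; try by case: nK.
- by move=> u ru; have [_ ->] := hl _ ru; exact: (naming_complete nK).
- by move=> u ru; have [-> ->] := hl _ ru; exact: (naming_children nK).
- move=> u u' ru ru'; have [-> ->] := hl _ ru; have [-> ->] := hl _ ru'.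
  exact: (naming_eq nK).
Qed.

Lemma cut_forest N F C1 C2 K CUT : graph N F C1 C2 -> naming N C1 C2 K ->
  forest N (cutF F K CUT) (cutC N K CUT C1) (cutC N K CUT C2).
Proof.
case=> gr gC gE _ nK; split.
- by move=> v rv; rewrite /cutF; case: ifP => // _; case/andP: (gr _ rv).
- by move=> u /gC[c1 c2]; rewrite /cutC; split; case: ifP => _; lia.
- move=> u c ru rc ccase.
  have {ccase} [cu ncut] : (c = C1 u \/ c = C2 u) /\ ~~ ((0 < CUT u) && (K c == 0)).
    have nN : c <> N.+1 by move=> cN; move: rc; rewrite /real cN ltnn andbF.
    by case: ccase; rewrite /cutC; case: ifP => [_ /nN//|/negbT nc ce]; rewrite ce; split=> //; [left|right].
  have Fc : F c = u by apply/gE.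
  by rewrite /cutF Fc andbC ifN.
Qed.

Section Main.
Variables (m w n : nat).
Let N := n + n.
Let S := N + 4.
Hypotheses (Sm : narrs * S <= m) (Sw : narrs * S <= 2 ^ w).
Variables F a : nat -> nat.
Hypotheses (FE : forall x, real N x -> F x = a x + (if x <= n then 1 else n.+1))
  (a_lt : forall x, real N x -> a x < n)
  (F2 : forall x y z, real N x -> real N y -> real N z -> F x = F y -> F y = F z ->
        [\/ x = y, y = z | x = z]).

(** All that is retained of a run: the link between [ans] and isomorphism is then pure combinatorics
    on these maps. *)
Record outcome (ans : bool) : Prop := Outcome {
  oC1 : nat -> nat; oC2 : nat -> nat; oK : nat -> nat; oCUT : nat -> nat; oK2 : nat -> nat;
  out_graph : graph N F oC1 oC2;
  out_naming : naming N oC1 oC2 oK;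
  out_cuts : cuts N F oC1 oC2 oK oCUT;
  out_naming2 : naming N (cutC N oK oCUT oC1) (cutC N oK oCUT oC2) oK2;
  out_ans : ans = all (fun k => root_count (cutF F oK oCUT) oK2 (iota 1 n) k ==
                         root_count (cutF F oK oCUT) oK2 (iota n.+1 n) k) (iota 0 S) }.

Lemma wp_main_loop s : var s vn = n -> var s vN = N -> arr s aF = a ->
  (forall A x, 0 < A -> arr s A x = 0) ->
  wp m w S main_loop s (fun s' t => exists ans : bool,
    [/\ var s' vAns = ans, outcome ans & t <= 5000 * N + 5000]).
Proof.
move=> nE NE aE Z.
apply: wp_seq; apply: wp_conseq; first by apply: wp_shift_input; rewrite ?aE.
move=> s1 t1 [F1 k1 t1le]; rewrite aE in F1.
have n1 : var s1 vn = n by case: k1 => ->.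
have N1 : var s1 vN = N by case: k1 => ->.
have Z1 A x : 0 < A -> arr s1 A x = 0.
  by move=> A0; case: k1 => _ ->; [exact: Z|rewrite inE; lia].
have FE1 x : real N x -> arr s1 aF x = F x by move=> rx; rewrite F1 // FE.
have gR x : real N x -> real N (arr s1 aF x).
  move=> rx; rewrite FE1 // FE //; have := a_lt rx.
  by rewrite /real /N; case: ifP; lia.
apply: wp_seq; apply: wp_conseq.
  apply: (wp_find_children Sm Sw gR) => // [x y z rx ry rz|x|x]; try exact: Z1.
  by rewrite !FE1 //; exact: F2.
move=> s2 t2 [g2 k2 t2le].
have n2 : var s2 vn = n by case: k2 => ->.
have N2 : var s2 vN = N by case: k2 => ->.
have F2E : arr s2 aF = arr s1 aF by case: k2 => _ ->.
have Z2 A x : 3 <= A -> arr s2 A x = 0.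
  move=> A0; case: k2 => _ ->; last by rewrite !inE; lia.
  by apply: Z1; lia.
set C1 := arr s2 aC1 in g2; set C2 := arr s2 aC2 in g2.
apply: wp_seq; apply: wp_conseq.
  by apply: (wp_name_classes Sm Sw (graph_forest g2)) => // x; exact: Z2.
move=> s3 t3 [nK3 k3 t3le].
have n3 : var s3 vn = n by case: k3 => ->.
have N3 : var s3 vN = N by case: k3 => ->.
set K := arr s3 aK in nK3.
have Z3 A x : 8 <= A -> arr s3 A x = 0.
  move=> A0; case: k3 => _ ->; last by rewrite !inE; lia.
  by apply: Z2; lia.
have G3 : graph_in N (arr s1 aF) C1 C2 K s3.
  by split=> //; case: k3 => _ ->.
apply: wp_seq; apply: wp_conseq.
  by apply: (wp_cut_cycles Sm Sw g2 nK3 G3) => x; exact: Z3.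
move=> s4 t4 [cut4 k4 t4le].
have n4 : var s4 vn = n by case: k4 => ->.
have G4 : graph_in N (arr s1 aF) C1 C2 K s4 := graph_in_keeps Sm Sw G3 k4 isT isT.
have [F4 C14 C24 K4 N4] := G4.
set CUT := arr s4 aCUT in cut4.
have Z4 A x : 10 <= A -> arr s4 A x = 0.
  move=> A0; case: k4 => _ ->; last by rewrite !inE; lia.
  by apply: Z3; lia.
apply: wp_seq; apply: wp_conseq.
  by apply: (@wp_apply_cuts _ _ n Sm Sw (arr s1 aF) C1 C2 K CUT g2).
move=> s5 t5 [CE5 k5 t5le].
have n5 : var s5 vn = n by case: k5 => ->.
have N5 : var s5 vN = N by case: k5 => ->.
have Z5 A x : 10 <= A -> arr s5 A x = 0.
  move=> A0; case: k5 => _ ->; last by rewrite !inE; lia.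
  by apply: Z4; lia.
apply: wp_seq; apply: wp_conseq; first by apply: wp_clear_names.
move=> s6 t6 [Z6 k6 t6le].
(* Clearing reaches only the first [S] entries, while [wp_name_classes] asks for zeros everywhere;
   [s7] describes the same machine with zeros beyond. *)
pose s7 := HState (var s6) (fun A x => if x < S then arr s6 A x else 0).
apply: (@wp_ext _ _ _ _ _ s7) => [//|A x xS|]; first by rewrite /= xS.
have n7 : var s7 vn = n by case: k6 => /= ->.
have N7 : var s7 vN = N by case: k6 => /= ->.
have rS x : real N x -> x < S by rewrite /real /S; lia.
have CE7 x : real N x -> [/\ arr s7 aF x = cutF (arr s1 aF) K CUT x,
    arr s7 aC1 x = cutC N K CUT C1 x & arr s7 aC2 x = cutC N K CUT C2 x].
  move=> rx; have [e1 e2 e3] := CE5 _ rx.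
  by rewrite /= rS //; case: k6 => _ k6; rewrite !k6.
have Z7 x : [/\ arr s7 aK x = 0, arr s7 aH x = 0 & arr s7 aST x = 0].
  by rewrite /=; case: ifP => // /Z6.
have Z7' A x : 10 <= A -> arr s7 A x = 0.
  move=> A0; rewrite /=; case: ifP => // _; case: k6 => _ ->; first exact: Z5.
  by rewrite !inE; lia.
have f7 : forest N (arr s7 aF) (arr s7 aC1) (arr s7 aC2).
  have [f1 f2 f3] := cut_forest CUT g2 nK3.
  split.
  - by move=> v rv; have [-> _ _] := CE7 _ rv; exact: f1.
  - by move=> u ru; have [_ -> ->] := CE7 _ ru; exact: f2.
  - move=> u c ru rc; have [_ -> ->] := CE7 _ ru; have [-> _ _] := CE7 _ rc.
    exact: f3.
apply: wp_seq; apply: wp_conseq.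
  by apply: (wp_name_classes Sm Sw f7) => // x; case: (Z7 x).
move=> s8 t8 [nK8 k8 t8le].
have n8 : var s8 vn = n by case: k8 => ->.
have N8 : var s8 vN = N by case: k8 => ->.
have Z8 A x : 10 <= A -> arr s8 A x = 0.
  move=> A0; case: k8 => _ ->; first exact: Z7'.
  by rewrite !inE; lia.
have F8 : arr s8 aF = arr s7 aF by case: k8 => _ ->.
apply: wp_seq; apply: wp_conseq.
  apply: (wp_count_roots Sm Sw) => // [v rv|x|x]; try exact: Z8.
  by have := naming_range nK8 rv; rewrite /S; lia.
move=> s9 t9 [cg ch k9 t9le].
have N9 : var s9 vN = N by case: k9 => ->.
apply: wp_conseq; first by apply: (@wp_compare_counts _ _ n Sm Sw).
move=> s10 t10 [ansE t10le].
eexists; split; first exact: ansE; last by rewrite /N in t1le t2le t3le t4le t5le t6le t8le t9le t10le *; lia.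
have FEx x : real N x -> cutF (arr s1 aF) K CUT x = cutF F K CUT x.
  by move=> rx; rewrite /cutF FE1.
exists C1 C2 K CUT (arr s8 aK) => //.
- case: g2 => gr gC gE gD; split=> //.
  + by move=> v rv; rewrite -FE1 //; exact: gr.
  + by move=> u c ru rc; rewrite -FE1 //; exact: gE.
(* The array agrees with [F] on real vertices only; iterates of a cyclic vertex remain real. *)
- have it v p : cyc N K v -> iter p (arr s1 aF) v = iter p F v.
    move=> cv; elim: p => //= p IH; rewrite -IH FE1 //.
    by case/andP: (cyc_iter g2 nK3 p cv).
  have wd v d : cyc N K v -> word (arr s1 aF) C1 C2 K v d = word F C1 C2 K v d.
    by move=> cv; rewrite /word it.
  case: cut4 => cc cl ce cu; split=> //.
  + move=> c p Cc d ae; have cv := cc _ Cc.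
    have ci : cyc N K (iter p F c) by rewrite -it //; exact: (cyc_iter g2 nK3).
    rewrite -!wd // -it //; apply: cl => // e ed; rewrite it // !wd //; exact: ae.
  + by move=> v cv; have [p Cp] := ce _ cv; exists p; rewrite -it.
  + by move=> c p Cc; rewrite -it; [exact: cu|exact: cc].
- by apply: naming_ext nK8 => u ru; have [_ -> ->] := CE7 _ ru.
- apply: eq_all => k; rewrite cg ch F8; congr (_ == _); apply: eq_in_count => v;
    rewrite mem_iota => vi; have rv : real N v by rewrite /real /N; lia.
  + by have [-> _ _] := CE7 _ rv; rewrite FEx.
  + by have [-> _ _] := CE7 _ rv; rewrite FEx.
Qed.

End Main.

(** * Classes of the cut graph *)

(** Counting through an injection given as a relation, so that no image has to be chosen. *)
Lemma size_le_rel (R : nat -> nat -> Prop) (s1 s2 : seq nat) : uniq s1 ->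
  (forall x, x \in s1 -> exists2 y, y \in s2 & R x y) ->
  (forall x1 x2 y, x1 \in s1 -> x2 \in s1 -> R x1 y -> R x2 y -> x1 = x2) ->
  size s1 <= size s2.
Proof.
elim: s1 s2 => //= x s1 IH s2 /andP[xs1 us1] ex inj.
have [y ys2 Rxy] := ex x (mem_head _ _).
rewrite (perm_size (perm_to_rem ys2)) /= ltnS; apply: IH => //.
- move=> z zs1; have zs : z \in x :: s1 by rewrite inE zs1 orbT.
  have [y' y's2 Rzy'] := ex z zs; exists y' => //.
  have : y' \in y :: rem y s2 by rewrite -(perm_mem (perm_to_rem ys2)).
  rewrite inE => /orP[/eqP E|//]; rewrite E in Rzy'.
  by rewrite (inj x z y) ?mem_head ?zs1 // in xs1; rewrite (inj _ _ _ _ _ Rxy Rzy') ?mem_head // zs1 in xs1.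
- by move=> x1 x2 z x1s x2s; apply: inj; rewrite inE ?x1s ?x2s orbT.
Qed.

Lemma hi_lo (a b a' b' : nat) : maxn a b = maxn a' b' /\ minn a b = minn a' b' <->
  (a = a' /\ b = b') \/ (a = b' /\ b = a').
Proof. by split; [case=> *|case=> -[-> ->]]; lia. Qed.

Section Names.
Variables (N : nat) (F C1 C2 K CUT K2 : nat -> nat).
Hypotheses (gF : graph N F C1 C2) (nK : naming N C1 C2 K)
  (cC : cuts N F C1 C2 K CUT).
Let F' := cutF F K CUT.
Let C1' := cutC N K CUT C1.
Let C2' := cutC N K CUT C2.
Hypothesis nK2 : naming N C1' C2' K2.

Notation rl := (real N).
Notation cy := (cyc N K).

Lemma child_le u : rl u -> C1 u <= N /\ C2 u <= N.
Proof. by case: gF => _ h _ _; exact: h. Qed.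

Lemma K_child c : c <= N -> 0 < c -> rl c.
Proof. by rewrite /real => -> ->. Qed.

Lemma named_children u : rl u -> 0 < K u ->
  [/\ 0 < K (C1 u), 0 < K (C2 u), K (C1 u) < K u & K (C2 u) < K u].
Proof. by move=> ru Ku; have := naming_children nK ru Ku; rewrite /lo /hi => -[]; split; lia. Qed.

Lemma cut_tree u : 0 < K u -> CUT u = 0.
Proof.
by move=> Ku; case: (posnP (CUT u)) => // /(cuts_cyc cC)/andP[_ /eqP E]; rewrite E in Ku.
Qed.

Lemma tree_C u : 0 < K u -> C1' u = C1 u /\ C2' u = C2 u.
Proof. by move=> Ku; rewrite /C1' /C2' /cutC cut_tree. Qed.

Lemma K2_tree_pos u : rl u -> 0 < K u -> 0 < K2 u.
Proof.
move: {2}(K u) (leqnn (K u)) => k; elim/ltn_ind: k u => k IH u uk ru Ku.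
have [k1 k2 l1 l2] := named_children ru Ku; have [c1N c2N] := child_le ru.
have pos c : c <= N -> 0 < K c -> K c < K u -> 0 < K2 c.
  move=> cN Kc lt; case: (posnP c) => [->|c0]; first by rewrite (naming_none nK2).
  by apply: (IH (K c)) => //; [lia|exact: K_child].
apply: (naming_complete nK2) => //; have [e1 e2] := tree_C Ku.
by rewrite /lo -/C1' e1 e2; have := pos _ c1N k1 l1; have := pos _ c2N k2 l2; lia.
Qed.

(* [p] is the child of [u] on the cycle, [t] the root of the tree attached to
   [u], or 0 if there is none. *)
Record cyc_children (u p t : nat) : Prop := CycChildren {
  cc_cyc : cy p;
  cc_F : F p = u;
  cc_tree : 0 < K t;
  cc_le : t <= N;
  cc_pair : (C1 u = p /\ C2 u = t) \/ (C1 u = t /\ C2 u = p) }.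

(** One child is unnamed by [unnamed_child]; a second one would have the same image under [F],
    against [cyc_inj]. *)
Lemma cyc_childrenP u : cy u -> exists p t, cyc_children u p t.
Proof.
move=> cu; have [p cp Fp] := unnamed_child gF nK cu.
have ru : rl u by case/andP: cu.
have rp : rl p by case/andP: cp.
case: (gF) => gr gC gE gD; have [c1N c2N] := gC u ru.
have other t : t <= N -> t = C1 u \/ t = C2 u -> t <> p -> 0 < K t.
  move=> tN tu tp; case: (posnP (K t)) => // Kt.
  have rt : rl t.
    by apply: K_child => //; case: (posnP t) Kt => // ->; rewrite (naming_none nK).
  have ct : cy t by rewrite /cyc rt Kt.
  by case: tp; apply: (cyc_inj gF nK) => //; rewrite Fp; apply/gE.
have p0 : p <> 0 by move: rp; rewrite /real; lia.
have /gE : F p = u by []. 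
move=> /(_ ru rp) [pE|pE].
- exists p, (C2 u); split=> //; last by left.
  apply: other => //; first by right.
  by move=> E; apply: p0; rewrite pE; apply: gD => //; rewrite -pE E.
- exists p, (C1 u); split=> //; last by right.
  apply: other => //; first by left.
  by move=> E; apply: p0; rewrite -E; apply: gD => //; rewrite -pE E.
Qed.

Definition cut_pred (u p : nat) : nat := if 0 < CUT u then N.+1 else p.

Lemma cyc_pair u p t : cyc_children u p t ->
  hi C1' C2' K2 u = maxn (K2 (cut_pred u p)) (K2 t) /\
  lo C1' C2' K2 u = minn (K2 (cut_pred u p)) (K2 t).
Proof.
case=> /andP[_ Kp] _ Kt _; rewrite /hi /lo /C1' /C2' /cutC /cut_pred.
have Kt0 : (K t == 0) = false by lia.
case=> -[-> ->]; rewrite Kp Kt0 ?andbF ?andbT //.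
by rewrite maxnC minnC.
Qed.

Lemma lab_cyc u p t : cyc_children u p t -> lab C1 C2 K u = K t.
Proof. by case=> /andP[_ /eqP Kp] _ _ _; rewrite /lab => -[] [-> ->]; rewrite Kp ?addn0. Qed.

Lemma K2_pos0 t : t <= N -> 0 < K t -> 0 < K2 t.
Proof.
move=> tN Kt; case: (posnP t) => [->|t0]; first by rewrite (naming_none nK2).
by apply: K2_tree_pos => //; exact: K_child.
Qed.

Lemma K2_cyc_step u : cy u -> 0 < CUT u \/ (exists2 p, cy p /\ F p = u & 0 < K2 p) ->
  0 < K2 u.
Proof.
move=> cu H; have [p [t ch]] := cyc_childrenP cu.
have [hE lE] := cyc_pair ch.
apply: (naming_complete nK2); first by case/andP: cu.
have := K2_pos0 (cc_le ch) (cc_tree ch); rewrite lE leq_min /cut_pred => ->.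
rewrite andbT; case: ifP => [_|nc]; first by rewrite (naming_cut nK2).
case: H => [Cu|[p' [cp' Fp'] Kp']]; first by rewrite Cu in nc.
by rewrite -(cyc_inj gF nK cp' (cc_cyc ch)) // Fp' (cc_F ch).
Qed.

Lemma cyc_from_cut u : cy u -> exists c i, 0 < CUT c /\ u = iter i F c.
Proof.
move=> cu; have [p Cp] := cuts_exist cC cu; have [L L0 per] := cyc_period gF nK cu.
(* Going back [p] steps on a cycle is going forward [p * L - p] steps, since [L] is a period. *)
exists (iter p F u), (p * L - p); split=> //.
rewrite -iterD subnK; first by rewrite iter_period.
by rewrite leq_pmulr.
Qed.

(** Once the cycles are cut the naming misses nothing: on a cycle, induct on the distance from the
    cut vertex. *)
Lemma K2_pos u : rl u -> 0 < K2 u.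
Proof.
move=> ru; case: (posnP (K u)) => Ku; last exact: K2_tree_pos.
have cu : cy u by rewrite /cyc ru Ku.
have [c [i [Cc uE]]] := cyc_from_cut cu.
rewrite uE {u ru Ku cu uE}; have cc := cuts_cyc cC Cc.
elim: i => [|i IH]; first by apply: K2_cyc_step => //; left.
apply: K2_cyc_step; first exact: (cyc_iter gF nK i.+1 cc).
by right; exists (iter i F c) => //; split=> //; exact: (cyc_iter gF nK).
Qed.

Lemma K2_range u : rl u -> 3 <= K2 u < N + 3.
Proof. by move=> ru; have := naming_range nK2 ru; have := K2_pos ru; lia. Qed.

Lemma K2_eq u u' : rl u -> rl u' ->
  hi C1' C2' K2 u = hi C1' C2' K2 u' -> lo C1' C2' K2 u = lo C1' C2' K2 u' ->
  K2 u = K2 u'.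
Proof. by move=> ru ru' h l; apply/(naming_eq nK2) => //; exact: K2_pos. Qed.

(** The two runs of the naming choose unrelated names. Equality of classes carries over by induction
    on the first class, because cuts do not touch the trees. *)
Lemma K2_tree u u' : u <= N -> u' <= N -> 0 < K u -> K u = K u' -> K2 u = K2 u'.
Proof.
move: {2}(K u) (leqnn (K u)) => k; elim/ltn_ind: k u u' => k IH u u' uk uN u'N Ku E.
have K1 v : v <= N -> K v = 1 -> v = 0.
  move=> vN Kv; case: (posnP v) => // v0.
  by have := naming_range nK (K_child vN v0); rewrite Kv; lia.
case: (posnP u) => [u0|u0].
  by rewrite u0 (K1 u') // -E u0 (naming_none nK).
case: (posnP u') => [u'0|u'0].
  by rewrite u'0 (K1 u) // E u'0 (naming_none nK).
have ru := K_child uN u0; have ru' := K_child u'N u'0.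
have Ku' : 0 < K u' by rewrite -E.
have [c1N c2N] := child_le ru; have [c1N' c2N'] := child_le ru'.
have [k1 k2 l1 l2] := named_children ru Ku.
have [e1 e2] := tree_C Ku; have [e1' e2'] := tree_C Ku'.
have /hi_lo pr := (naming_eq nK ru ru' Ku Ku').1 E.
suff /hi_lo [h l] : (K2 (C1 u) = K2 (C1 u') /\ K2 (C2 u) = K2 (C2 u')) \/
          (K2 (C1 u) = K2 (C2 u') /\ K2 (C2 u) = K2 (C1 u')).
  by apply: K2_eq; rewrite // /hi /lo e1 e2 e1' e2'.
by case: pr => -[p1 p2]; [left|right]; split;
  [apply: (IH (K (C1 u)))|apply: (IH (K (C2 u)))|
   apply: (IH (K (C1 u)))|apply: (IH (K (C2 u)))] => //; lia.
Qed.

Lemma cut_rootP r : rl r -> F' r = 0 <-> cy r /\ 0 < CUT (F r).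
Proof.
move=> rr; have F0 : F r <> 0 by case: gF => /(_ _ rr); rewrite /real; lia.
rewrite /F' /cutF /cyc rr /=; case: (K r == 0) => /=; last by split=> [/F0|[]].
by case: ifP => _; split=> [E|[_ E]] //; case: F0.
Qed.

(** The word gives the attached trees, and the common periods place the cut leaves at the same
    positions; the classes then agree by induction from the cut. *)
Lemma K2_cyc_word c c' : 0 < CUT c -> 0 < CUT c' ->
  (forall d, word F C1 C2 K c d = word F C1 C2 K c' d) ->
  (forall d, iter d F c = c <-> iter d F c' = c') ->
  forall i, K2 (iter i F c) = K2 (iter i F c').
Proof.
move=> Cc Cc' wE per.
have cc i : cy (iter i F c) by apply: (cyc_iter gF nK); exact: (cuts_cyc cC).
have cc' i : cy (iter i F c') by apply: (cyc_iter gF nK); exact: (cuts_cyc cC).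
have cutE i : (0 < CUT (iter i F c)) = (0 < CUT (iter i F c')).
  apply/idP/idP => [/(cuts_uniq cC Cc)/per->|/(cuts_uniq cC Cc')/per->] //.
have rc i : rl (iter i F c) by case/andP: (cc i).
have rc' i : rl (iter i F c') by case/andP: (cc' i).
have step i p t p' t' : cyc_children (iter i F c) p t ->
    cyc_children (iter i F c') p' t' ->
    (~~ (0 < CUT (iter i F c)) -> K2 p = K2 p') -> K2 (iter i F c) = K2 (iter i F c').
  move=> ch ch' pE; have [h l] := cyc_pair ch; have [h' l'] := cyc_pair ch'.
  have tE : K2 t = K2 t'.
    apply: K2_tree (cc_le ch) (cc_le ch') (cc_tree ch) _.
    by rewrite -(lab_cyc ch) -(lab_cyc ch'); exact: wE.
  have qE : K2 (cut_pred (iter i F c) p) = K2 (cut_pred (iter i F c') p').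
    by rewrite /cut_pred -cutE; case: ifP => // /negbT /pE.
  by apply: K2_eq; rewrite ?h ?h' ?l ?l' ?tE ?qE.
elim=> [|i IH].
  have [p [t ch]] := cyc_childrenP (cc 0); have [p' [t' ch']] := cyc_childrenP (cc' 0).
  by apply: (step _ _ _ _ _ ch ch'); rewrite /= Cc.
have [p [t ch]] := cyc_childrenP (cc i.+1); have [p' [t' ch']] := cyc_childrenP (cc' i.+1).
apply: (step _ _ _ _ _ ch ch') => _.
have -> : p = iter i F c.
  by apply: (cyc_inj gF nK) (cc_cyc ch) (cc i) _; rewrite (cc_F ch).
have -> // : p' = iter i F c'.
by apply: (cyc_inj gF nK) (cc_cyc ch') (cc' i) _; rewrite (cc_F ch').
Qed.

End Names.

(** * An isomorphism preserves the numbers of roots *)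

Definition embeds (F : nat -> nat) (A B : pred nat) (phi psi : nat -> nat) : Prop :=
  forall v, A v -> [/\ B (phi v), psi (phi v) = v & F (phi v) = phi (F v)].

Section Transfer.
Variables (N : nat) (F C1 C2 K CUT K2 : nat -> nat).
Hypotheses (gF : graph N F C1 C2) (nK : naming N C1 C2 K)
  (cC : cuts N F C1 C2 K CUT).
Let F' := cutF F K CUT.
Let C1' := cutC N K CUT C1.
Let C2' := cutC N K CUT C2.
Hypothesis nK2 : naming N C1' C2' K2.

Notation rl := (real N).
Notation cy := (cyc N K).

(** The equality closes [A] under images and under preimages, so the children of a vertex of [A] lie
    in [A]. *)
Definition component_closed (A : pred nat) : Prop :=
  (forall v, A v -> rl v) /\ (forall v, rl v -> A (F v) = A v).

Section OneWay.
Variables (A B : pred nat) (phi psi : nat -> nat).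
Hypotheses (cA : component_closed A) (cB : component_closed B).
Hypotheses (ePhi : embeds F A B phi psi) (ePsi : embeds F B A psi phi).

(** A missing child must be sent to a missing child. *)
Definition phi0 (c : nat) : nat := if c == 0 then 0 else phi c.

Lemma embeds_iter v i : A v -> A (iter i F v) /\ iter i F (phi v) = phi (iter i F v).
Proof.
move=> Av; elim: i => //= i [Ai ->]; split; last by case: (ePhi Ai).
by case: cA => rA ->; [|exact: rA].
Qed.

Lemma phi_inj v v' : A v -> A v' -> phi v = phi v' -> v = v'.
Proof. by move=> /ePhi[_ e _] /ePhi[_ e' _] E; rewrite -e -e' E. Qed.

Lemma children_A u c : A u -> c = C1 u \/ c = C2 u -> c <> 0 -> A c.
Proof.
case: (cA) => rA clA Au cu c0; have ru := rA _ Au.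
have rc : rl c by case: (child_le gF ru) cu => ? ? []; rewrite /real; lia.
rewrite -clA //; case: gF => _ _ gE _.
by have -> : F c = u by apply/gE.
Qed.

(** Which child comes first is an accident of the numbering, so [phi] may exchange them. *)
Lemma children_phi u : A u ->
  (C1 (phi u) = phi0 (C1 u) /\ C2 (phi u) = phi0 (C2 u)) \/
  (C1 (phi u) = phi0 (C2 u) /\ C2 (phi u) = phi0 (C1 u)).
Proof.
move=> Au; have [rA _] := cA; have [rB _] := cB.
have [Bu pu _] := ePhi Au; have ru := rA _ Au; have ru' := rB _ Bu.
case: (gF) => gr _ gE gD.
have fwd c : c = C1 u \/ c = C2 u -> c <> 0 -> phi c = C1 (phi u) \/ phi c = C2 (phi u).
  move=> cu c0; have Ac := children_A Au cu c0.
  have [Bc _ Fc] := ePhi Ac; apply/gE => //; first exact: rB.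
  by rewrite Fc; congr phi; apply/gE => //; exact: rA.
have bwd d : d = C1 (phi u) \/ d = C2 (phi u) -> d <> 0 ->
    exists c, [/\ c = C1 u \/ c = C2 u, c <> 0 & d = phi c].
  move=> du d0.
  have rd : rl d by case: (child_le gF ru') du => ? ? []; rewrite /real; lia.
  have Fd : F d = phi u by apply/gE.
  have Bd : B d by case: cB => _ clB; rewrite -clB // Fd.
  have [Ad pd Fpd] := ePsi Bd; exists (psi d); split=> //.
    by apply/gE => //; [exact: rA|rewrite Fpd Fd].
  by move=> E; have := rA _ Ad; rewrite E.
have D1 := gD _ ru; have D2 := gD _ ru'.
have inj c c' : (c = C1 u \/ c = C2 u) -> (c' = C1 u \/ c' = C2 u) -> c <> 0 -> c' <> 0 ->
    phi c = phi c' -> c = c'.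
  by move=> cu cu' c0 c0'; apply: phi_inj; [exact: children_A cu c0|exact: children_A cu' c0'].
have bw1 := bwd (C1 (phi u)) (or_introl erefl); have bw2 := bwd (C2 (phi u)) (or_intror erefl).
have fw1 := fwd (C1 u) (or_introl erefl); have fw2 := fwd (C2 u) (or_intror erefl).
have i12 := inj _ _ (or_introl erefl) (or_intror erefl).
(* What is left is a case analysis on which of the children are missing. *)
move: fw1 fw2 bw1 bw2 D1 D2 i12; rewrite /phi0.
move: (C1 u) (C2 u) (C1 (phi u)) (C2 (phi u)) => c1 c2 d1 d2 fw1 fw2 bw1 bw2 D1 D2 i12.
have e0 d c : (d <> 0 -> exists c', [/\ c' = 0 \/ c' = c, c' <> 0 & d = phi c']) ->
    d = 0 \/ (c <> 0 /\ d = phi c).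
  move=> H; case: (eqVneq d 0) => [|/eqP/H[c' [[->|->]]]] //; first by left.
  by right.
case: (eqVneq c1 0) => [c10|/eqP c10]; case: (eqVneq c2 0) => [c20|/eqP c20].
- left; rewrite c10 c20 in bw1 bw2.
  by split; [case: (e0 _ _ bw1) => // -[]|case: (e0 _ _ bw2) => // -[]].
- rewrite c10 in bw1 bw2.
  case: (fw2 c20) => E; [right|left]; rewrite -E; split=> //.
    by case: (e0 _ _ bw2) => // -[_ E2]; rewrite E2 E in D2 *; exact: D2.
  by case: (e0 _ _ bw1) => // -[_ E2]; apply: D2; rewrite E2 E.
- have sw c d : (d <> 0 -> exists c', [/\ c' = c \/ c' = 0, c' <> 0 & d = phi c']) ->
      d = 0 \/ (c <> 0 /\ d = phi c).
    by move=> H; apply: e0 => /H[c' [cc' ? ?]]; exists c'; split=> //; case: cc'; [right|left].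
  rewrite c20 in bw1 bw2.
  case: (fw1 c10) => E; [left|right]; rewrite -E; split=> //.
    by case: (sw _ _ bw2) => // -[_ E2]; rewrite E2 E in D2 *; exact: D2.
  by case: (sw _ _ bw1) => // -[_ E2]; apply: D2; rewrite E2 E.
- case: (fw1 c10) => E1; case: (fw2 c20) => E2; [|left|right|]; rewrite ?E1 ?E2 //.
  + by have := i12 c10 c20; rewrite E1 E2 => /(_ erefl)/D1.
  + by have := i12 c10 c20; rewrite E1 E2 => /(_ erefl)/D1.
Qed.

Lemma K_phi_named u : A u -> 0 < K u -> K (phi u) = K u.
Proof.
have [rA _] := cA; have [rB _] := cB.
move: {2}(K u) (leqnn (K u)) => k; elim/ltn_ind: k u => k IH u uk Au Ku.
have ru := rA _ Au; have [Bu _ _] := ePhi Au; have ru' := rB _ Bu.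
have [k1 k2 l1 l2] := named_children nK ru Ku.
have E c : c = C1 u \/ c = C2 u -> 0 < K c -> K c < K u -> K (phi0 c) = K c.
  move=> cu Kc lt; rewrite /phi0; case: eqP => [-> //|c0].
  by apply: (IH (K c)) => //; [lia|exact: children_A cu c0].
have E1 := E _ (or_introl erefl) k1 l1; have E2 := E _ (or_intror erefl) k2 l2.
have [h l] : hi C1 C2 K (phi u) = hi C1 C2 K u /\ lo C1 C2 K (phi u) = lo C1 C2 K u.
  by rewrite /hi /lo; case: (children_phi Au) => -[-> ->]; rewrite E1 E2; lia.
have Ku' : 0 < K (phi u).
  by apply: (naming_complete nK) => //; rewrite l /lo; lia.
exact/(naming_eq nK).
Qed.

End OneWay.

Section BothWays.
Variables (A B : pred nat) (phi psi : nat -> nat).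
Hypotheses (cA : component_closed A) (cB : component_closed B).
Hypotheses (ePhi : embeds F A B phi psi) (ePsi : embeds F B A psi phi).

(** An unnamed vertex with a named image is excluded by applying [K_phi_named] to [psi]. *)
Lemma K_phi u : A u -> K (phi u) = K u.
Proof.
move=> Au; case: (posnP (K u)) => Ku; last exact: (K_phi_named cA cB ePhi ePsi).
case: (posnP (K (phi u))) => [->|Ku'] //.
have [Bu pu _] := ePhi Au.
by have := K_phi_named cB cA ePsi ePhi Bu Ku'; rewrite pu Ku => E; rewrite -E in Ku'.
Qed.

Lemma lab_phi u : A u -> lab C1 C2 K (phi u) = lab C1 C2 K u.
Proof.
move=> Au; have E c : c = C1 u \/ c = C2 u -> K (phi0 phi c) = K c.
  move=> cu; rewrite /phi0; case: eqP => [-> //|c0].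
  by apply: K_phi; exact: (children_A cA Au cu c0).
have E1 := E _ (or_introl erefl); have E2 := E _ (or_intror erefl).
by rewrite /lab; case: (children_phi cA cB ePhi ePsi Au) => -[-> ->]; rewrite E1 E2 // addnC.
Qed.

Lemma word_phi u d : A u -> word F C1 C2 K (phi u) d = word F C1 C2 K u d.
Proof.
move=> Au; rewrite /word; have [Ai ->] := embeds_iter cA ePhi d Au; exact: lab_phi.
Qed.

Lemma cyc_phi u : A u -> cy u -> cy (phi u).
Proof.
move=> Au /andP[ru Ku]; rewrite /cyc K_phi // Ku andbT.
by have [Bu _ _] := ePhi Au; case: cB => rB _; exact: rB.
Qed.

(** The image cycle may be cut at a vertex [c'] other than [phi c]. Both [c] and [c'] start a least
    rotation of the same cyclic word, so they read the same infinite word and [K2_cyc_word]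
    applies. *)
Lemma root_phi r : A r -> F' r = 0 -> exists2 q, B (iter q F (phi r)) &
  F' (iter q F (phi r)) = 0 /\ K2 (iter q F (phi r)) = K2 r.
Proof.
have [rA clA] := cA; have [rB _] := cB.
move=> Ar F'r; have rr := rA _ Ar; have [cr Cc] := (cut_rootP K CUT gF rr).1 F'r.
set c := F r in Cc; have cc : cy c := cuts_cyc cC Cc.
have Ac : A c by rewrite /c clA.
have cpc := cyc_phi Ac cc.
have [p Cc'] := cuts_exist cC cpc.
set c' := iter p F (phi c) in Cc'.
have [Ap phip] := embeds_iter cA ePhi p Ac.
have [L L0 per] := cyc_period gF nK cc.
have per' : iter L F (phi c) = phi c by have [_ ->] := embeds_iter cA ePhi L Ac; rewrite per.
have back : iter (p * L - p) F c' = phi c.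
  rewrite /c' -iterD subnK ?iter_period //.
  by rewrite leq_pmulr.
have wordE d : word F C1 C2 K c d = word F C1 C2 K c' d.
  have ww e : word F C1 C2 K c' e = word F C1 C2 K (iter p F c) e.
    by rewrite /c' phip word_phi.
  have wc : wle (word F C1 C2 K c) (word F C1 C2 K (iter p F c)).
    exact: (cuts_least cC).
  have wc' : wle (word F C1 C2 K c') (word F C1 C2 K (phi c)).
    by rewrite -back; exact: (cuts_least cC).
  apply: wle_anti => e ae.
  - by rewrite ww; apply: wc => f /ae; rewrite ww.
  - have wd f : word F C1 C2 K c f = word F C1 C2 K (phi c) f by rewrite word_phi.
    by rewrite wd; apply: wc' => f /ae; rewrite wd.
have perE d : iter d F c = c <-> iter d F c' = c'.
  have [_ pd] := embeds_iter cA ePhi d Ac.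
  split=> E.
    by rewrite /c' -iterD addnC iterD pd E.
  apply: (phi_inj ePhi) => //; first by case: (embeds_iter cA ePhi d Ac).
  by rewrite -pd -back -iterD addnC iterD E.
have KE := K2_cyc_word gF nK cC nK2 Cc Cc' wordE perE.
have rE : r = iter L.-1 F c.
  apply: (cyc_inj gF nK) => //; first exact: (cyc_iter gF nK).
  by rewrite -iterS prednK // per.
have phir : iter (L.-1 + p).+1 F (phi r) = iter L.-1 F c'.
  have [_ _ Fr] := ePhi Ar.
  by rewrite iterSr Fr iterD.
have Fc' : F (iter L.-1 F c') = c'.
  by rewrite -iterS prednK //; apply/perE.
have Br' : B (iter L.-1 F c').
  rewrite /c' -iterD; have [Ai ->] := embeds_iter cA ePhi (L.-1 + p) Ac.
  by have [] := ePhi Ai.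
exists (L.-1 + p).+1; rewrite phir //; split; last by rewrite rE KE.
apply/(cut_rootP K CUT gF); first exact: rB.
split; last by rewrite Fc'.
by apply: (cyc_iter gF nK); exact: (cuts_cyc cC).
Qed.

Lemma root_count_le (lA lB : seq nat) k : uniq lA ->
  (forall v, v \in lA -> A v) -> (forall v, B v -> v \in lB) ->
  root_count F' K2 lA k <= root_count F' K2 lB k.
Proof.
have [rA clA] := cA; move=> uA lAA lBB; rewrite /root_count -!size_filter.
apply: (@size_le_rel (fun r r' => exists q, r' = iter q F (phi r))).
- exact: filter_uniq.
- move=> r; rewrite mem_filter => /andP[/andP[/eqP Fr /eqP Kr]] /lAA Ar.
  have [q Bq [Fq Kq]] := root_phi Ar Fr.
  exists (iter q F (phi r)); last by exists q.
  by rewrite mem_filter Fq Kq Kr !eqxx; exact: lBB.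
- move=> r1 r2 y; rewrite !mem_filter => /andP[/andP[/eqP F1 _] /lAA A1].
  move=> /andP[/andP[/eqP F2 _] /lAA A2] [q1 ->] [q2].
  have [Aq1 ->] := embeds_iter cA ePhi q1 A1; have [Aq2 ->] := embeds_iter cA ePhi q2 A2.
  move=> /(phi_inj ePhi Aq1 Aq2) E.
  have [cy1 C1_] := (cut_rootP K CUT gF (rA _ A1)).1 F1; have [cy2 C2_] := (cut_rootP K CUT gF (rA _ A2)).1 F2.
  apply: (cyc_inj gF nK) => //.
  have [L L0 per] := cyc_period gF nK cy2.
  (* Two roots sent to the same vertex lie on one cycle, which has a single cut vertex. *)
  have E2 : F r2 = iter (q2 * L - q2 + q1) F (F r1).
    rewrite -iterSr iterS iterD E -iterD subnK ?iter_period //.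
    by rewrite leq_pmulr.
  by rewrite E2; apply/esym/(cuts_uniq cC) => //; rewrite -E2.
Qed.

End BothWays.
End Transfer.

(** * Equal numbers of roots give an isomorphism *)

Section Converse.
Variables (N : nat) (F C1 C2 K CUT K2 : nat -> nat).
Hypotheses (gF : graph N F C1 C2) (nK : naming N C1 C2 K)
  (cC : cuts N F C1 C2 K CUT).
Let F' := cutF F K CUT.
Let C1' := cutC N K CUT C1.
Let C2' := cutC N K CUT C2.
Hypotheses (fF' : forest N F' C1' C2') (nK2 : naming N C1' C2' K2).

Notation rl := (real N).
Notation cy := (cyc N K).

Variables (lA lB : seq nat).
Hypotheses (uA : uniq lA) (uB : uniq lB).
Let A v := v \in lA.
Let B v := v \in lB.
Hypotheses (cA : component_closed N F A) (cB : component_closed N F B).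
Hypothesis counts : forall k, k < N + 3 -> root_count F' K2 lA k = root_count F' K2 lB k.

Let rangeK2 := K2_range gF nK cC nK2.

Definition root_list (l : seq nat) (k : nat) : seq nat :=
  [seq v <- l | (F' v == 0) && (K2 v == k)].

(** Roots of equal class are paired by rank; equality of the counts keeps the index in range, so the
    default 0 is not reached. *)
Definition match_root (r : nat) : nat :=
  nth 0 (root_list lB (K2 r)) (index r (root_list lA (K2 r))).

Lemma size_root_list r : rl r -> size (root_list lA (K2 r)) = size (root_list lB (K2 r)).
Proof.
move=> rr; rewrite !size_filter; apply: counts.
by have := rangeK2 rr; lia.
Qed.

Lemma match_rootP r : A r -> F' r = 0 ->
  [/\ B (match_root r), F' (match_root r) = 0 & K2 (match_root r) = K2 r].
Proof.
move=> Ar Fr; have rr : rl r by case: cA => rA _; exact: rA.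
have rin : r \in root_list lA (K2 r) by rewrite mem_filter Fr !eqxx.
have : match_root r \in root_list lB (K2 r).
  by apply: mem_nth; rewrite -size_root_list // index_mem.
by rewrite mem_filter => /andP[/andP[/eqP-> /eqP->]].
Qed.

Lemma match_root_inj r1 r2 : A r1 -> A r2 -> F' r1 = 0 -> F' r2 = 0 ->
  match_root r1 = match_root r2 -> r1 = r2.
Proof.
move=> A1 A2 F1 F2 E; have rA := cA.1.
have KE : K2 r1 = K2 r2.
  by have [_ _ <-] := match_rootP A1 F1; have [_ _ <-] := match_rootP A2 F2; rewrite E.
move: E; rewrite /match_root -KE => E.
have in1 : r1 \in root_list lA (K2 r1) by rewrite mem_filter F1 !eqxx.
have in2 : r2 \in root_list lA (K2 r1) by rewrite mem_filter F2 KE !eqxx.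
have i1 := in1; have i2 := in2; rewrite -index_mem size_root_list in i1; last exact: rA.
rewrite -index_mem size_root_list in i2; last exact: rA.
have ub : uniq (root_list lB (K2 r1)) by exact: filter_uniq.
have /eqP := E; rewrite nth_uniq // => /eqP ie.
by rewrite -(nth_index 0 in1) ie nth_index.
Qed.

(** Children are matched straight if their classes agree in order, crosswise otherwise. The choice
    depends on [u] and [u'] only, so two siblings never take the same slot, even when their classes
    are equal. *)
Definition slot (u u' v : nat) : nat :=
  if ((K2 (C1' u) == K2 (C1' u')) && (K2 (C2' u) == K2 (C2' u'))) == (v == C1' u)
  then C1' u' else C2' u'.

(** The calls climb to the root, and the image is then found by coming down slot by slot; [d] is
    fuel. *)
Fixpoint descend (d v : nat) : nat :=
  if d is d'.+1 then
    if F' v == 0 then match_root v else slot (F' v) (descend d' (F' v)) v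
  else 0.

Lemma descendS d v : descend d.+1 v =
  if F' v == 0 then match_root v else slot (F' v) (descend d (F' v)) v.
Proof. by []. Qed.

Lemma child_cut u c : rl u -> rl c -> c = C1' u \/ c = C2' u <-> F' c = u.
Proof.
move=> ru rc; split; first by case: fF' => _ _ h; exact: h.
have u0 : u <> 0 by move: ru; rewrite /real; lia.
rewrite /F' /cutF; case: ifP => [_ /esym //|nc Fc].
have ncut : (0 < CUT u) && (K c == 0) = false by rewrite -Fc andbC.
have [cE|cE] : c = C1 u \/ c = C2 u by case: gF => _ _ gE _; apply/gE.
  by left; rewrite /C1' /cutC -cE ncut.
by right; rewrite /C2' /cutC -cE ncut.
Qed.

Lemma parent_real v : rl v -> F' v <> 0 -> rl (F' v) /\ K2 v < K2 (F' v).
Proof.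
move=> rv F0; have rF : rl (F' v).
  by case: fF' => /(_ v rv) FN _ _; rewrite /real FN andbT lt0n; exact/eqP.
split=> //; have Ku := rangeK2 rF.
have Ku0 : 0 < K2 (F' v) by lia.
have [_ hilt] := naming_children nK2 rF Ku0; apply: leq_trans hilt; rewrite ltnS /hi.
by case: ((child_cut rF rv).2 erefl) => E; rewrite {1}E leq_max leqnn ?orbT.
Qed.

Lemma descend_stable d d' v : rl v -> N + 3 - K2 v <= d -> N + 3 - K2 v <= d' ->
  descend d v = descend d' v.
Proof.
elim: d d' v => [|d IH] d' v rv; first by have := rangeK2 rv; lia.
case: d' => [|d']; first by have := rangeK2 rv; lia.
move=> le le' /=; case: eqP => // F0; have [rF lt] := parent_real rv F0.
by rewrite (IH d') //; lia.
Qed.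

(* Classes increase towards the root, so [N + 3] bounds the depth. *)
Definition transport := locked (descend (N + 3)).

Lemma transportE v : rl v -> transport v =
  if F' v == 0 then match_root v else slot (F' v) (transport (F' v)) v.
Proof.
move=> rv; have -> : transport v = descend N.+3 v by rewrite /transport -lock addn3.
rewrite descendS; case: eqP => // F0.
have [rF lt] := parent_real rv F0; have Kv := rangeK2 rv.
by rewrite /transport -lock; congr slot; apply: descend_stable => //; lia.
Qed.

Lemma K2_child c : c <= N.+1 -> 3 <= K2 c -> rl c.
Proof.
move=> cN Kc; have c0 : c <> 0 by move=> c0; rewrite c0 (naming_none nK2) in Kc.
have cN1 : c <> N.+1 by move=> E; rewrite E (naming_cut nK2) in Kc.
by rewrite /real; lia.
Qed.

Lemma slots_match u u' : rl u -> rl u' -> K2 u = K2 u' ->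
  (K2 (C1' u) = K2 (C1' u') /\ K2 (C2' u) = K2 (C2' u')) \/
  (K2 (C1' u) = K2 (C2' u') /\ K2 (C2' u) = K2 (C1' u')).
Proof.
move=> ru ru' E; apply/hi_lo; apply/(naming_eq nK2) => //.
  by have := rangeK2 ru; lia.
by have := rangeK2 ru'; lia.
Qed.

Lemma slotP u u' v : rl u -> rl u' -> rl v -> K2 u = K2 u' -> F' v = u ->
  [/\ rl (slot u u' v), K2 (slot u u' v) = K2 v & F' (slot u u' v) = u'].
Proof.
move=> ru ru' rv E Fv; have Kv := rangeK2 rv.
have KE : K2 (slot u u' v) = K2 v.
  have := slots_match ru ru' E; have := (child_cut ru rv).2 Fv; rewrite /slot.
  case: (eqVneq v (C1' u)) => [<- _ pr|nv [E1|<-] pr].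
  - by case: ifP => /eqP; case: eqP; case: eqP => //=; lia.
  - by rewrite E1 eqxx in nv.
  - by case: ifP => /eqP; case: eqP; case: eqP => //=; lia.
have sl : slot u u' v = C1' u' \/ slot u u' v = C2' u'.
  by rewrite /slot; case: ifP; [left|right].
have rs : rl (slot u u' v).
  apply: K2_child; last by rewrite KE; lia.
  by case: fF' => _ /(_ _ ru')[? ?] _; case: sl => ->.
by split=> //; apply/(child_cut ru' rs).
Qed.

(** Class 2 is reserved for the cut leaf, so the class of a vertex tells whether it was cut. *)
Lemma cut_K2 u : rl u -> 0 < CUT u <-> K2 (C1' u) = 2 \/ K2 (C2' u) = 2.
Proof.
move=> ru; have [c1N c2N] := child_le gF ru.
have K22 c : c <= N -> K2 c <> 2.
  move=> cN; case: (posnP c) => [->|c0]; first by rewrite (naming_none nK2).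
  by have := rangeK2 (K_child cN c0); lia.
split=> [Cu|]; last first.
  by case; rewrite /C1' /C2' /cutC; case: ifP => [/andP[]|_ /K22-/(_ _)] //.
have cu := cuts_cyc cC Cu; have [p [t [/andP[_ Kp] _ _ _ pr]]] := cyc_childrenP gF nK cu.
by case: pr => -[e1 e2]; [left|right]; rewrite /C1' /C2' /cutC Cu ?e1 ?e2 Kp (naming_cut nK2).
Qed.

Lemma cut_K2_eq u u' : rl u -> rl u' -> K2 u = K2 u' -> (0 < CUT u) = (0 < CUT u').
Proof.
move=> ru ru' E; have pr := slots_match ru ru' E.
have P : (K2 (C1' u) = 2 \/ K2 (C2' u) = 2) <-> (K2 (C1' u') = 2 \/ K2 (C2' u') = 2).
  by case: pr => -[-> ->]; split; case; auto.
by apply/idP/idP => [/(cut_K2 ru)/P/(cut_K2 ru')|/(cut_K2 ru')/P/(cut_K2 ru)].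
Qed.

Lemma transportP v : A v -> [/\ B (transport v), K2 (transport v) = K2 v &
  F' (transport v) = if F' v == 0 then 0 else transport (F' v)].
Proof.
have [rA clA] := cA; have [rB clB] := cB.
move: {2}(N + 3 - K2 v) (leqnn (N + 3 - K2 v)) => k.
elim: k v => [|k IH] v kv Av; have rv := rA _ Av; have Kv := rangeK2 rv; first by lia.
rewrite transportE //; case: eqP => [F0|F0]; first by have [] := match_rootP Av F0.
have [rF lt] := parent_real rv F0.
have FE : F' v = F v by move: F0; rewrite /F' /cutF; case: ifP.
have AF : A (F' v) by rewrite FE clA.
have [Bu Ku _] := IH (F' v) ltac:(lia) AF; have ru := rB _ Bu.
have [rs Ks Fs] := slotP rF ru rv (esym Ku) erefl.
split=> //; rewrite -clB //.
have F'0 : F' (slot (F' v) (transport (F' v)) v) <> 0.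
  by rewrite Fs => E; move: ru; rewrite E.
have <- : F' (slot (F' v) (transport (F' v)) v) = F (slot (F' v) (transport (F' v)) v).
  by move: F'0; rewrite /F' /cutF; case: ifP.
by rewrite Fs.
Qed.

Lemma transport_inj v v' : A v -> A v' -> transport v = transport v' -> v = v'.
Proof.
have [rA clA] := cA; have [rB clB] := cB.
move: {2}(N + 3 - K2 v) (leqnn (N + 3 - K2 v)) => k.
elim: k v v' => [|k IH] v v' kv Av Av' E; have rv := rA _ Av; have rv' := rA _ Av';
  have Kv := rangeK2 rv; first by lia.
have [B1 K1 FE1] := transportP Av; have [B2 K2' FE2] := transportP Av'.
have pos u : A u -> F' u <> 0 -> transport (F' u) <> 0.
  move=> Au F0; have ru := rA _ Au.
  have FE : F' u = F u by move: F0; rewrite /F' /cutF; case: ifP.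
  have AF : A (F' u) by rewrite FE clA.
  by have [/rB/andP[t0 _] _ _] := transportP AF; exact/eqP/lt0n_neq0.
rewrite E FE2 in FE1; case: (eqVneq (F' v) 0) FE1 => [F0|/eqP F0] FE1.
  case: (eqVneq (F' v') 0) FE1 => [F0' _|/eqP F0' /pos] //; last by case.
  by move: E; rewrite (transportE rv) (transportE rv') F0 F0' /=; exact: match_root_inj.
case: (eqVneq (F' v') 0) FE1 => [F0' /esym/pos|/eqP F0' FE1]; first by case.
have FE u : F' u <> 0 -> F' u = F u by rewrite /F' /cutF; case: ifP.
have AF : A (F' v) by rewrite FE // clA.
have AF' : A (F' v') by rewrite FE // clA.
have [rF lt] := parent_real rv F0.
have kF : N + 3 - K2 (F' v) <= k by clear -kv lt Kv; lia.
have uE : F' v = F' v' by exact: IH.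
move: E; rewrite (transportE rv) (transportE rv'); move/eqP/negPf: (F0) => ->; move/eqP/negPf: (F0') => ->.
rewrite -uE; set u := F' v in rF uE *; set u' := transport u.
have [Bu Ku _] := transportP AF; have ru' := rB _ Bu; rewrite -/u -/u' in Ku ru'.
have [rs _ _] := slotP rF ru' rv (esym Ku) erefl.
(* The two slots of [u'] can coincide only if neither holds a vertex. *)
have c12 : rl (C1' u') -> C1' u' <> C2' u'.
  rewrite /C1' /C2' /cutC; case: ifP => [_|_]; first by rewrite /real ltnn andbF.
  case: ifP => _ r E; first by move: r; rewrite E /real ltnn andbF.
  by case: gF => _ _ _ /(_ _ ru' E) E0; rewrite E0 in r.
have ch := (child_cut rF rv).2 erefl.
have ch' := (child_cut rF rv').2 (esym uE).
have second x : x = C1' u \/ x = C2' u -> (x == C1' u) = false -> x = C2' u.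
  by case=> // ->; rewrite eqxx.
move: rs; rewrite /slot; case e1: (v == C1' u); case e2: (v' == C1' u).
- by rewrite (eqP e1) (eqP e2).
- by case: (_ && _) => /= r; [move/(c12 r)|move/esym => E; rewrite -E in r; case: (c12 r)].
- by case: (_ && _) => /= r; [move/esym => E; rewrite -E in r; case: (c12 r)|move/(c12 r)].
- by rewrite (second v) // (second v').
Qed.

(** Only the removed edges, from a root [v] to a cut vertex [c], need an argument. Since
    [transport v] is a root, its image under [F] is cut; so is [transport c], as its class shows.
    Both lie on one cycle, which has a single cut. *)
Lemma transport_F v : A v -> F (transport v) = transport (F v).
Proof.
have [rA clA] := cA; have [rB clB] := cB.
have FE u : F' u <> 0 -> F' u = F u by rewrite /F' /cutF; case: ifP.
have inner u : A u -> F' u <> 0 -> F (transport u) = transport (F u).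
  move=> Au F0; have [_ _] := transportP Au; move/eqP/negPf: (F0) => -> E.
  have AF : A (F' u) by rewrite FE // clA // rA.
  rewrite -FE // E FE //.
  by have [/rB/andP[t0 _] _ _] := transportP AF; rewrite FE // in t0; exact/eqP/lt0n_neq0.
move=> Av; have rv := rA _ Av.
case: (eqVneq (F' v) 0) => [F0|/eqP F0]; last exact: inner.
have [cv Cc] := (cut_rootP K CUT gF rv).1 F0.
set c := F v in Cc *; have cc := cuts_cyc cC Cc.
have Ac : A c by rewrite /c clA.
have perx : exists L, (0 < L) && (iter L F c == c).
  by have [L L0 per] := cyc_period gF nK cc; exists L; rewrite L0 per eqxx.
(* With the least period, the path from [c] meets no root before [v], so [inner] applies along
   it. *)
have [L /andP[L0 /eqP per] minL] := ex_minnP perx.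
have Ai i : A (iter i F c).
  by elim: i => //= i IH; rewrite clA //; exact: rA.
have vE : v = iter L.-1 F c.
  apply: (cyc_inj gF nK) => //; first exact: (cyc_iter gF nK).
  by rewrite -iterS prednK // per.
have trE i : i <= L.-1 -> transport (iter i F c) = iter i F (transport c).
  elim: i => // i IH iL; rewrite [RHS]iterS -IH; last by lia.
  suff F0i : F' (iter i F c) <> 0 by rewrite (inner _ (Ai i) F0i).
  move=> F0i; have [_ Ci] := (cut_rootP K CUT gF (rA _ (Ai i))).1 F0i.
  have /= Ei := cuts_uniq cC (p := i.+1) Cc Ci.
  by have := minL i.+1; rewrite /= Ei eqxx => /(_ isT); lia.
have [Bc Kc _] := transportP Ac; have [Bv Kv' Fv] := transportP Av.
rewrite F0 eqxx in Fv.
have [_ Cv] := (cut_rootP K CUT gF (rB _ Bv)).1 Fv.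
have Ctc : 0 < CUT (transport c) by rewrite (cut_K2_eq (rB _ Bc) (rA _ Ac) Kc).
have Fte : F (transport v) = iter L F (transport c).
  by rewrite {1}vE trE // -iterS prednK.
by rewrite Fte; apply: (cuts_uniq cC Ctc); rewrite -Fte.
Qed.

End Converse.

(** * The theorem *)

Definition fibers2 (T : Type) (P : T -> Prop) (f : T -> T) : Prop :=
  forall x y z, P x -> P y -> P z -> f x = f y -> f y = f z ->
  [\/ x = y, y = z | x = z].

(** A conjugacy of [f] with [F] on [l]; the two graphs become two blocks of numbers under a single
    map [F]. *)
Definition numbering (V : finType) (f : V -> V) (F : nat -> nat) (l : seq nat)
    (nu : V -> nat) : Prop :=
  [/\ injective nu, forall u, nu u \in l, forall x, x \in l -> exists u, nu u = x &
      forall u, F (nu u) = nu (f u)].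

Lemma numbering_of_adjacency (V : finType) (f : V -> V) (a : seq nat) (o : nat)
    (F : nat -> nat) : adjacency_list (func_graph f) a ->
  (forall i, i < #|V| -> F (o + i.+1) = o + (nth 0 a i).+1) ->
  exists nu, numbering f F (iota o.+1 #|V|) nu.
Proof.
move=> [sz [l [l' lK l'K] adj]] FE; exists (fun u => o + (l u).+1); split.
- by move=> u v /= E; rewrite -(lK u) -(lK v); congr l'; apply: val_inj => /=; lia.
- by move=> u; rewrite mem_iota; have := ltn_ord (l u); lia.
- move=> x; rewrite mem_iota => xi; have lt : x - o.+1 < #|V| by lia.
  by exists (l' (Ordinal lt)); rewrite l'K /=; lia.
- move=> u; rewrite FE //; congr (o + _.+1); apply/eqP.
  by rewrite -adj /func_graph.
Qed.

Lemma adjacency_lt (V : finType) (f : V -> V) (a : seq nat) :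
  adjacency_list (func_graph f) a -> forall i, i < #|V| -> nth 0 a i < #|V|.
Proof.
move=> [sz [l [l' lK l'K] adj]] i lt.
have := adj (l' (Ordinal lt)) (f (l' (Ordinal lt))).
by rewrite /func_graph eqxx l'K /= => /esym/eqP->.
Qed.

(** The polynomial [p - p.[x]] still has degree 2, so it cannot have three distinct roots. *)
Lemma quadratic_fibers (R : finFieldType) (p : {poly R}) : size p = 3 ->
  fibers2 (fun _ => True) (fun x : R => p.[x])%R.
Proof.
move=> sp x y z _ _ _ xy yz.
case: (eqVneq x y) => [|nxy]; first by constructor 1.
case: (eqVneq y z) => [|nyz]; first by constructor 2.
case: (eqVneq x z) => [|nxz]; first by constructor 3.
pose q : {poly R} := (p - (p.[x])%:P)%R.
have sq : size q = 3.
  by rewrite /q size_polyDl // size_polyN sp; apply: leq_ltn_trans (size_polyC_leq1 _) _.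
have q0 : q != 0%R by rewrite -size_poly_eq0 sq.
have rt : all (root q) [:: x; y; z].
  by rewrite /= /root /q !(hornerD, hornerN, hornerC) -yz -xy !GRing.subrr eqxx.
have := max_poly_roots q0 rt; rewrite sq /= !inE negb_or nxy nxz nyz.
by move=> /(_ isT).
Qed.

Section IsoOfNumbering.
Variables (V : finType) (f g : V -> V) (n : nat) (F : nat -> nat) (nuf nug : V -> nat).
Let N := n + n.
Let lA := iota 1 n.
Let lB := iota n.+1 n.
Hypotheses (numf : numbering f F lA nuf) (numg : numbering g F lB nug).

Lemma split_real v : real N v = (v \in lA) || (v \in lB).
Proof. by rewrite !mem_iota /real /N; lia. Qed.

Lemma lAB v : v \in lA -> v \in lB = false.
Proof. by rewrite !mem_iota; lia. Qed.

Lemma F_lA v : v \in lA -> F v \in lA.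
Proof. by case: numf => _ inA surj FE /surj[u <-]; rewrite FE. Qed.

Lemma F_lB v : v \in lB -> F v \in lB.
Proof. by case: numg => _ inB surj FE /surj[u <-]; rewrite FE. Qed.

Lemma closed_lA : component_closed N F (fun v => v \in lA).
Proof.
split=> v; first by rewrite split_real => ->.
rewrite split_real => /orP[vA|vB]; first by rewrite vA F_lA.
apply/idP/idP => H; first by have := lAB H; rewrite F_lB.
by rewrite (lAB H) in vB.
Qed.

Lemma closed_lB : component_closed N F (fun v => v \in lB).
Proof.
split=> v; first by rewrite split_real orbC => ->.
rewrite split_real => /orP[vA|vB]; last by rewrite vB F_lB.
by rewrite (lAB vA) (lAB (F_lA vA)).
Qed.

Lemma numbering_fibers : fibers2 (fun _ => True) f -> fibers2 (fun _ => True) g ->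
  fibers2 (real N) F.
Proof.
move=> ff fg x y z; rewrite !split_real.
have rule (h : V -> V) nu l : numbering h F l nu -> fibers2 (fun _ => True) h ->
    x \in l -> y \in l -> z \in l -> F x = F y -> F y = F z -> [\/ x = y, y = z | x = z].
  move=> [inj inl surj FE] fh /surj[u <-] /surj[v <-] /surj[t <-].
  rewrite !FE => /inj uv /inj vt.
  by case: (fh u v t) => // ->; [constructor 1|constructor 2|constructor 3].
have sep v v' : v \in lA -> v' \in lB -> F v <> F v'.
  by move=> vA vB E; have := lAB (F_lA vA); rewrite E F_lB.
move=> /orP[xA|xB] /orP[yA|yB] /orP[zA|zB] xy yz; try exact: rule numf ff _ _ _ _ _;
  try exact: rule numg fg _ _ _ _ _.
- by case: (sep _ _ yA zB).
- by case: (sep _ _ xA yB).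
- by case: (sep _ _ xA yB).
- by case: (sep _ _ yA xB).
- by case: (sep _ _ yA xB).
- by case: (sep _ _ zA yB).
Qed.

Variable ans : bool.
Hypothesis out : outcome n F ans.
Variable v0 : V.

Lemma outcome_iso : ans <-> digraph_iso (func_graph f) (func_graph g).
Proof.
case: out => C1 C2 K CUT K2 gF nK cC nK2 ->.
case: (numf) => injf inA surjA FfE; case: (numg) => injg inB surjB FgE.
(* Inverse of a numbering, with [v0] as default outside its range. *)
pose mu (nu : V -> nat) x := odflt v0 [pick u | nu u == x].
have muK (nu : V -> nat) : injective nu -> cancel nu (mu nu).
  move=> inj u; rewrite /mu; case: pickP => /= [v /eqP/inj //|/(_ u)].
  by rewrite eqxx.
split=> [/allP counts | [phi [psi phiK psiK] iso]].
  have cnt k : k < N + 3 -> root_count (cutF F K CUT) K2 lA k = root_count (cutF F K CUT) K2 lB k.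
    by move=> kN; apply/eqP/counts; rewrite mem_iota /N in kN *; lia.
  have fF' := cut_forest CUT gF nK.
  pose T := transport N F C1 C2 K CUT K2 lA lB.
  have TP v : v \in lA -> T v \in lB.
    by move=> vA; case: (transportP gF nK cC fF' nK2 (iota_uniq _ _) (iota_uniq _ _) closed_lA closed_lB cnt vA).
  have Tinj v v' : v \in lA -> v' \in lA -> T v = T v' -> v = v'.
    exact: (transport_inj gF nK cC fF' nK2 (iota_uniq _ _) (iota_uniq _ _) closed_lA closed_lB cnt).
  have TF v : v \in lA -> F (T v) = T (F v).
    exact: (transport_F gF nK cC fF' nK2 (iota_uniq _ _) (iota_uniq _ _) closed_lA closed_lB cnt).
  pose phi u := mu nug (T (nuf u)).
  have phiE u : nug (phi u) = T (nuf u).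
    by have [v vE] := surjB _ (TP _ (inA u)); rewrite /phi -vE muK.
  have phi_inj : injective phi.
    move=> u v E; apply/injf/Tinj => //; by rewrite -!phiE E.
  exists phi; first exact: injF_bij.
  move=> u v; rewrite /func_graph.
  have -> : g (phi u) = phi (f u).
    by apply: injg; rewrite -FgE !phiE TF // FfE.
  by rewrite (inj_eq phi_inj).
have homphi u : g (phi u) = phi (f u).
  by have := iso u (f u); rewrite /func_graph eqxx => /esym/eqP.
have hompsi u : f (psi u) = psi (g u).
  by rewrite -[LHS]phiK -homphi psiK.
(* [phi] and [psi] are carried over to numbers; each gives one of two opposite inequalities between
   the counts. *)
pose P x := nug (phi (mu nuf x)); pose Q x := nuf (psi (mu nug x)).
have eP : embeds F (fun v => v \in lA) (fun v => v \in lB) P Q.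
  move=> v /surjA[u <-]; rewrite /P /Q FfE !muK // phiK.
  by split=> //; rewrite FgE homphi.
have eQ : embeds F (fun v => v \in lB) (fun v => v \in lA) Q P.
  move=> v /surjB[u <-]; rewrite /P /Q FgE !muK // psiK.
  by split=> //; rewrite FfE hompsi.
apply/allP => k _; rewrite eqn_leq; apply/andP; split.
  by apply: (root_count_le gF nK cC nK2 closed_lA closed_lB eP eQ) => //; exact: iota_uniq.
by apply: (root_count_le gF nK cC nK2 closed_lB closed_lA eQ eP) => //; exact: iota_uniq.
Qed.

End IsoOfNumbering.

(** * Base addresses of the arrays and the initial state *)

Fixpoint init_bases (k : nat) : cmd :=
  if k is k'.+1 then
    init_bases k' ;; Add (nvars + k) (nvars + k') (tmp 0)
  else Skip.

(** [vAns] is initially 0, so the first instruction reads the number of vertices. The bases are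
    multiples of [2n + 4], obtained by repeated addition as the machine has no multiplication. *)
Definition prologue : cmd :=
  Read vn vAns ;; Add vN vn vn ;; Const (tmp 0) 4 ;; Add (tmp 0) vN (tmp 0) ;;
  init_bases narrs.-1.

Definition program : cmd := prologue ;; main_loop.

Lemma exec_init_bases m w S k r : k < narrs -> narrs * S <= 2 ^ w ->
  (forall A, A < narrs -> reg r (nvars + A) = 0) -> reg r (tmp 0) = S ->
  exists r', [/\ exec m w (init_bases k) r (k + 1) r', Defs.mem r' = Defs.mem r,
    reg r' (tmp 0) = S, forall A, A <= k -> reg r' (nvars + A) = A * S &
    forall i, i < nvars -> reg r' i = reg r i].
Proof.
move=> kn Sw r0 rS; elim: k kn => [|k IH] kn.
  exists r; split=> //; first exact: ExecSkip.
  by case=> // _; rewrite r0.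
have [r1 [E1 M1 S1 B1 V1]] := IH (ltnW kn).
have kS : k * S + S = k.+1 * S by rewrite mulSn addnC.
have lt : k.+1 * S < 2 ^ w.
  case: (posnP S) => [->|S0]; first by rewrite muln0 expn_gt0.
  by apply: leq_trans Sw; rewrite ltn_pmul2r.
exists (set_reg r1 (nvars + k.+1) (reg r1 (nvars + k) + reg r1 (tmp 0))); split=> //.
- have -> : k.+1 + 1 = (k + 1) + 1 by lia.
  by apply: ExecSeq E1 _; apply: ExecAdd; rewrite B1 // S1 kS.
- by rewrite /= upd_neq // /tmp; lia.
- move=> A; rewrite leq_eqVlt => /orP[/eqP->|lA] /=; first by rewrite updE B1 // S1 kS.
  by rewrite upd_neq ?B1 //; lia.
- by move=> i lti /=; rewrite upd_neq ?V1 //; lia.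
Qed.

Lemma prologue_rep m w a1 a2 n : size a1 = n -> size a2 = n ->
  let S := n + n + 4 in narrs * S <= m -> narrs * S <= 2 ^ w ->
  exists r s, [/\ exec m w prologue (initial_state a1 a2) 16 r, rep S s r,
    var s vn = n /\ var s vN = n + n, arr s aF = nth 0 (input_words a1 a2) &
    forall A x, 0 < A -> arr s A x = 0].
Proof.
move=> s1 s2 S Sm Sw.
have Sw' : 12 * S <= 2 ^ w by exact: Sw.
have Sm' : 12 * S <= m by exact: Sm.
set r0 := initial_state a1 a2.
pose ra := set_reg r0 vn n.
pose rb := set_reg ra vN (n + n).
pose rc := set_reg rb (tmp 0) 4.
pose rd := set_reg rc (tmp 0) S.
have B0 A : A < narrs -> reg rd (nvars + A) = 0.
  by move=> lt; rewrite /rd /rc /rb /ra /= !upd_neq //; rewrite /tmp; lia.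
have [r [Er Mr Sr Br Vr]] := @exec_init_bases m w S narrs.-1 rd isT Sw B0 erefl.
exists r, (HState (fun i => if i < nvars then reg rd i else 0)
  (fun A x => if A == 0 then nth 0 (input_words a1 a2) x else 0)); split=> //.
- have -> : 16 = 1 + (1 + (1 + (1 + (narrs.-1 + 1)))) by [].
  apply: ExecSeq; first by apply: ExecRead => /=; lia.
  have -> : set_reg r0 vn (Defs.mem r0 (reg r0 vAns)) = ra by rewrite /ra /= s1.
  apply: ExecSeq; first by apply: ExecAdd => /=; rewrite /upd /=; lia.
  apply: ExecSeq; first by apply: ExecConst; lia.
  apply: ExecSeq; first by apply: ExecAdd => /=; rewrite /upd /=; lia.
  exact: Er.
- split=> [i lti|A ltA|A x ltA ltx] /=.
  + by rewrite lti Vr.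
  + by rewrite Br //; lia.
  + rewrite Mr /=; case: eqP => [->|A0]; first by rewrite mul0n.
    (* The [2n + 1] words of the input fit in the first array, so the others start in zeroed
       memory. *)
    rewrite nth_default // /input_words /= size_cat s1 s2.
    by case: A A0 ltA => // A _ _; rewrite mulSn /S; lia.
- by move=> A x A0 /=; case: eqP A0 => // ->.
Qed.


Theorem theorem12 :
  exists (P : cmd) (C : nat),
  forall (F : finFieldType) (p1 p2 : {poly F}) (a1 a2 : seq nat),
    size p1 = 3 -> size p2 = 3 ->
    let G := func_graph (fun x : F => (p1.[x])%R) in
    let H := func_graph (fun x : F => (p2.[x])%R) in
    adjacency_list G a1 -> adjacency_list H a2 ->
    exists (m w t : nat) (ans : bool),
      [/\ computes m w P a1 a2 t ans,
          ans <-> digraph_iso G H,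
          bit_time w t <= C * (bit_size a1 + bit_size a2) &
          bit_memory m w P <= C * (bit_size a1 + bit_size a2)].
Proof.
(* At most [20000 n] steps and [(100 + k) n] words, [k] being the number of registers, are charged
   [w <= 7u] bits each; the bit sizes add up to [2nu]. *)
exists program, (200 * 1000 + 7 * num_regs program) => R p1 p2 a1 a2 sp1 sp2 G H adj1 adj2.
set n := #|R|.
have n2 : 1 < n by exact: card_finNzRing_gt1.
have sz1 : size a1 = n by case: adj1.
have sz2 : size a2 = n by case: adj2.
pose N := n + n; pose u := up_log 2 n.
have u0 : 0 < u by rewrite up_log_gt0.
(* Six more bits than [u] suffice for all addresses: [12 (2n + 4) <= 64 n] as [n] is at least 2. *)
pose w := u + 6; pose m := narrs * (N + 4).
have nu : n <= 2 ^ u by exact: up_logP.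
have wE : 2 ^ w = 64 * 2 ^ u by rewrite /w expnD mulnC.
have Sw : narrs * (N + 4) <= 2 ^ w by rewrite wE /narrs /N; lia.
have Sm : narrs * (N + 4) <= m by [].
pose inp := nth 0 (input_words a1 a2).
pose F x := inp x + (if x <= n then 1 else n.+1).
have lt1 := adjacency_lt adj1; have lt2 := adjacency_lt adj2.
have inp1 i : i < n -> inp i.+1 = nth 0 a1 i.
  by move=> lt; rewrite /inp /= nth_cat sz1 lt.
have inp2 i : i < n -> inp (n + i.+1) = nth 0 a2 i.
  by move=> lt; rewrite /inp addnS /= nth_cat sz1 ltnNge leq_addr /= addKn.
have [nu1 num1] := @numbering_of_adjacency _ _ a1 0 F adj1
  ltac:(by move=> i lt; rewrite !add0n /F inp1 // lt addn1).
have [nu2 num2] : exists nu2, numbering (fun x : R => p2.[x])%R F (iota n.+1 n) nu2.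
  apply: numbering_of_adjacency adj2 _ => i lt.
  by rewrite /F inp2 // ifF; lia.
have a_lt x : real N x -> inp x < n.
  move=> rx; case: (leqP x n) => xn.
    have [xE xl] : x = x.-1.+1 /\ x.-1 < n by move: rx; rewrite /real; lia.
    by rewrite xE inp1 //; exact: lt1.
  have xE : x = n + (x - n).-1.+1 by lia.
  have xl : (x - n).-1 < n by move: rx; rewrite /real /N; lia.
  by rewrite xE inp2 //; exact: lt2.
have F2 := numbering_fibers num1 num2 (quadratic_fibers sp1) (quadratic_fibers sp2).
have [r [s [E0 R0 [nE NE] aE Z]]] := prologue_rep sz1 sz2 Sm Sw.
have [t [r' [s' [E1 R1 [ans [ansE out t_le]]]]]] :=
  @wp_main_loop m w n Sm Sw F inp (fun x _ => erefl) a_lt F2 s nE NE aE Z r R0.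
exists m, w, (16 + t), ans; split.
- split.
  + by rewrite /input_words /= size_cat sz1 sz2 /m /narrs /N; lia.
  + rewrite /input_words /= all_cat; apply/and3P; split; first by rewrite sz1 wE; lia.
      apply/allP => x /(nthP 0)[i]; rewrite sz1 => lt <-.
      by apply: leq_trans (lt1 _ lt) _; rewrite wE -/n; lia.
    apply/allP => x /(nthP 0)[i]; rewrite sz2 => lt <-.
    by apply: leq_trans (lt2 _ lt) _; rewrite wE -/n; lia.
  + exists r'; first exact: ExecSeq E0 E1.
    by case: R1 => -> // _ _; rewrite ansE.
- exact: (outcome_iso num1 num2 out 0%R).
- rewrite /bit_time /bit_size sz1 sz2 -/u /w.
  have T : 16 + t <= 20 * 1000 * n by rewrite /N in t_le; lia.
  have W : u + 6 <= 7 * u by lia.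
  apply: leq_trans (leq_mul T W) _; nia.
- rewrite /bit_memory /bit_size sz1 sz2 -/u /w.
  set k := num_regs program.
  have M : m + k <= (100 + k) * n by rewrite /m /narrs /N; nia.
  have W : u + 6 <= 7 * u by lia.
  apply: leq_trans (leq_mul M W) _; nia.
Qed.
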